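(* Let $M$ be $\mathbb{R}^3$ or $S^3$ with a fixed Riemannian metric, $K$ a knot type in $M$, $\gamma_*\in\mathcal{E}_K(M)$ and $\Lambda_*=\operatorname{Rop}(\gamma_* )$. For any cofinal sequence $\Lambda_*\le\Lambda_1<\Lambda_2<\cdots\to\infty$ the canonical map from the mapping telescope $$\operatorname{Tel}\bigl(\mathcal{E}_{K,\Lambda_1}(M)\to\mathcal{E}_{K,\Lambda_2}(M)\to\cdots\bigr)\longrightarrow\mathcal{E}_K(M)$$ of the inclusions is a weak homotopy equivalence.
   Context: $\operatorname{Emb}^\infty(S^1,M)$ is the space of smooth embeddings with the $C^\infty$ topology; $\mathcal{E}_K(M)$ is its path component consisting of embeddings of (oriented) knot type $K$. For an embedded closed curve $\gamma$ in $M$, $\operatorname{Len}(\gamma)$ is its length and its thickness $\operatorname{Thi}(\gamma)$ is the normal injectivity radius: the supremum of the radii for which the normal exponential map of $\gamma$ is an embedding. The ropelength is $\operatorname{Rop}(\gamma)=\operatorname{Len}(\gamma)/\operatorname{Thi}(\gamma)$, and $\mathcal{E}_{K,\Lambda}(M)=\{\gamma\in\mathcal{E}_K(M):\operatorname{Rop}(\gamma)\le\Lambda\}$. *)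

(* Defs.v *)
From HB Require Import structures.
From Stdlib Require Import Relation_Operators.
From mathcomp Require Import all_boot all_order all_algebra generic_quotient.
From mathcomp Require Import all_classical all_reals all_analysis.
Set Implicit Arguments.
Unset Strict Implicit.
Unset Printing Implicit Defensive.
Import Order.TTheory GRing.Theory Num.Theory.
Import numFieldNormedType.Exports.
Local Open Scope classical_set_scope.
Local Open Scope ring_scope.
Local Open Scope quotient_scope.

Section SmoothMaps.
Variables (R : realType) (V W : normedModType R).

(* For [U] open in a finite-dimensional [V], asking for all directional
   derivatives is the same as asking for all partial derivatives. *)
Fixpoint Cn (k : nat) (U : set V) (f : V -> W) : Prop :=
  (forall x, U x -> {for x, continuous f}) /\
  (if k is k'.+1 then
     forall v, (forall x, U x -> derivable f x v) /\ Cn k' U ('D_v f)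
   else True).

Definition smooth (U : set V) (f : V -> W) : Prop := forall k, Cn k U f.

(* Smoothness on an arbitrary subset of a vector space: local existence of
   smooth extensions to open sets. *)
Definition smooth_on (A : set V) (f : V -> W) : Prop :=
  forall x, A x -> exists U F,
    [/\ open U, U x, smooth U F & forall y, (U `&` A) y -> F y = f y].

End SmoothMaps.

Section Submanifolds.
Variables (R : realType) (V W : normedModType R).

Definition curve_in (U : normedModType R) (A : set U) (x : U) (c : R -> U) :=
  c 0 = x /\ exists2 e : R, 0 < e &
    smooth (`]- e, e[%classic : set R^o) (c : R^o -> U) /\
    forall t, - e < t < e -> A (c t).

Definition tangent (A : set V) (x v : V) : Prop :=
  exists2 c, curve_in A x c & derive1 c 0 = v.

(* The image under the differential of [f] of the velocity at 0 of a curve [c]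
   in [A] is the velocity at 0 of [f \o c]. *)
Definition immersion (A : set V) (f : V -> W) : Prop :=
  forall x c, A x -> curve_in A x c ->
    derive1 c 0 != 0 -> derive1 (f \o c) 0 != 0.

(* Continuity on [A] is part of [smooth_on]; the last clause is the continuity
   of the inverse map from [f @` A] to [A]. *)
Definition smooth_embedding (A : set V) (B : set W) (f : V -> W) : Prop :=
  [/\ (forall x, A x -> B (f x)), smooth_on A f, immersion A f,
      {in A &, injective f} &
      forall x, A x -> forall P, nbhs x P ->
        exists2 Q, nbhs (f x) Q & forall y, A y -> Q (f y) -> P y].

End Submanifolds.

Section Metric.
Variables (R : realType) (n : nat).
Implicit Types (M : set 'rV[R]_n) (u v x : 'rV[R]_n).

Definition pairing (A : 'M[R]_n) u v : R := (u *m A *m v^T) 0 0.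

(* A Riemannian metric on a closed submanifold [M] of R^n, given by a smooth
   field of symmetric bilinear forms on R^n that is positive definite on the
   tangent spaces of [M]; only its values on pairs of tangent vectors of [M]
   matter below.  Every smooth metric on [M] arises in this way, by extending
   it to R^n. *)
Record riemannian_metric M := RiemannianMetric {
  metric_at :> 'rV[R]_n -> 'M[R]_n ;
  metric_smooth : smooth setT metric_at ;
  metric_sym : forall x, (metric_at x)^T = metric_at x ;
  metric_pos : forall x v, M x -> tangent M x v -> v != 0 ->
    0 < pairing (metric_at x) v v }.

End Metric.

Section Geodesics.
Variables (R : realType) (n : nat) (M : set 'rV[R]_n).
Variable g : riemannian_metric M.
Implicit Types (u v x y : 'rV[R]_n) (c : R -> 'rV[R]_n).

(* [christoffel x u v] is the sum of Gamma_(ij,k) u_i u_j v_k, with the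
   Christoffel symbols of the first kind
   Gamma_(ij,k) = (d_i g_jk + d_j g_ik - d_k g_ij) / 2. *)
Definition christoffel x u v : R :=
  pairing ('D_u g x) u v - 2^-1 * pairing ('D_v g x) u u.

(* The equation says that the covariant acceleration of [c] is [g]-orthogonal
   to [M], i.e. that its covariant derivative for the Levi-Civita connection of
   the metric induced on [M] vanishes; it only depends on the induced metric. *)
Definition geodesic (J : set R) c : Prop :=
  [/\ smooth (J : set R^o) (c : R^o -> 'rV[R]_n), (forall t, J t -> M (c t)) &
      forall t v, J t -> tangent M (c t) v ->
        pairing (g (c t)) (derive1n 2 c t) v
          + christoffel (c t) (derive1 c t) v = 0].

Definition exp_value (p : 'rV[R]_n * 'rV[R]_n) y : Prop :=
  exists2 e : R, 0 < e & exists c,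
    [/\ geodesic `]- e, 1 + e[%classic c, c 0 = p.1,
        derive1 c 0 = p.2 & c 1 = y].

Definition exp_domain : set ('rV[R]_n * 'rV[R]_n) :=
  [set p | exists y, exp_value p y].

(* By uniqueness of geodesics [exp_value p] has at most one element; outside
   of [exp_domain] the value of [Exp] is irrelevant. *)
Definition Exp (p : 'rV[R]_n * 'rV[R]_n) : 'rV[R]_n := xget 0 (exp_value p).

End Geodesics.

Section Embeddings.
Variables (R : realType) (n : nat) (M : set 'rV[R]_n).

Definition circle : set 'rV[R]_2 :=
  [set p | p 0 0 ^+ 2 + p 0 1 ^+ 2 = 1].

Definition turn (t : R) : 'rV[R]_2 :=
  \row_(j < 2) (if j == 0 then cos t else sin t).

(* A smooth embedding [f] of the circle is represented by its lift
   [f \o turn], a 2 pi-periodic function that determines [f] on the circle. *)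
Definition embedded_loop : set (R -> 'rV[R]_n) :=
  [set c | exists2 f, smooth_embedding circle M f & c = f \o turn].

Definition jets (c : embedded_loop) :
    {ptws nat -> {uniform R -> 'rV[R]_n}} :=
  fun k => derive1n k (set_val c).

(* The C^oo topology: uniform convergence of every derivative. *)
Definition Emb : topologicalType := initial_topology jets.

Definition loop (c : Emb) : R -> 'rV[R]_n := set_val (c : embedded_loop).

End Embeddings.

Section Ropelength.
Variables (R : realType) (n : nat) (M : set 'rV[R]_n).
Variable g : riemannian_metric M.
Implicit Types (c : Emb M) (r : R).
Local Notation mu := (@lebesgue_measure R).

Definition Len c : R :=
  Rintegral mu `[0, 2 * pi]%classic
    (fun t => let v := derive1 (loop c) t in
      Num.sqrt (pairing (g (loop c t)) v v)).

(* The open [r]-disc bundle of the normal bundle of the curve in [M]. *)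
Definition normal_disc_bundle c r : set ('rV[R]_n * 'rV[R]_n) :=
  [set p | exists t, [/\ p.1 = loop c t, tangent M p.1 p.2,
     pairing (g p.1) p.2 (derive1 (loop c) t) = 0 &
     pairing (g p.1) p.2 p.2 < r ^+ 2]].

Definition embedding_radius c r : Prop :=
  [/\ 0 < r, normal_disc_bundle c r `<=` exp_domain g &
      smooth_embedding (normal_disc_bundle c r) M (Exp g)].

Definition Thi c : \bar R := ereal_sup [set r%:E | r in embedding_radius c].

Definition Rop c : \bar R := ((Len c)%:E / Thi c)%E.

End Ropelength.

Section WeakEquivalences.
Variable R : realType.

Definition cube (n : nat) : set 'rV[R]_n :=
  [set s | forall i, 0 <= s 0 i <= 1].

Definition cube_boundary (n : nat) : set 'rV[R]_n :=
  [set s | cube s /\ exists i, s 0 i = 0 \/ s 0 i = 1].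

Definition joined (X : topologicalType) (x y : X) : Prop :=
  exists p : R -> X, [/\ {within `[0, 1]%classic, continuous p}, p 0 = x & p 1 = y].

Definition path_component (X : topologicalType) (x : X) : set X :=
  [set y | joined x y].

(* Based maps of pairs (cube, boundary) -> (X, x); values off the cube are
   irrelevant here and in [homotopic]. *)
Definition spheroid (X : topologicalType) (x : X) n (a : 'rV[R]_n -> X) :=
  {within @cube n, continuous a} /\ forall s, cube_boundary s -> a s = x.

Definition homotopic (X : topologicalType) (x : X) n (a b : 'rV[R]_n -> X) :=
  exists H : R * 'rV[R]_n -> X,
    [/\ {within `[0, 1]%classic `*` @cube n, continuous H},
        forall s, cube s -> H (0, s) = a s /\ H (1, s) = b s &
        forall t s, 0 <= t <= 1 -> cube_boundary s -> H (t, s) = x].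

(* [f] is bijective on pi_0 and on pi_n for n >= 1 and every base point.  The
   induced maps on pi_n are group morphisms for any continuous [f]. *)
Definition weak_homotopy_equivalence (X Y : topologicalType) (f : X -> Y) :=
  [/\ continuous f,
      (forall x x', joined (f x) (f x') -> joined x x'),
      (forall y, exists x, joined (f x) y),
      (forall n x a b, (0 < n)%N -> @spheroid X x n a -> @spheroid X x n b ->
         homotopic (f x) (f \o a) (f \o b) -> homotopic x a b) &
      (forall n x b, (0 < n)%N -> @spheroid Y (f x) n b ->
         exists2 a, @spheroid X x n a & homotopic (f x) (f \o a) b)].

End WeakEquivalences.

Section Telescope.
Variable R : realType.
Variables (X : nat -> topologicalType) (f : forall i, X i -> X i.+1).

Local Notation I := (`[0, 1]%classic : set R).

Definition cylinders : topologicalType := {i & (X i * I)%type}.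

Definition glue (p q : cylinders) : Prop :=
  exists i (x : X i) (s t : I),
    [/\ set_val s = 1, set_val t = 0, p = existT _ i (x, s) &
        q = existT _ i.+1 (f x, t)].

Definition tel_rel : rel cylinders :=
  fun p q => `[< clos_refl_sym_trans _ glue p q >].

Lemma tel_rel_refl : reflexive tel_rel.
Proof. by move=> p; apply/asboolP; exact: rst_refl. Qed.

Lemma tel_rel_sym : symmetric tel_rel.
Proof. by move=> p q; apply/asboolP/asboolP; exact: rst_sym. Qed.

Lemma tel_rel_trans : transitive tel_rel.
Proof.
by move=> q p r /asboolP pq /asboolP qr; apply/asboolP; exact: rst_trans pq qr.
Qed.

Definition tel_equiv := EquivRel _ tel_rel_refl tel_rel_sym tel_rel_trans.

Definition telescope : topologicalType :=
  quotient_topology {eq_quot tel_equiv}.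

(* The map induced by a cocone on [X]; see [tel_descE]. *)
Definition tel_desc (Y : Type) (h : forall i, X i -> Y) (q : telescope) : Y :=
  let p := repr q in h (projT1 p) (projT2 p).1.

Lemma tel_descE (Y : Type) (h : forall i, X i -> Y) :
  (forall i x, h i.+1 (f x) = h i x) ->
  forall p : cylinders,
    tel_desc h (\pi_telescope p) = h (projT1 p) (projT2 p).1.
Proof.
move=> hf p; rewrite /tel_desc.
have : tel_rel (repr (\pi_telescope p)) p.
  have /eqmodP := reprK (\pi_telescope p); exact.
move: (repr _) => q /asboolP; elim=> {p q}.
- by move=> p q [i [x [s [t [_ _ -> ->]]]]]; rewrite /= hf.
- by [].
- by move=> p q _ ->.
- by move=> p q r _ -> _ ->.
Qed.

End Telescope.

Section Inclusions.
Variables (T : topologicalType).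

Definition incl (A B : set T) (AB : A `<=` B) (x : A) : B :=
  exist _ (set_val x) (mem_set (AB _ (set_mem (valP x)))).

Definition tel_inclusion (R : realType) (A : nat -> set T) (B : set T)
    (AS : forall i, A i `<=` A i.+1) (AB : forall i, A i `<=` B) :
    telescope R (fun i => incl (AS i)) -> B :=
  tel_desc (fun i => incl (AB i)).

End Inclusions.

Section Knots.
Variable R : realType.

Variant model_space := Euclidean3 | Sphere3.

Definition ambient_dim (X : model_space) : nat :=
  match X with Euclidean3 => 3 | Sphere3 => 4 end.

Definition points (X : model_space) : set 'rV[R]_(ambient_dim X) :=
  match X with
  | Euclidean3 => setT
  | Sphere3 => [set x : 'rV[R]_4 | \sum_i x 0 i ^+ 2 = 1]
  end.

Variables (n : nat) (M : set 'rV[R]_n) (g : riemannian_metric M).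

(* An oriented knot type is encoded by the path component E_K of the space of
   embeddings that it determines. *)
Definition knot_type (K : set (Emb M)) : Prop :=
  exists c, K = path_component R c.

Definition Rop_sublevel (K : set (Emb M)) (L : R) : set (Emb M) :=
  [set c | K c /\ (Rop g c <= L%:E)%E].

Lemma Rop_sublevel_sub K L : Rop_sublevel K L `<=` K.
Proof. by move=> c []. Qed.

Lemma Rop_sublevel_le K L L' : L < L' ->
  Rop_sublevel K L `<=` Rop_sublevel K L'.
Proof.
move=> LL' c [Kc cL]; split => //; apply: le_trans cL _.
by rewrite lee_fin ltW.
Qed.

End Knots.
Arguments points : clear implicits.
Arguments Rop_sublevel_sub [R n M] g K L _ _.
Arguments Rop_sublevel_le [R n M] g K [L L'] _ _ _.
Arguments tel_inclusion [T] R [A B] AS AB _.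

(* Main.v *)
(** If the normal exponential map of a loop [c] satisfies
    [|Exp (c t, v) - Exp (c s, w)| >= d * (|c t - c s| + |v - w|)] for normal
    vectors shorter than [d], then [d] is at most the thickness of [c].  Such a
    [d > 0] exists simultaneously for all loops that are C^2-close to a given
    one: near the diagonal because [Exp (p, v)] is C^1-close to [p + v], as the
    geodesics are the trajectories of a smooth second order system on the
    ambient vector space, and away from the diagonal by continuity.  As the
    length is also locally bounded, the ropelength is locally bounded, and every
    compact set of loops lies in a sublevel set of the ropelength.

    A point of the telescope is determined by its image and its height, and
    pushing points up to a prescribed height is continuous.  A compact family in
    the target therefore lifts at every large integral height, and over a
    collar of the cube the base point is pushed up to that height. *)

From HB Require Import structures.
From Stdlib Require Import Relation_Operators.
Require Import Defs.
From mathcomp Require Import all_boot all_order all_algebra generic_quotient.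
From mathcomp Require Import all_classical all_reals all_analysis.
From mathcomp Require Import ring lra.
Set Implicit Arguments.
Unset Strict Implicit.
Unset Printing Implicit Defensive.
Import Order.TTheory GRing.Theory Num.Theory.
Import numFieldNormedType.Exports.
Local Open Scope classical_set_scope.
Local Open Scope ring_scope.

(** * Calculus of [Cn] maps *)

(** Both ambient spaces are zero sets of [b%:R * (dot x x - 1)], with [b = false] for the Euclidean
    space and [b = true] for the sphere, and are treated by the same formulas. The metric may be
    incomplete and is positive definite only on tangent vectors of [M], so the geodesic equation has
    to be extended to an open subset of the ambient vector space. There it becomes the second order
    system given by [spray], for which existence, uniqueness and smooth dependence are derived from
    Picard iteration. This also yields the ambient smooth extensions of [Exp] that [smooth_on] asks
    for. Since the spray is quadratic in the velocity, its derivative vanishes at zero velocity;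
    this is the source of the C^1-closeness of [Exp] to addition. Two derivatives of the loop enter
    because the covector that cuts out the normal space involves the first one and must vary at a
    bounded rate along the curve. *)

Section MatrixNorm.
Variables (R : realType) (p q : nat).
Implicit Types x : 'M[R]_(p, q).

Lemma ler_mx_entry x i j : `|x i j| <= `|x|.
Proof.
rewrite [leRHS]/Num.Def.normr/= mx_normrE.
exact: (le_bigmax _ (fun k : 'I_p * 'I_q => `|x k.1 k.2|) (i, j)).
Qed.

Lemma mx_norm_le x (K : R) : 0 <= K -> (forall i j, `|x i j| <= K) -> `|x| <= K.
Proof.
move=> K0 xK; rewrite [leLHS]/Num.Def.normr/= mx_normrE.
by apply: bigmax_le => // -[i j] _; exact: xK.
Qed.

Lemma mx_continuousP (T : topologicalType) (f : T -> 'M[R]_(p, q)) (t : T) :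
  {for t, continuous f} <->
  forall i j, {for t, continuous (fun s => f s i j : R)}.
Proof.
split=> [cf i j|cf].
  apply: (@continuous_comp _ _ _ f (fun M : 'M[R]_(p, q) => M i j)) => //.
  exact: coord_continuous.
apply/cvgrPdist_le => /= e e0.
near=> s; apply: mx_norm_le => [|i j]; first exact: ltW.
rewrite !mxE.
move: i j; near: s; apply: filter_forall => i; apply: filter_forall => j.
exact: ((cvgrPdist_le _ _).1 (cf i j)).
Unshelve. all: by end_near. Qed.

End MatrixNorm.

Section CnBasics.
Variables (R : realType) (V W : normedModType R).
Implicit Types (U : set V) (f g : V -> W).

Lemma open_near U x : open U -> U x -> \forall y \near x, U y.
Proof. by move=> oU Ux; exact: open_nbhs_nbhs. Qed.

Lemma Cn_cont k U f x : Cn k U f -> U x -> {for x, continuous f}.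
Proof. by case: k => [|k] [+ _]; apply. Qed.

Lemma Cn_derivable k U f x v : Cn k.+1 U f -> U x -> derivable f x v.
Proof. by case=> _ /(_ v)[+ _]; apply. Qed.
Arguments Cn_derivable [k U f x] v.

Lemma Cn_derive k U f v : Cn k.+1 U f -> Cn k U ('D_v f).
Proof. by case=> _ /(_ v)[]. Qed.
Arguments Cn_derive [k U f] v.

(** Openness of [U] turns equality on [U] into equality near each point, which is all that
    derivatives see. The basic closure properties below are proved by induction on [k] after
    replacing the derivative on [U] by a formula with this lemma. *)
Lemma eq_Cn k U f g : open U -> (forall x, U x -> f x = g x) ->
  Cn k U f -> Cn k U g.
Proof.
move=> oU; elim: k f g => [|k IH] f g fg [cf df].
  split=> // x Ux; have nfg : {near x, f =1 g}.
    by apply: filterS (open_near oU Ux) => y; exact: fg.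
  change (g @ x --> g x); rewrite -(fg x Ux); apply: cvg_trans (cf x Ux).
  by apply: near_eq_cvg; apply: filterS nfg => y ->.
have nfg x : U x -> {near x, f =1 g}.
  by move=> Ux; apply: filterS (open_near oU Ux) => y; exact: fg.
split=> [x Ux|v].
  change (g @ x --> g x); rewrite -(fg x Ux); apply: cvg_trans (cf x Ux).
  by apply: near_eq_cvg; apply: filterS (nfg x Ux) => y ->.
have [d1 d2] := df v; split=> [x Ux|].
  by apply: near_eq_derivable (d1 x Ux); exact: nfg.
by apply: IH d2 => x Ux; apply: near_eq_derive; exact: nfg.
Qed.

Lemma sub_Cn k U U' f : U' `<=` U -> Cn k U f -> Cn k U' f.
Proof.
move=> UU'; elim: k f => [|k IH] f [cf df].
  by split=> // x /UU'; exact: cf.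
split=> [x /UU'|v]; first exact: cf.
have [d1 d2] := df v; split=> [x /UU'|]; [exact: d1|exact: IH].
Qed.

Lemma CnW k U f : Cn k.+1 U f -> Cn k U f.
Proof.
elim: k f => [|k IH] f [cf df]; first by split.
by split=> // v; have [d1 d2] := df v; split=> //; exact: IH.
Qed.

Lemma Cn_cst k U (w : W) : open U -> Cn k U (cst w).
Proof.
move=> oU; elim: k w => [|k IH] w; first by split=> // x _; exact: cvg_cst.
split=> [x _|v]; first exact: cvg_cst.
split=> [x _|]; first exact: derivable_cst.
by apply: (@eq_Cn _ _ (cst 0)) (IH 0) => // x _; rewrite derive_cst.
Qed.

Lemma CnD k U f g : open U -> Cn k U f -> Cn k U g ->
  Cn k U (fun x => f x + g x).
Proof.
move=> oU; elim: k f g => [|k IH] f g Cf Cg.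
  by split=> // x Ux; apply: continuousD; [exact: (Cn_cont Cf)|exact: (Cn_cont Cg)].
split=> [x Ux|v].
  by apply: continuousD; [exact: (Cn_cont Cf)|exact: (Cn_cont Cg)].
split=> [x Ux|].
  exact: derivableD (Cn_derivable v Cf Ux) (Cn_derivable v Cg Ux).
apply: (eq_Cn oU) (IH _ _ (Cn_derive v Cf) (Cn_derive v Cg)) => x Ux.
apply/esym; exact: deriveD (Cn_derivable v Cf Ux) (Cn_derivable v Cg Ux).
Qed.

Lemma CnZ k U (a : R) f : open U -> Cn k U f -> Cn k U (fun x => a *: f x).
Proof.
move=> oU; elim: k f => [|k IH] f Cf.
  by split=> // x Ux; apply: continuousZl_tmp; exact: (Cn_cont Cf).
split=> [x Ux|v].
  by apply: continuousZl_tmp; exact: (Cn_cont Cf).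
split=> [x Ux|].
  exact: derivableZ (Cn_derivable v Cf Ux).
apply: (eq_Cn oU) (IH _ (Cn_derive v Cf)) => x Ux.
apply/esym; exact: deriveZ _ (Cn_derivable v Cf Ux).
Qed.

Lemma Cn_sum k U (I : Type) (r : seq I) (P : pred I) (f : I -> V -> W) :
  open U -> (forall i, P i -> Cn k U (f i)) ->
  Cn k U (fun x => \sum_(i <- r | P i) f i x).
Proof.
move=> oU Cf; elim: r => [|i r IH].
  by apply: (eq_Cn oU) (Cn_cst k 0 oU) => x _; rewrite big_nil.
case: (boolP (P i)) => Pi.
  by apply: (eq_Cn oU) (CnD oU (Cf i Pi) IH) => x _; rewrite big_cons Pi.
by apply: (eq_Cn oU) IH => x _; rewrite big_cons (negbTE Pi).
Qed.

Lemma CnS k U f : (forall x, U x -> {for x, continuous f}) ->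
  (forall v, (forall x, U x -> derivable f x v) /\ Cn k U ('D_v f)) ->
  Cn k.+1 U f.
Proof. by []. Qed.

End CnBasics.
Arguments Cn_derivable {R V W k U f x} v.
Arguments Cn_derive {R V W k U f} v.

Section CnScalar.
Variables (R : realType) (V : normedModType R).
Implicit Types (U : set V) (f g : V -> R^o).

Lemma CnM k U f g : open U -> Cn k U f -> Cn k U g ->
  Cn k U (fun x => f x * g x : R^o).
Proof.
move=> oU; elim: k f g => [|k IH] f g Cf Cg.
  by split=> // x Ux; apply: continuousM; [exact: (Cn_cont Cf)|exact: (Cn_cont Cg)].
apply: CnS => [x Ux|v].
  by apply: continuousM; [exact: (Cn_cont Cf)|exact: (Cn_cont Cg)].
split=> [x Ux|].
  exact: derivableM (Cn_derivable v Cf Ux) (Cn_derivable v Cg Ux).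
apply: (@eq_Cn _ _ _ _ _ (fun x => f x * 'D_v g x + g x * 'D_v f x)) => // [x Ux|].
  apply/esym; exact: deriveM (Cn_derivable v Cf Ux) (Cn_derivable v Cg Ux).
apply: CnD => //; apply: IH; do ?[exact: CnW|exact: Cn_derive].
Qed.

(** The derivative [- f^-1 f^-1 f'] again contains [f^-1], so the induction on [k] runs with [f]
    fixed and rests on the product rule. *)
Lemma Cn_inv k U f : open U -> (forall x, U x -> f x != 0) -> Cn k U f ->
  Cn k U (fun x => (f x)^-1 : R^o).
Proof.
move=> oU f0; elim: k => [|k IH] Cf.
  by split=> // x Ux; apply: continuousV; [exact: f0|exact: (Cn_cont Cf)].
apply: CnS => [x Ux|v].
  by apply: continuousV; [exact: f0|exact: (Cn_cont Cf)].
split=> [x Ux|].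
  by apply: derivableV; [exact: f0|exact: (Cn_derivable v Cf)].
apply: (@eq_Cn _ _ _ _ _ (fun x => (-1 : R) *: ((f x)^-1 * (f x)^-1 * 'D_v f x))) => // [x Ux|].
  rewrite deriveV ?f0//; last exact: (Cn_derivable v Cf).
  by rewrite scaleN1r /GRing.scale/= -exprVn expr2 mulNr.
apply: CnZ => //; apply: CnM => //; last exact: Cn_derive.
by apply: CnM => //; apply: IH; exact: CnW.
Qed.

Lemma Cn_prod k U (I : Type) (r : seq I) (P : pred I) (f : I -> V -> R^o) :
  open U -> (forall i, P i -> Cn k U (f i)) ->
  Cn k U (fun x => \prod_(i <- r | P i) f i x : R^o).
Proof.
move=> oU Cf; elim: r => [|i r IH].
  by apply: (eq_Cn oU) (Cn_cst k (1 : R^o) oU) => x _; rewrite big_nil.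
case: (boolP (P i)) => Pi.
  by apply: (eq_Cn oU) (CnM oU (Cf i Pi) IH) => x _; rewrite big_cons Pi.
by apply: (eq_Cn oU) IH => x _; rewrite big_cons (negbTE Pi).
Qed.

End CnScalar.

Section CnMatrix.
Variables (R : realType) (V : normedModType R).
Implicit Types (U : set V).

Lemma Cn_mxP p q k U (M : V -> 'M[R]_(p, q)) : open U ->
  Cn k U M <-> forall i j, Cn k U (fun x => M x i j : R^o).
Proof.
move=> oU; elim: k M => [|k IH] M; split.
- case=> cM _ i j; split=> // x Ux; exact: ((mx_continuousP _ _).1 (cM x Ux)).
- move=> cM; split=> // x Ux; apply/mx_continuousP => i j.
  by have [+ _] := cM i j; apply.
- move=> [cM dM] i j; apply: CnS => [x Ux|v].
    exact: ((mx_continuousP _ _).1 (cM x Ux)).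
  have [d1 d2] := dM v; split=> [x Ux|].
    exact: ((derivable_mxP _ _ _).1 (d1 x Ux)).
  apply: (eq_Cn oU) ((IH _).1 d2 i j) => x Ux.
  by rewrite derive_mx ?mxE//; exact: d1.
- move=> cM; have dM v x : U x -> derivable M x v.
    by move=> Ux; apply/derivable_mxP => i j; exact: (Cn_derivable v (cM i j)).
  apply: CnS => [x Ux|v].
    by apply/mx_continuousP => i j; exact: (Cn_cont (cM i j)).
  split=> [x|]; first exact: dM.
  apply/IH => i j; apply: (eq_Cn oU) (Cn_derive v (cM i j)) => x Ux.
  by rewrite derive_mx ?mxE//; exact: dM.
Qed.

Lemma Cn_mulmx p q r k U (A : V -> 'M[R]_(p, q)) (B : V -> 'M[R]_(q, r)) :
  open U -> Cn k U A -> Cn k U B -> Cn k U (fun x => A x *m B x).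
Proof.
move=> oU /Cn_mxP-/(_ oU) CA /Cn_mxP-/(_ oU) CB; apply/Cn_mxP => // i j.
apply: (@eq_Cn _ _ _ _ _ (fun x => \sum_l A x i l * B x l j)) => // [x _|].
  by rewrite mxE.
by apply: Cn_sum => // l _; exact: CnM.
Qed.

Lemma Cn_trmx p q k U (A : V -> 'M[R]_(p, q)) :
  open U -> Cn k U A -> Cn k U (fun x => (A x)^T).
Proof.
move=> oU /Cn_mxP-/(_ oU) CA; apply/Cn_mxP => // i j.
by apply: (eq_Cn oU) (CA j i) => x _; rewrite mxE.
Qed.

Lemma CnZmx p q k U (a : V -> R^o) (A : V -> 'M[R]_(p, q)) :
  open U -> Cn k U a -> Cn k U A -> Cn k U (fun x => a x *: A x).
Proof.
move=> oU Ca /Cn_mxP-/(_ oU) CA; apply/Cn_mxP => // i j.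
by apply: (eq_Cn oU) (CnM oU Ca (CA i j)) => x _; rewrite mxE.
Qed.

Lemma Cn_det p k U (A : V -> 'M[R]_p) :
  open U -> Cn k U A -> Cn k U (fun x => \det (A x) : R^o).
Proof.
move=> oU /Cn_mxP-/(_ oU) CA; apply: Cn_sum => // s _; apply: CnM => //.
  exact: Cn_cst.
by apply: Cn_prod => // i _; exact: CA.
Qed.

(** The cofactor formula makes the inverse a rational expression in the entries. *)
Lemma Cn_invmx p k U (A : V -> 'M[R]_p) :
  open U -> (forall x, U x -> \det (A x) != 0) -> Cn k U A ->
  Cn k U (fun x => invmx (A x)).
Proof.
move=> oU A0 CA.
apply: (@eq_Cn _ _ _ _ _ (fun x => (\det (A x))^-1 *: \adj (A x))) => // [x Ux|].
  by rewrite /invmx unitmxE unitfE A0.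
apply: CnZmx => //; first by apply: Cn_inv => //; exact: Cn_det.
apply/Cn_mxP => // i j.
apply: (@eq_Cn _ _ _ _ _ (fun x => (-1) ^+ (j + i) * \det (row' j (col' i (A x))))) => // [x _|].
  by rewrite mxE.
apply: CnM => //; first exact: Cn_cst.
apply: Cn_det => //; apply/Cn_mxP => // a b.
by apply: (eq_Cn oU) ((Cn_mxP _ _ oU).1 CA (lift j a) (lift i b)) => x _; rewrite !mxE.
Qed.

End CnMatrix.

(** * Linear maps, mean value estimates and the chain rule *)

Section LinearMaps.
Variables (R : realType) (V V' W : normedModType R).

Lemma is_derive_affine (f : V -> W) (L : {linear V' -> V}) c x v :
  derivable f (L x + c) (L v) ->
  is_derive x v (fun y => f (L y + c)) ('D_(L v) f (L x + c)).
Proof.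
have E : (fun h : R => h^-1 *: (((fun y => f (L y + c)) \o shift x) (h *: v) - f (L x + c)))
   = (fun h => h^-1 *: ((f \o shift (L x + c)) (h *: L v) - f (L x + c))).
  by apply/funext => h /=; rewrite (linearD L) (linearZ_LR L) addrA.
by move=> df; split; rewrite /derivable /derive E.
Qed.

Lemma Cn_affine k (U : set V) (f : V -> W) (L : {linear V' -> V}) c :
  continuous L -> open U -> Cn k U f ->
  Cn k [set y | U (L y + c)] (fun y => f (L y + c)).
Proof.
move=> cL oU.
have cA : continuous (fun y => L y + c) by move=> y; apply: cvgD; [exact: cL|exact: cvg_cst].
have oU' : open [set y | U (L y + c)] by apply: open_comp => // y _; exact: cA.
have cfA g y : Cn 0 U g -> U (L y + c) -> {for y, continuous (fun y => g (L y + c))}.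
  move=> Cg Uy; apply: (@continuous_comp _ _ _ (fun y => L y + c) g); first exact: cA.
  exact: (Cn_cont Cg).
elim: k f => [|k IH] f Cf; first by split=> // y; exact: cfA.
apply: CnS => [y|v]; first by apply: cfA; split=> // z; exact: (Cn_cont Cf).
have d y : U (L y + c) -> is_derive y v (fun y => f (L y + c)) ('D_(L v) f (L y + c)).
  by move=> Uy; apply: is_derive_affine; exact: Cn_derivable Cf Uy.
split=> [y /d []//|].
by apply: (eq_Cn oU') (IH _ (Cn_derive (L v) Cf)) => y /d[_ ->].
Qed.

Lemma Cn_linear k (U : set V) (L : {linear V -> W}) :
  continuous L -> open U -> Cn k U L.
Proof.
move=> cL oU; have dL x : differentiable L x by apply: linear_differentiable; exact: cL.
case: k => [|k]; first by split=> // x _; exact: cL.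
apply: CnS => [x _|v]; first exact: cL.
split=> [x _|]; first exact: diff_derivable.
apply: (eq_Cn oU) (Cn_cst k (L v) oU) => x _.
by rewrite deriveE// diff_lin.
Qed.

End LinearMaps.

Section Frechet.
Variables (R : realType).

Lemma is_derive_line (V W : normedModType R) (f : V -> W) (a w : V) (s : R) :
  derivable f (a + s *: w) w ->
  is_derive s 1 (fun t : R => f (a + t *: w)) ('D_w f (a + s *: w)).
Proof.
have E : (fun h : R => h^-1 *: (((fun t : R => f (a + t *: w)) \o shift s) (h *: (1 : R^o)) - f (a + s *: w)))
   = (fun h => h^-1 *: ((f \o shift (a + s *: w)) (h *: w) - f (a + s *: w))).
  apply/funext => h /=; congr (_ *: (f _ - _)).
  by rewrite [h *: _]mulr1 scalerDl addrCA.
by move=> df; split; rewrite /derivable /derive E.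
Qed.

Lemma segment_mvt (V : normedModType R) (f : V -> R^o) (a w : V) :
  (forall s : R, 0 <= s <= 1 -> derivable f (a + s *: w) w) ->
  exists2 s, 0 <= s <= 1 & f (a + w) - f a = 'D_w f (a + s *: w).
Proof.
move=> df; pose phi (t : R) := f (a + t *: w) : R.
have dphi (t : R) : 0 <= t <= 1 -> is_derive t 1 phi ('D_w f (a + t *: w)).
  by move=> t01; exact/is_derive_line/df.
have [||c] := @MVT R phi (fun t => 'D_w f (a + t *: w)) 0 1 ltr01.
- by move=> x; rewrite in_itv /= => /andP[x0 x1]; apply: dphi; rewrite !ltW.
- apply: derivable_within_continuous => x; rewrite in_itv /= => x01.
  by have [] := dphi x x01.
rewrite in_itv /= /phi scale1r scale0r addr0 subr0 mulr1 => /andP[c0 c1] E.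
by exists c; rewrite ?ltW.
Qed.

Variables (V : normedModType R) (U : set V) (f : V -> R^o).
Hypotheses (oU : open U) (Cf : Cn 1 U f).

Lemma derive_cont x v : U x -> {for x, continuous ('D_v f)}.
Proof. exact: Cn_cont (Cn_derive v Cf). Qed.

(** Directional derivatives are derivatives along lines, and the line in direction [h *: v] is the
    line in direction [v] run at speed [h], including [h = 0]. *)
Lemma deriveZv y (h : R) v : U y -> 'D_(h *: v) f y = h * 'D_v f y.
Proof.
move=> Uy.
have := @is_derive_line V R^o f y v 0; rewrite scale0r addr0 => /(_ (Cn_derivable v Cf Uy)) [d1 d2].
have := @is_derive_line V R^o f y (h *: v) 0; rewrite scale0r addr0 => /(_ (Cn_derivable _ Cf Uy)) [d3 <-].
rewrite -d2 (_ : (fun t : R => f (y + t *: (h *: v))) = (fun t : R => f (y + t *: v)) \o (fun t : R => t * h)); last first.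
  by apply/funext => t /=; rewrite scalerA.
move: d1; set phi := (fun t : R => f (y + t *: v)) => d1.
rewrite -!derive1E.
have d4 : derivable (id : R -> R) 0 1 by exact: derivable_id.
have d5 : derivable (cst h : R -> R) 0 1 by exact: derivable_cst.
have dg : derivable (fun t : R => t * h) 0 1 by exact: (derivableM d4 d5).
have d1' : derivable phi (0 * h) 1 by rewrite mul0r; exact d1.
rewrite (derive1_comp dg d1') mul0r mulrC; congr (_ * _).
have := @derive1Mr R id 0 h d4.
by rewrite derive1_id mul1r.
Qed.

(** Additivity is not a formal property of directional derivatives. The increment along [u + v] is
    split into one along [u] from [x] and one along [v] from the moved point [x + h *: u]; the mean
    value theorem and the continuity of ['D_v f] handle the second. *)
Lemma deriveDv x u v : U x -> 'D_(u + v) f x = 'D_u f x + 'D_v f x.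
Proof.
move=> Ux.
apply: cvg_lim => //.
have E : (fun h : R => h^-1 *: ((f \o shift x) (h *: (u + v)) - f x)) =
   (fun h => h^-1 *: ((f \o shift x) (h *: u) - f x)) \+
   (fun h => h^-1 *: (f (x + h *: u + h *: v) - f (x + h *: u))).
  apply/funext => h.
  have e1 : h *: (u + v) + x = x + h *: u + h *: v by rewrite scalerDr addrC addrA.
  have e2 (c : R) (A B C : R^o) : c *: (A - C) = c *: (B - C) + c *: (A - B).
    by rewrite -scalerDr [in RHS]addrC subrKA.
  change (h^-1 *: (f (h *: (u + v) + x) - f x) = h^-1 *: (f (h *: u + x) - f x) +
    h^-1 *: (f (x + h *: u + h *: v) - f (x + h *: u))).
  by rewrite e1 [h *: u + x]addrC; exact: e2.
rewrite E; apply: cvgD; first exact: (Cn_derivable u Cf Ux).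
apply/cvgrPdist_le => e e0.
have /cvgrPdist_le/(_ e e0) := derive_cont (v := v) Ux.
rewrite -nbhs_nearE => /nbhs_ballP[d /= d0 Hd].
have /nbhs_ballP[d' /= d'0 Hd'] := open_near oU Ux.
pose M := `|u| + `|v| + 1.
have M0 : 0 < M by rewrite ltr_wpDl// addr_ge0.
near=> h.
have h0 : h != 0 by near: h; exact: nbhs_dnbhs_neq.
have hM : `|h| * M < Num.min d d'.
  rewrite -ltr_pdivlMr//; near: h; apply: dnbhs0_lt.
  by rewrite divr_gt0// lt_min d0.
have Hs (s : R) : 0 <= s <= 1 -> ball x (Num.min d d') (x + h *: u + s *: (h *: v)).
  move=> /andP[s0 s1]; rewrite -ball_normE /= -addrA opprD addNKr normrN.
  apply: le_lt_trans hM; rewrite (le_trans (ler_normD _ _))// !normrZ.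
  rewrite (ger0_norm s0) /M !mulrDr mulr1 -addrA lerD2l.
  by rewrite (le_trans (ler_piMl _ s1)) ?mulr_ge0// lerDl.
have sub1 : ball x (Num.min d d') `<=` ball x d.
  by apply: le_ball; rewrite ge_min lexx.
have sub2 : ball x (Num.min d d') `<=` ball x d'.
  by apply: le_ball; rewrite ge_min lexx orbT.
have [|s s01 ->] := @segment_mvt V f (x + h *: u) (h *: v).
  move=> s s01; have := Hd' _ (sub2 _ (Hs s s01)) => Uy.
  exact: Cn_derivable Cf Uy.
set y := x + _ + _.
have Uy : U y by exact: Hd' _ (sub2 _ (Hs s s01)).
rewrite deriveZv//; change (`|'D_v f x - h^-1 *: (h *: 'D_v f y)| <= e).
rewrite scalerA mulVf// scale1r.
exact: Hd (sub1 _ (Hs s s01)).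
Unshelve. all: by end_near. Qed.

End Frechet.

(** The near-covering form of compactness, with the filter of large numbers for the bound, turns
    local bounds into a single one. The same device with the filter of small positive numbers
    produces the uniform radii further on. *)
Lemma compact_bound (R : realType) (T : topologicalType) (Q : set T) (g : T -> R) :
  compact Q -> (forall x, Q x -> {for x, continuous g}) ->
  exists2 M, 0 <= M & forall x, Q x -> `|g x| <= M.
Proof.
move=> /compact_near_coveringP cQ cg.
have : \forall M \near +oo, Q `<=` (fun x => `|g x| <= M).
  apply: (cQ R (pinfty_nbhs R) (fun M x => `|g x| <= M)) => x Qx.
  exists ([set y | `|g y| < `|g x| + 1], [set M | `|g x| + 1 < M]).
    split=> /=.
      have cn : `|g y| @[y --> x] --> `|g x| by apply: cvg_norm; exact: cg.
      by apply: (cvgr_lt (`|g x|) cn); rewrite ltrDl.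
    exact: nbhs_pinfty_gt.
  by move=> [y M] /= [h1 h2]; rewrite ltW// (lt_trans h1).
move=> HM; near +oo_R => M; exists M => //.
by move=> x Qx; exact: (near HM M).
Unshelve. all: by end_near. Qed.

Definition segment_closed (R : realType) (V : normedModType R) (Q : set V) :=
  forall (a b : V) (s : R), Q a -> Q b -> 0 <= s <= 1 -> Q (a + s *: (b - a)).

Lemma convex_ball (R : realType) (V : normedModType R) (x : V) (d : R) :
  segment_closed [set y | `|y - x| < d].
Proof.
move=> a b s /= ha hb /andP[s0 s1].
have -> : a + s *: (b - a) - x = (1 - s) *: (a - x) + s *: (b - x).
  have -> : b - a = (b - x) - (a - x) by rewrite opprB addrA subrK.
  by rewrite addrAC scalerBr scalerBl scale1r addrA addrAC.
rewrite (le_lt_trans (ler_normD _ _))// !normrZ (ger0_norm s0) ger0_norm ?subr_ge0//.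
have [->|sN0] := eqVneq s 0; first by rewrite subr0 mul1r mul0r addr0.
have s0' : 0 < s by rewrite lt_neqAle eq_sym sN0.
apply: (@lt_le_trans _ _ ((1 - s) * d + s * d)).
  by rewrite ler_ltD ?ltr_pM2l// ler_wpM2l ?subr_ge0// ltW.
by rewrite -mulrDl subrK mul1r.
Qed.

Section RealStrict.
Variables (R : realType) (m : nat) (U : set 'rV[R]_m) (f : 'rV[R]_m -> R^o).
Hypotheses (oU : open U) (Cf : Cn 1 U f).

Lemma derive_row_sum x v : U x ->
  'D_v f x = \sum_i v 0 i * 'D_(delta_mx 0 i) f x.
Proof.
move=> Ux; rewrite {1}(row_sum_delta v).
elim/big_ind2 : _ => [|u a w b <- <-|i _]; first exact: derive0.
  exact: (deriveDv oU Cf).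
exact: (deriveZv Cf).
Qed.

(** Strict differentiability, with both end points free: the mean value theorem on the segment,
    inside a ball where the partial derivatives differ from those at [x] by at most [e']. *)
Lemma strict_derive x (e : R) : U x -> 0 < e -> exists2 d : R, 0 < d &
  forall a b, `|a - x| < d -> `|b - x| < d ->
    U a /\ `|f b - f a - 'D_(b - a) f x| <= e * `|b - a|.
Proof.
move=> Ux e0.
(* One part of [e] for each partial derivative; [m.+1] keeps the quotient positive when [m = 0]. *)
pose e' := e / m.+1%:R.
have e'0 : 0 < e' by rewrite divr_gt0.
have H1 : \forall y \near x, forall i, `|'D_(delta_mx 0 i) f y - 'D_(delta_mx 0 i) f x| <= e'.
  near=> y; near: y; apply: filter_forall => i.
  have /cvgrPdist_le/(_ _ e'0) := derive_cont Cf (v := delta_mx 0 i) Ux.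
  by apply: filterS => y; rewrite distrC.
have [d /= d0 Hd] := (nbhs_ballP _ _).1 (filterI (open_near oU Ux) H1).
exists d => // a b ad bd.
have B y : `|y - x| < d -> ball x d y by rewrite -ball_normE /= distrC.
have Hs (s : R) : 0 <= s <= 1 -> ball x d (a + s *: (b - a)).
  by move=> s01; apply: B; exact: convex_ball.
split; first by have [] := Hd _ (B _ ad).
have [s s01|s s01] := @segment_mvt R _ f a (b - a).
  by have [Uy _] := Hd _ (Hs _ s01); exact: Cn_derivable Cf Uy.
rewrite [a + (b - a)]addrC subrK => ->; have [Uy Hy] := Hd _ (Hs _ s01).
rewrite !derive_row_sum// -sumrB (le_trans (ler_norm_sum _ _ _))//.
apply: (@le_trans _ _ (\sum_(i < m) `|b - a| * e')).
  apply: ler_sum => i _; rewrite -mulrBr normrM ler_pM//.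
  exact: ler_mx_entry.
rewrite sumr_const card_ord -mulrnAr [leRHS]mulrC ler_wpM2l// -mulr_natr /e'.
rewrite -mulrA; apply: ler_piMr; first exact: ltW.
rewrite mulrC ler_pdivrMr// mul1r.
by rewrite ler_nat.
Unshelve. all: by end_near. Qed.

Lemma convex_lipschitz (Q : set 'rV[R]_m) : compact Q -> segment_closed Q -> Q `<=` U ->
  exists2 L, 0 <= L & forall a b, Q a -> Q b -> `|f b - f a| <= L * `|b - a|.
Proof.
move=> cQ xQ QU.
have /choice[M HM] : forall i : 'I_m, exists M : R,
    0 <= M /\ forall x, Q x -> `|'D_(delta_mx 0 i) f x| <= M.
  move=> i; have [M M0 HM] := @compact_bound R _ Q ('D_(delta_mx 0 i) f) cQ
    (fun x Qx => derive_cont Cf (v := delta_mx 0 i) (QU _ Qx)).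
  by exists M.
exists (\sum_i M i) => [|a b Qa Qb]; first by apply: sumr_ge0 => i _; have [] := HM i.
have [s s01|s s01] := @segment_mvt R _ f a (b - a).
  exact: Cn_derivable Cf (QU _ (xQ a b s Qa Qb s01)).
rewrite [a + (b - a)]addrC subrK => ->; have Qy := xQ a b s Qa Qb s01.
rewrite derive_row_sum; last exact: QU.
rewrite (le_trans (ler_norm_sum _ _ _))// mulr_suml ler_sum// => i _.
rewrite normrM mulrC ler_pM//; first by have [_] := HM i; apply.
exact: ler_mx_entry.
Qed.

End RealStrict.

Section MatrixStrict.
Variables (R : realType) (m p q : nat) (U : set 'rV[R]_m) (F : 'rV[R]_m -> 'M[R]_(p, q)).
Hypotheses (oU : open U) (CF : Cn 1 U F).

Let Cf i j : Cn 1 U (fun x => F x i j : R^o).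
Proof. exact: (Cn_mxP _ _ oU).1. Qed.

Lemma derive_mxE x v i j : U x -> ('D_v F x) i j = 'D_v (fun x => F x i j : R^o) x.
Proof. by move=> Ux; rewrite derive_mx ?mxE//; exact: Cn_derivable CF Ux. Qed.

Lemma derive_mxD x u v : U x -> 'D_(u + v) F x = 'D_u F x + 'D_v F x.
Proof.
move=> Ux; apply/matrixP => i j; rewrite [RHS]mxE !(derive_mxE _ _ _ Ux).
exact: (deriveDv oU (Cf i j)).
Qed.

Lemma derive_mxZ x (h : R) v : U x -> 'D_(h *: v) F x = h *: 'D_v F x.
Proof.
move=> Ux; apply/matrixP => i j; rewrite [RHS]mxE !(derive_mxE _ _ _ Ux).
exact: (deriveZv (Cf i j)).
Qed.

Lemma derive_mx_sum x v : U x ->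
  'D_v F x = \sum_i v 0 i *: 'D_(delta_mx 0 i) F x.
Proof.
move=> Ux; apply/matrixP => i j; rewrite derive_mxE// (derive_row_sum oU (Cf i j))//.
by rewrite summxE; apply: eq_bigr => k _; rewrite mxE derive_mxE.
Qed.

Lemma strict_derive_mx x (e : R) : U x -> 0 < e -> exists2 d : R, 0 < d &
  forall a b, `|a - x| < d -> `|b - x| < d ->
    U a /\ `|F b - F a - 'D_(b - a) F x| <= e * `|b - a|.
Proof.
move=> Ux e0.
have H : \forall d \near 0^'+, forall i j a b, `|a - x| < d -> `|b - x| < d ->
    `|F b i j - F a i j - 'D_(b - a) (fun x => F x i j : R^o) x| <= e * `|b - a|.
  near=> z; near: z; apply: filter_forall => i; apply: filter_forall => j.
  have [d d0 Hd] := strict_derive oU (Cf i j) Ux e0.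
  near=> d' => a b ad bd.
  have d'd : d' < d by near: d'; exact: nbhs_right_lt.
  by have [] := Hd a b (lt_trans ad d'd) (lt_trans bd d'd).
have /nbhs_ballP[d0 /= d00 Hd0] := open_near oU Ux.
near (0 : R)^'+ => d.
have dd0 : d < d0 by near: d; exact: nbhs_right_lt.
exists d => // a b ad bd; split; first by apply: Hd0; rewrite -ball_normE /= distrC (lt_trans ad).
apply: mx_norm_le => [|i j]; first by rewrite mulr_ge0// ltW.
by rewrite !mxE derive_mxE//; exact: (near H d).
Unshelve. all: by end_near. Qed.

Lemma convex_lipschitz_mx (Q : set 'rV[R]_m) : compact Q -> segment_closed Q -> Q `<=` U ->
  exists2 L, 0 <= L & forall a b, Q a -> Q b -> `|F b - F a| <= L * `|b - a|.
Proof.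
move=> cQ xQ QU.
have /choice[M HM] : forall ij : 'I_p * 'I_q, exists M : R,
    0 <= M /\ forall a b, Q a -> Q b -> `|F b ij.1 ij.2 - F a ij.1 ij.2| <= M * `|b - a|.
  move=> ij; have [M M0 HM] := convex_lipschitz oU (Cf ij.1 ij.2) cQ xQ QU.
  by exists M.
have M0 ij : 0 <= M ij by have [] := HM ij.
exists (\sum_ij M ij) => [|a b Qa Qb]; first exact: sumr_ge0.
apply: mx_norm_le => [|i j]; first by rewrite mulr_ge0// sumr_ge0.
rewrite 2!mxE; have [_ H] := HM (i, j).
rewrite (le_trans (H a b Qa Qb))// ler_wpM2r//.
by rewrite (bigD1 (i, j))//= lerDl sumr_ge0.
Qed.

End MatrixStrict.

Section DeriveBounds.
Variables (R : realType) (m p q : nat) (U : set 'rV[R]_m) (F : 'rV[R]_m -> 'M[R]_(p, q)).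
Hypotheses (oU : open U) (CF : Cn 1 U F).

Lemma derive_mx_norm_le x v (C : R) : U x ->
  (forall i, `|'D_(delta_mx 0 i) F x| <= C) -> `|'D_v F x| <= m%:R * C * `|v|.
Proof.
move=> Ux HC; rewrite (derive_mx_sum oU CF)// (le_trans (ler_norm_sum _ _ _))//.
apply: (@le_trans _ _ (\sum_(i < m) `|v| * C)).
  by apply: ler_sum => i _; rewrite normrZ ler_pM// ler_mx_entry.
by rewrite sumr_const card_ord -[leLHS]mulr_natl [`|v| * C]mulrC mulrA.
Qed.

Lemma derive_mx_bound (Q : set 'rV[R]_m) : compact Q -> Q `<=` U ->
  exists2 C, 0 <= C & forall x v, Q x -> `|'D_v F x| <= C * `|v|.
Proof.
move=> cQ QU.
have /choice[M HM] : forall i : 'I_m, exists M : R,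
    0 <= M /\ forall x, Q x -> `|'D_(delta_mx 0 i) F x| <= M.
  move=> i; have [|M M0 HM] := @compact_bound R _ Q (fun x => `|'D_(delta_mx 0 i) F x|) cQ.
    move=> x /QU Ux; apply: (@continuous_comp _ _ _ ('D_(delta_mx 0 i) F) (fun M => `|M| : R)).
      exact: (Cn_cont (Cn_derive _ CF)).
    exact: norm_continuous.
  by exists M; split=> // x Qx; have := HM x Qx; rewrite normr_id.
have M0 i : 0 <= M i by have [] := HM i.
exists (m%:R * \sum_i M i) => [|x v Qx]; first by rewrite mulr_ge0// sumr_ge0.
apply: derive_mx_norm_le => [|i]; first exact: QU.
have [_ H] := HM i; rewrite (le_trans (H x Qx))//.
by rewrite (bigD1 i)//= lerDl sumr_ge0.
Qed.

Lemma derive_mx_near x (e : R) : U x -> 0 < e ->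
  \forall a \near x, U a /\ forall u, `|'D_u F a - 'D_u F x| <= e * `|u|.
Proof.
move=> Ux e0; pose e' := e / m.+1%:R.
have e'0 : 0 < e' by rewrite divr_gt0.
have H1 : \forall a \near x, forall i, `|'D_(delta_mx 0 i) F a - 'D_(delta_mx 0 i) F x| <= e'.
  near=> y; near: y; apply: filter_forall => i.
  have /cvgrPdist_le/(_ _ e'0) H := Cn_cont (Cn_derive (delta_mx 0 i) CF) Ux.
  by near=> y; rewrite distrC; near: y; exact: H.
apply: filterS2 (open_near oU Ux) H1 => a Ua Ha; split=> // u.
rewrite !(derive_mx_sum oU CF)// -sumrB (le_trans (ler_norm_sum _ _ _))//.
apply: (@le_trans _ _ (\sum_(i < m) `|u| * e')).
  by apply: ler_sum => i _; rewrite -scalerBr normrZ ler_pM// ler_mx_entry.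
rewrite sumr_const card_ord -mulrnAr [leRHS]mulrC ler_wpM2l// -mulr_natr /e'.
rewrite -mulrA; apply: ler_piMr; first exact: ltW.
by rewrite mulrC ler_pdivrMr// mul1r ler_nat.
Unshelve. all: by end_near. Qed.

(** Strict differentiability with the derivative taken at the moving point [a]; this is the form
    that is made uniform along a trajectory. *)
Lemma strict_derive_near x (e : R) : U x -> 0 < e -> exists2 d : R, 0 < d &
  forall a b, `|a - x| < d -> `|b - x| < d ->
    U a /\ `|F b - F a - 'D_(b - a) F a| <= e * `|b - a|.
Proof.
move=> Ux e0; have e20 : 0 < e / 2 by rewrite divr_gt0.
have [d1 d10 H1] := strict_derive_mx oU CF Ux e20.
have /nbhs_ballP[d2 /= d20 H2] := derive_mx_near Ux e20.
exists (Num.min d1 d2); first by rewrite lt_min d10.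
move=> a b; rewrite !lt_min => /andP[a1 a2] /andP[b1 b2].
have [Ua Hab] := H1 a b a1 b1; split=> //.
have [|_ Ha] := H2 a; first by rewrite -ball_normE /= distrC.
rewrite -(subrKA ('D_(b - a) F x)) (splitr e) mulrDl.
apply: (le_trans (ler_normD _ _)); apply: lerD; first exact: Hab.
by rewrite distrC; exact: Ha.
Qed.

(** The map [f] is only assumed derivable at [x] in the direction [v]. With [qh] its difference
    quotient, the error is split into ['D_(w - qh) F (f x)], small because [qh] tends to [w], and
    the Taylor remainder of [F], small relative to [|h| * |qh|]. *)
Lemma is_derive_chain (V : normedModType R) (f : V -> 'rV[R]_m) x v :
  U (f x) -> derivable f x v ->
  is_derive x v (F \o f) ('D_('D_v f x) F (f x)).
Proof.
move=> Ux df; set w := 'D_v f x.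
pose C : R := m%:R * \sum_i `|'D_(delta_mx 0 i) F (f x)|.
have C0 : 0 <= C by rewrite mulr_ge0// sumr_ge0.
have HC u : `|'D_u F (f x)| <= C * `|u|.
  by apply: derive_mx_norm_le => // i; rewrite (bigD1 i)//= lerDl sumr_ge0.
have L : (fun h : R => h^-1 *: (((F \o f) \o shift x) (h *: v) - (F \o f) x)) @ 0^' -->
    'D_w F (f x).
  apply/cvgrPdist_le => e e0.
  have w10 : 0 < `|w| + 1 by rewrite ltr_wpDl.
  pose e1 := e / 2 / (`|w| + 1); have e10 : 0 < e1 by rewrite !divr_gt0.
  (* The entry [1] keeps [|qh|] below [|w| + 1]; the other one makes [C * e2] at most [e / 2]. *)
  pose e2 := Num.min 1 (e / 2 / (C + 1)).
  have e20 : 0 < e2 by rewrite lt_min ltr01 !divr_gt0// ltr_wpDl.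
  have [d d0 Hd] := strict_derive_near Ux e10.
  have /cvgrPdist_le/(_ e2 e20) Hq : (fun h : R => h^-1 *: ((f \o shift x) (h *: v) - f x)) @ 0^' --> w by exact: df.
  near=> h.
  have h0 : h != 0 by near: h; exact: nbhs_dnbhs_neq.
  have hd : `|h| * (`|w| + 1) < d.
    by rewrite -ltr_pdivlMr//; near: h; apply: dnbhs0_lt; rewrite divr_gt0.
  have : `|w - h^-1 *: ((f \o shift x) (h *: v) - f x)| <= e2 by near: h; exact: Hq.
  rewrite /=; set b := f (h *: v + x); set qh := h^-1 *: (b - f x) => wq.
  have qw : `|qh| <= `|w| + 1.
    rewrite -(subrK w qh) addrC (le_trans (ler_normD _ _))// lerD2l distrC.
    by rewrite (le_trans wq)// /e2 ge_min lexx.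
  have bq : b - f x = h *: qh by rewrite /qh scalerA mulfV// scale1r.
  have [||_ Hb] := Hd (f x) b.
  - by rewrite subrr normr0.
  - by rewrite bq normrZ (le_lt_trans _ hd)// ler_wpM2l.
  have -> : 'D_w F (f x) - h^-1 *: (F b - F (f x)) =
     'D_(w - qh) F (f x) - h^-1 *: (F b - F (f x) - 'D_(b - f x) F (f x)).
    have E : h^-1 *: 'D_(b - f x) F (f x) = 'D_qh F (f x).
      by rewrite bq (derive_mxZ oU CF)// [LHS]scalerA mulVf// scale1r.
    rewrite (derive_mxD oU CF)// -[- qh]scaleN1r (derive_mxZ oU CF)// scaleN1r.
    by rewrite [h^-1 *: (F b - F (f x) - _)]scalerBr E opprB addrA subrK.
  rewrite (splitr e) (le_trans (ler_normB _ _))// lerD//.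
    rewrite (le_trans (HC _))// (@le_trans _ _ (C * (e / 2 / (C + 1))))//.
      by rewrite ler_wpM2l// (le_trans wq)// /e2 ge_min lexx orbT.
    rewrite mulrCA; apply: ler_piMr; first by rewrite divr_ge0// ltW.
    by rewrite ler_pdivrMr ?mul1r ?lerDl// ltr_wpDl.
  rewrite normrZ normfV ler_pdivrMl ?normr_gt0// (le_trans Hb)//.
  rewrite bq normrZ mulrCA ler_wpM2l// /e1.
  rewrite -[leRHS]mulr1 -[leLHS]mulrA; apply: ler_wpM2l; first by rewrite divr_ge0// ltW.
  by rewrite mulrC ler_pdivrMr// mul1r.
by split; [apply/cvg_ex; exists ('D_w F (f x))|exact: cvg_lim L].
Unshelve. all: by end_near. Qed.

End DeriveBounds.

(** The derivative is a sum of components of ['D_v f] times compositions of [f] with partial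
    derivatives of [F]; these take the place of [F] in the induction, which therefore quantifies
    over it. *)
Lemma Cn_comp (R : realType) (V : normedModType R) (m p q k : nat) (U : set V)
    (U' : set 'rV[R]_m) (f : V -> 'rV[R]_m) (F : 'rV[R]_m -> 'M[R]_(p, q)) :
  open U -> open U' -> (forall x, U x -> U' (f x)) ->
  Cn k U f -> Cn k U' F -> Cn k U (F \o f).
Proof.
move=> oU oU' fU; elim: k F => [|k IH] F Cf CF.
  split; last exact I; move=> x Ux; apply: continuous_comp; first exact: (Cn_cont Cf).
  by apply: (Cn_cont CF); exact: fU.
have C1F : Cn 1 U' F by clear -CF; elim: k CF => // k IH /CnW.
apply: CnS => [x Ux|v].
  apply: continuous_comp; first exact: (Cn_cont Cf).
  by apply: (Cn_cont CF); exact: fU.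
have dc x : U x -> is_derive x v (F \o f) ('D_('D_v f x) F (f x)).
  by move=> Ux; apply: (is_derive_chain oU' C1F); [exact: fU|exact: Cn_derivable Cf Ux].
split=> [x /dc[]//|].
apply: (@eq_Cn _ _ _ _ _ (fun x => \sum_i ('D_v f x) 0 i *: ('D_(delta_mx 0 i) F \o f) x)) => //.
  by move=> x Ux; have [_ ->] := dc x Ux; rewrite (derive_mx_sum oU' C1F)//; exact: fU.
apply: Cn_sum => // i _; apply: CnZmx => //.
  exact: (Cn_mxP _ _ oU).1 (Cn_derive v Cf) 0 i.
by apply: IH; [exact: CnW|exact: Cn_derive].
Qed.

(** * Mean value inequalities and Gronwall's lemma *)

Section Comparison.
Variables (R : realType).

Lemma derive_ge0_le (g g' : R -> R) (a b : R) : a <= b ->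
  (forall s : R, a <= s <= b -> is_derive s 1 g (g' s)) ->
  (forall s : R, a <= s <= b -> 0 <= g' s) -> g a <= g b.
Proof.
move=> ab dg g0.
have [||c] := @MVT_segment R g g' a b ab.
- by move=> x; rewrite in_itv /= => /andP[h1 h2]; apply: dg; rewrite !ltW.
- apply: derivable_within_continuous => x; rewrite in_itv /= => x01.
  by have [] := dg x x01.
rewrite in_itv /= => cab E; rewrite -subr_ge0 E mulr_ge0 ?subr_ge0//.
exact: g0.
Qed.

Variables (p q : nat).
Implicit Types y : R -> 'M[R]_(p, q).

Lemma is_derive_mxE y (s : R) (w : 'M[R]_(p, q)) i j :
  is_derive s 1 y w -> is_derive s 1 (fun t => y t i j : R) (w i j).
Proof.
move=> [dy <-]; split; first exact: ((derivable_mxP _ _ _).1 dy i j).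
by rewrite derive_mx ?mxE.
Qed.

Lemma is_derive_mxP y (s : R) (w : 'M[R]_(p, q)) :
  (forall i j, is_derive s 1 (fun t => y t i j : R) (w i j)) -> is_derive s 1 y w.
Proof.
move=> dy; have dy' : derivable y s 1 by apply/derivable_mxP => i j; have [] := dy i j.
split=> //; rewrite derive_mx//; apply/matrixP => i j; rewrite mxE.
by have [] := dy i j.
Qed.

(** The norm is the maximum of the absolute values of the entries, so it suffices that [B] minus or
    plus each entry of [y] is nondecreasing. *)
Lemma derive_comparison y y' (B B' : R -> R) (a b : R) : a <= b ->
  (forall s : R, a <= s <= b -> is_derive s 1 y (y' s)) ->
  (forall s : R, a <= s <= b -> is_derive s 1 B (B' s)) ->
  (forall s : R, a <= s <= b -> `|y' s| <= B' s) ->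
  `|y b - y a| <= B b - B a.
Proof.
move=> ab dy dB yB.
have B0 : B a <= B b.
  by apply: (derive_ge0_le ab dB) => s sab; rewrite (le_trans _ (yB s sab)).
apply: mx_norm_le => [|i j]; first by rewrite subr_ge0.
rewrite !mxE ler_norml.
have H s : a <= s <= b -> `|y' s i j| <= B' s.
  by move=> sab; rewrite (le_trans _ (yB s sab))// ler_mx_entry.
have h1 : B a - y a i j <= B b - y b i j.
  apply: (@derive_ge0_le (fun s => B s - y s i j) (fun s => B' s - y' s i j)) => // s sab.
    by apply: is_deriveB; [exact: dB|exact/is_derive_mxE/dy].
  by have := H s sab; rewrite ler_norml subr_ge0 => /andP[].
have h2 : B a + y a i j <= B b + y b i j.
  apply: (@derive_ge0_le (fun s => B s + y s i j) (fun s => B' s + y' s i j)) => // s sab.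
    by apply: is_deriveD; [exact: dB|exact/is_derive_mxE/dy].
  by have := H s sab; rewrite ler_norml => /andP[h _]; lra.
by apply/andP; split; lra.
Qed.

Lemma derive_norm_le y y' (K a b : R) : a <= b ->
  (forall s : R, a <= s <= b -> is_derive s 1 y (y' s)) ->
  (forall s : R, a <= s <= b -> `|y' s| <= K) ->
  `|y b - y a| <= K * (b - a).
Proof.
move=> ab dy yK; rewrite mulrBr.
apply: (@derive_comparison y y' (fun s => K * s) (fun=> K)) => // s _.
by apply: is_derive_eq; rewrite [LHS]mulr1.
Qed.

Lemma is_derive_expRM (l c s : R) :
  is_derive s 1 (fun s => c * expR (l * s)) (c * l * expR (l * s)).
Proof.
have h1 : is_derive s 1 (fun s : R => l * s) l.
  by apply: is_derive_eq; rewrite [LHS]mulr1.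
have h2 : is_derive s 1 (fun s => expR (l * s)) (expR (l * s) * l).
  by apply: (@is_derive1_comp _ expR (fun s => l * s)).
by apply: is_derive_eq; rewrite [LHS]mulrA mulrAC.
Qed.

(** Comparison with an exponential, mirrored for negative times. The exponential weight is what
    makes Picard iteration contract on the whole line. *)
Lemma derive_weighted_le y y' (K l t : R) : 0 < l ->
  (forall s : R, `|s| <= `|t| -> is_derive s 1 y (y' s)) ->
  (forall s : R, `|s| <= `|t| -> `|y' s| <= K * expR (l * `|s|)) ->
  `|y t - y 0| <= K / l * (expR (l * `|t|) - 1).
Proof.
move=> l0 dy yK; have lN0 : l != 0 by rewrite gt_eqF.
have [t0|t0] := leP 0 t.
  have Hs (s : R) : 0 <= s <= t -> `|s| <= `|t|.
    by move=> /andP[s0 st]; rewrite !ger0_norm.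
  have := @derive_comparison y y' (fun s => K / l * expR (l * s))
    (fun s => K / l * l * expR (l * s)) 0 t t0
    (fun s h => dy s (Hs s h)) (fun s _ => is_derive_expRM l (K / l) s).
  rewrite mulr0 expR0 (ger0_norm t0) mulrBr; apply=> s sab.
  rewrite divfK//; have := yK s (Hs s sab).
  by rewrite (ger0_norm (x := s))//; case/andP: sab.
have Hs (s : R) : t <= s <= 0 -> `|s| <= `|t|.
  by move=> /andP[s0 st]; rewrite !ler0_norm ?lerN2// ltW.
have := @derive_comparison y y' (fun s => - K / l * expR (- l * s))
    (fun s => - K / l * - l * expR (- l * s)) t 0 (ltW t0)
    (fun s h => dy s (Hs s h)) (fun s _ => is_derive_expRM (- l) (- K / l) s).
rewrite mulr0 expR0 (ltr0_norm t0) distrC => H; apply: le_trans (H _) _.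
  move=> s sab; rewrite mulrN !mulNr opprK divfK//; have := yK s (Hs s sab).
  by rewrite (ler0_norm (x := s)) ?mulrN ?mulNr//; case/andP: sab.
by rewrite !mulrN !mulNr mulr1; lra.
Qed.

(** The norm of [y] is weighted by [expR (- (2 * L) * |s|)] and examined where the weighted function
    is maximal. There the growth bound contributes at most half of the maximum, because the weight
    decays at twice the rate [L], and this half is absorbed on the left. Hence the factor [2] and
    the term [beta / L]. *)
Lemma gronwall y y' (L beta T t : R) : 0 < L -> 0 <= beta ->
  (forall s : R, `|s| <= T -> is_derive s 1 y (y' s)) ->
  (forall s : R, `|s| <= T -> `|y' s| <= L * `|y s| + beta) ->
  `|t| <= T -> `|y t| <= (2 * `|y 0| + beta / L) * expR (2 * L * `|t|).
Proof.
move=> L0 beta0 dy yL tT; have T0 : 0 <= T by rewrite (le_trans _ tT).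
pose g s : R := `|y s| * expR (- (2 * L) * `|s|).
have gc : {within `[- T, T], continuous g}.
  apply: continuous_in_subspaceT => s; rewrite inE /= in_itv /= -ler_norml => sT.
  apply: (@continuousM _ _ (fun s => `|y s| : R) (fun s : R => expR (- (2 * L) * `|s|))).
    apply: (@continuous_comp _ _ _ y (fun M => `|M| : R)); last exact: norm_continuous.
    by apply/differentiable_continuous/derivable1_diffP; have [] := dy s sT.
  apply: (@continuous_comp _ _ _ (fun s : R => - (2 * L) * `|s|) expR); last exact: continuous_expR.
  apply: (@continuousM _ _ (fun=> - (2 * L)) (fun s : R => `|s|)); first exact: cst_continuous.
  exact: norm_continuous.
have TT : - T <= T by rewrite (le_trans _ T0)// oppr_le0.
have [c + cmax] := EVT_max TT gc; rewrite in_itv /= -ler_norml => cT.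
have gE s : `|y s| = g s * expR (2 * L * `|s|).
  by rewrite /g -[RHS]mulrA -expRD mulNr addNr expR0 mulr1.
have gN s : `|s| <= T -> `|y s| <= g c * expR (2 * L * `|s|).
  by move=> sT; rewrite gE ler_wpM2r ?expR_ge0// cmax// in_itv /= -ler_norml.
have gc0 : 0 <= g c by rewrite mulr_ge0// expR_ge0.
suff gcb : g c <= 2 * `|y 0| + beta / L.
  by rewrite (le_trans (gN t tT))// ler_wpM2r// expR_ge0.
have H : `|y c - y 0| <= (L * g c + beta) / (2 * L) * (expR (2 * L * `|c|) - 1).
  apply: derive_weighted_le; first by rewrite mulr_gt0.
    by move=> s sc; apply: dy; exact: le_trans sc cT.
  move=> s sc; have sT := le_trans sc cT.
  rewrite (le_trans (yL s sT))// mulrDl lerD//.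
    by rewrite -mulrA ler_pM2l// gN.
  by rewrite ler_peMr// -expR0 ler_expR !mulr_ge0// ltW.
have {}H : g c * expR (2 * L * `|c|) <=
    `|y 0| + (g c / 2 + beta / L / 2) * (expR (2 * L * `|c|) - 1).
  rewrite -gE -[X in `|X|](subrK (y 0)) addrC (le_trans (ler_normD _ _))// lerD2l.
  rewrite (le_trans H)// le_eqVlt; apply/orP; left; apply/eqP; congr (_ * _).
  by field; rewrite gt_eqF.
have : 1 <= expR (2 * L * `|c|) by rewrite -expR0 ler_expR !mulr_ge0// ltW.
have : 0 <= beta / L by rewrite divr_ge0// ltW.
have := normr_ge0 (y 0).
move: H; set E := expR _; set b := beta / L; set z := `|y 0| => H z0 b0 E1.
rewrite leNgt; apply/negP => h; nra.
Qed.

End Comparison.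

Section Antiderivative.
Variable R : realType.

Lemma derive0_const (g : R -> R) (a b : R) : a <= b ->
  (forall s : R, a <= s <= b -> is_derive s 1 g 0) -> g a = g b.
Proof.
move=> ab dg; apply/eqP; rewrite eq_le; apply/andP; split.
  exact: (@derive_ge0_le _ g (fun=> 0) a b ab).
rewrite -lerN2; apply: (@derive_ge0_le _ (fun x => - g x) (fun=> 0) a b ab) => // s sab.
by have := is_deriveN (dg s sab); rewrite oppr0.
Qed.

(** * Ordinary differential equations *)

(** The integral is taken from [- N x], in a compact interval around [x]. Subtracting its value at
    [0] makes it independent of the lower end, so the local antiderivatives fit together. *)
Lemma antiderivative (f : R -> R) : continuous f ->
  exists F : R -> R, F 0 = 0 /\ forall t : R, is_derive t 1 F (f t).
Proof.
move=> cf.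
pose H (N x : R) := (\int[@lebesgue_measure R]_(t in `[- N, x]) f t)%R.
have dH (N x : R) : - N < x < N -> is_derive x 1 (H N) (f x).
  move=> /andP[Nx xN].
  have fi : integrable (@lebesgue_measure R) `[- N, N]%classic (EFin \o f).
    apply: continuous_compact_integrable; first exact: segment_compact.
    by apply: continuous_subspaceT.
  have [dF dE] := continuous_FTC1_closed xN fi Nx (cf x).
  split; first exact dF.
  by rewrite -derive1E; exact dE.
pose N (x : R) : R := (Num.truncn `|x|).+1%:R.
have NP (x : R) : `|x| < N x by exact: truncnS_gt.
have N0 (x : R) : 0 < N x by [].
have HE (A B x : R) : 0 < A -> A <= B -> `|x| < A -> H A x - H A 0 = H B x - H B 0.
  move=> A0 AB xA.
  have dg (s : R) : `|s| < A -> is_derive s 1 (fun s => H A s - H B s) 0.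
    move=> sA; rewrite -(subrr (f s)); apply: is_deriveB; apply: dH.
      by rewrite -ltr_norml.
    by rewrite -ltr_norml (lt_le_trans sA).
  have : H A x - H B x = H A 0 - H B 0.
    have [x0|x0] := leP 0 x.
      apply/esym; apply: (@derive0_const (fun s => H A s - H B s) 0 x x0) => s /andP[s0 sx].
      by apply: dg; rewrite (le_lt_trans _ xA)// !ger0_norm.
    apply: (@derive0_const (fun s => H A s - H B s) x 0 (ltW x0)) => s /andP[s0 sx].
    by apply: dg; rewrite (le_lt_trans _ xA)// !ler0_norm ?lerN2// ltW.
  by move=> E; lra.
pose F x := H (N x) x - H (N x) 0.
exists F; split; first by rewrite /F subrr.
move=> t.
have d1 : is_derive t 1 (fun x => H (N t) x - H (N t) 0) (f t).
  have d2 : is_derive t 1 (H (N t)) (f t) by apply: dH; rewrite -ltr_norml.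
  by rewrite -[f t]subr0; exact: (is_deriveB d2 (is_derive_cst (H (N t) 0) t 1)).
apply: near_eq_is_derive d1.
near=> x.
have xN : `|x| < N t by near: x; apply: (cvgr_lt `|t|) => //; exact: norm_continuous.
apply/esym/HE => //.
rewrite /N ler_nat ltnS.
by rewrite -ltnS -(ltr_nat R) (le_lt_trans _ xN)// truncn_le.
Unshelve. all: by end_near. Qed.

Lemma antiderivative_row (m : nat) (f : R -> 'rV[R]_m) : continuous f ->
  exists F : R -> 'rV[R]_m, F 0 = 0 /\ forall t : R, is_derive t 1 F (f t).
Proof.
move=> cf.
have /choice[G HG] : forall i : 'I_m, exists G : R -> R,
    G 0 = 0 /\ forall t : R, is_derive t 1 G (f t 0 i).
  by move=> i; apply: antiderivative => t; exact: ((mx_continuousP _ _).1 (cf t)).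
exists (fun t => \row_i G i t); split.
  by apply/rowP => i; rewrite !mxE; have [] := HG i.
move=> t; apply: is_derive_mxP => i j; rewrite (ord1 i).
have -> : (fun s => (\row_i G i s) 0 j) = G j by apply/funext => s; rewrite mxE.
by have [_] := HG j; apply.
Qed.

End Antiderivative.

Section Geometric.
Variable R : realType.

Lemma le0_geometric (x c : R) : (forall n, x <= c / 2 ^+ n) -> x <= 0.
Proof.
move=> H; rewrite leNgt; apply/negP => x0.
have c0 : 0 < c by have := H 0%N; rewrite expr0 divr1; exact: lt_le_trans.
have := truncnS_gt (c / x); set n := (_.+1)%N => Hn.
have := H n; rewrite ler_pdivlMr ?exprn_gt0// leNgt => /negP; apply.
rewrite -ltr_pdivrMl// mulrC (lt_le_trans Hn)//.
by rewrite -natrX ler_nat ltnW// ltn_expl.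
Qed.

(** The intervals of radius [2 * c / 2 ^+ n] around [v n] are nested, since this radius is
    [c / 2 ^+ n] plus the next radius; the limit is the supremum of their left ends. *)
Lemma geometric_cvg_real (v : nat -> R) (c : R) :
  (forall n, `|v n.+1 - v n| <= c / 2 ^+ n) ->
  exists l, forall n, `|v n - l| <= 2 * c / 2 ^+ n.
Proof.
move=> Hv.
have c0 : 0 <= c by have := Hv 0%N; rewrite expr0 divr1; exact: le_trans.
have e0 n : 0 <= 2 * c / 2 ^+ n by rewrite divr_ge0 ?mulr_ge0// exprn_ge0.
have eS n : 2 * c / 2 ^+ n.+1 = c / 2 ^+ n.
  by rewrite exprS; field; rewrite expf_neq0.
have eE n : 2 * c / 2 ^+ n = c / 2 ^+ n + c / 2 ^+ n by rewrite -mulrA mulrDl mul1r.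
pose a n := v n - 2 * c / 2 ^+ n.
pose b n := v n + 2 * c / 2 ^+ n.
have aS n : a n <= a n.+1.
  by rewrite /a eS eE; have := Hv n; rewrite ler_norml => /andP[]; lra.
have bS n : b n.+1 <= b n.
  by rewrite /b eS eE; have := Hv n; rewrite ler_norml => /andP[]; lra.
have ndA : {homo a : m n / (m <= n)%N >-> m <= n} by apply/nondecreasing_seqP.
have niB : {homo b : m n / (m <= n)%N >-> n <= m} by apply/nonincreasing_seqP.
have ab m n : a m <= b n.
  apply: (le_trans (ndA _ _ (leq_maxl m n))).
  apply: le_trans (niB _ _ (leq_maxr m n)).
  by rewrite /a /b; have := e0 (maxn m n); lra.
have sA : has_sup (range a).
  split; first by exists (a 0%N), 0%N.
  by exists (b 0%N) => _ [m _ <-]; exact: ab.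
exists (sup (range a)) => n.
have h1 : a n <= sup (range a) by apply: sup_ubound; [by case: sA|exists n].
have h2 : sup (range a) <= b n.
  by apply: ge_sup; [by exists (a 0%N), 0%N|move=> _ [m _ <-]; exact: ab].
by rewrite ler_norml; apply/andP; split; move: h1 h2; rewrite /a /b; lra.
Qed.

Lemma geometric_cvg (p q : nat) (v : nat -> 'M[R]_(p, q)) (c : R) :
  (forall n, `|v n.+1 - v n| <= c / 2 ^+ n) ->
  exists l, forall n, `|v n - l| <= 2 * c / 2 ^+ n.
Proof.
move=> Hv.
have c0 : 0 <= c by have := Hv 0%N; rewrite expr0 divr1; exact: le_trans.
have /choice[l Hl] : forall ij : 'I_p * 'I_q, exists l : R,
    forall n, `|v n ij.1 ij.2 - l| <= 2 * c / 2 ^+ n.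
  move=> [i j]; apply: geometric_cvg_real => n /=.
  by apply: le_trans (Hv n); have := ler_mx_entry (v n.+1 - v n) i j; rewrite !mxE.
exists (\matrix_(i, j) l (i, j)) => n; apply: mx_norm_le => [|i j].
  by rewrite divr_ge0 ?mulr_ge0// exprn_ge0.
by rewrite !mxE; exact: (Hl (i, j) n).
Qed.

End Geometric.

(** * Picard iteration *)

Section Picard.
Variables (R : realType) (m : nat) (f : R -> 'rV[R]_m -> 'rV[R]_m) (y0 : 'rV[R]_m) (L K : R).
Hypotheses (L0 : 0 < L)
  (cf : forall y, continuous y -> continuous (fun t => f t (y t)))
  (lf : forall t a b, `|f t a - f t b| <= L * `|a - b|)
  (bf : forall t, `|f t y0| <= K).

Let step (y z : R -> 'rV[R]_m) :=
  z 0 = y0 /\ forall t : R, is_derive t 1 z (f t (y t)).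

Let step_ex y : continuous y -> exists z, step y z.
Proof.
move=> cy; have [F [F0 dF]] := antiderivative_row (cf cy).
exists (fun t => F t + y0); split; first by rewrite F0 add0r.
move=> t; rewrite -[f t (y t)]addr0.
by apply: is_deriveD; exact: is_derive_cst.
Qed.

Let step_cont y z : step y z -> continuous z.
Proof.
move=> [_ dz] t; apply/differentiable_continuous/derivable1_diffP.
by have [] := dz t.
Qed.

(** In the norm weighted by [expR (- (2 * L) * |t|)] a Picard step contracts by [1 / 2] on the whole
    line, so solutions are global at once and no short intervals have to be patched. *)
Let step_lip y z y' z' (C : R) : 0 <= C -> step y z -> step y' z' ->
  (forall t : R, `|y t - y' t| <= C * expR (2 * L * `|t|)) ->
  forall t : R, `|z t - z' t| <= C / 2 * expR (2 * L * `|t|).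
Proof.
move=> C0 [z0 dz] [z'0 dz'] Hy t.
have h1 : 0 < 2 * L by rewrite mulr_gt0.
have h2 (s : R) : `|s| <= `|t| -> is_derive s 1 (fun s => z s - z' s) (f s (y s) - f s (y' s)).
  by move=> _; exact: (is_deriveB (dz s) (dz' s)).
have h3 (s : R) : `|s| <= `|t| -> `|f s (y s) - f s (y' s)| <= L * C * expR (2 * L * `|s|).
  by move=> _; rewrite (le_trans (lf _ _ _))// -mulrA ler_pM2l.
have := derive_weighted_le h1 h2 h3.
rewrite z0 z'0 subrr subr0 => H; apply: (le_trans H).
have -> : L * C / (2 * L) = C / 2 by field; rewrite gt_eqF.
by rewrite ler_wpM2l ?divr_ge0// gerBl.
Qed.

Lemma picard : exists y : R -> 'rV[R]_m, y 0 = y0 /\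
  forall t : R, is_derive t 1 y (f t (y t)).
Proof.
pose S y := get [set z | step y z].
have SP y : continuous y -> step y (S y).
  by move=> /step_ex[z yz]; exact: (@getI _ [set z | step y z] z yz).
pose u n := iter n S (cst y0).
have uc n : continuous (u n).
  elim: n => [|n IH]; first by move=> t; exact: cst_continuous.
  exact: step_cont (SP _ IH).
have K0 : 0 <= K by rewrite (le_trans _ (bf 0)).
pose C := K / (2 * L); have C0 : 0 <= C by rewrite divr_ge0// mulr_ge0// ltW.
have uS n (t : R) : `|u n.+1 t - u n t| <= C / 2 ^+ n * expR (2 * L * `|t|).
  elim: n t => [|n IH] t.
    have [z0 dz] := SP (u 0%N) (uc 0%N).
    have h1 : 0 < 2 * L by rewrite mulr_gt0.
    have h3 (s : R) : `|s| <= `|t| -> `|f s (u 0%N s)| <= K * expR (2 * L * `|s|).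
      move=> _; rewrite (le_trans (bf s))// ler_peMr// -expR0 ler_expR.
      by rewrite !mulr_ge0// ltW.
    have := derive_weighted_le h1 (fun s _ => dz s) h3.
    rewrite z0 expr0 divr1 => H; apply: (le_trans H).
    by rewrite ler_wpM2l// gerBl.
  have := @step_lip (u n.+1) (u n.+2) (u n) (u n.+1) (C / 2 ^+ n) _ (SP _ (uc n.+1)) (SP _ (uc n)) IH t.
  by rewrite exprSr invfM mulrA; apply; rewrite divr_ge0// exprn_ge0.
have /choice[y Hy] : forall t : R, exists l, forall n,
    `|u n t - l| <= 2 * (C * expR (2 * L * `|t|)) / 2 ^+ n.
  by move=> t; apply: geometric_cvg => n; rewrite mulrAC.
have yc : continuous y.
  move=> t; apply/cvgrPdist_le => e e0.
  (* The speed of convergence depends on the time through the weight; on [|s| <= |t| + 1] it is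
     uniform. *)
  pose D := 2 * (C * expR (2 * L * (`|t| + 1))).
  have D0 : 0 <= D by rewrite mulr_ge0// mulr_ge0// expR_ge0.
  have [n Hn] : exists n, D / 2 ^+ n <= e / 3.
    apply/not_existsP => Hn.
    have : e / 3 <= 0 by apply: (@le0_geometric R _ D) => n; rewrite ltW// ltNge; apply/negP/Hn.
    by rewrite leNgt divr_gt0.
  have Hyn (s : R) : `|s| <= `|t| + 1 -> `|u n s - y s| <= e / 3.
    move=> st; rewrite (le_trans (Hy s n))// (le_trans _ Hn)// ler_pM2r ?invr_gt0 ?exprn_gt0//.
    by rewrite ler_pM2l// ler_wpM2l// ler_expR ler_pM2l// mulr_gt0.
  have e30 : 0 < e / 3 by rewrite divr_gt0.
  have /cvgrPdist_le/(_ _ e30) Hu := uc n t.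
  near=> s.
  have st : `|s| <= `|t| + 1.
    near: s; have : `|t| < `|t| + 1 by rewrite ltrDl.
    by move=> /(cvgr_le `|t|); apply; exact: norm_continuous.
  have us : `|u n t - u n s| <= e / 3 by near: s; exact: Hu.
  have h1 : `|u n t - y t| <= e / 3 by apply: Hyn; rewrite lerDl.
  have h2 := Hyn s st.
  have -> : y t - y s = (u n t - u n s) - (u n t - y t) + (u n s - y s).
    by apply/matrixP => i j; rewrite !mxE; ring.
  rewrite (le_trans (ler_normD _ _))//.
  have := ler_normB (u n t - u n s) (u n t - y t).
  lra.
(* The limit [y] is not differentiated as a limit. Its Picard step [z] stays within a multiple of
   [1 / 2 ^+ n] of [y] for every [n], hence equals [y] and provides the equation. *)
have [z yz] := step_ex yc.
suff zy : z = y by exists y; move: yz; rewrite /step zy.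
apply/funext => t; apply/eqP; rewrite -subr_eq0 -normr_le0.
pose E := expR (2 * L * `|t|); apply: (@le0_geometric R _ (2 * C * E)) => n.
have h1 := Hy t n.+1.
have := @step_lip y z (u n) (u n.+1) (2 * C / 2 ^+ n) _ yz (SP _ (uc n)).
move=> h2; have := h2 _ _ t; rewrite -/E => {h2} h2.
have -> : z t - y t = (z t - u n.+1 t) + (u n.+1 t - y t) by rewrite subrKA.
rewrite (le_trans (ler_normD _ _))//.
have -> : 2 * C * E / 2 ^+ n = 2 * C / 2 ^+ n / 2 * E + 2 * (C * E) / 2 ^+ n.+1.
  by rewrite exprS; field; rewrite expf_neq0.
apply: lerD => //; apply: h2; first by apply: divr_ge0; [exact: mulr_ge0|exact: exprn_ge0].
by move=> s; rewrite distrC (le_trans (Hy s n))// mulrA mulrAC.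
Unshelve. all: by end_near. Qed.

End Picard.

(** * Block vectors and clamping *)

Section RowMx.
Variables (R : realType) (m1 m2 : nat).

Lemma lsubmx_continuous : continuous (@lsubmx R 1 m1 m2).
Proof.
move=> z; apply/mx_continuousP => i j.
have -> : (fun s : 'rV[R]_(m1 + m2) => lsubmx s i j) = (fun s => s i (lshift m2 j)).
  by apply/funext => s; rewrite mxE.
exact: coord_continuous.
Qed.

Lemma rsubmx_continuous : continuous (@rsubmx R 1 m1 m2).
Proof.
move=> z; apply/mx_continuousP => i j.
have -> : (fun s : 'rV[R]_(m1 + m2) => rsubmx s i j) = (fun s => s i (rshift m1 j)).
  by apply/funext => s; rewrite mxE.
exact: coord_continuous.
Qed.

Lemma lsubmx_norm_le (z : 'rV[R]_(m1 + m2)) : `|lsubmx z| <= `|z|.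
Proof. by apply: mx_norm_le => // i j; rewrite mxE ler_mx_entry. Qed.

Lemma rsubmx_norm_le (z : 'rV[R]_(m1 + m2)) : `|rsubmx z| <= `|z|.
Proof. by apply: mx_norm_le => // i j; rewrite mxE ler_mx_entry. Qed.

Lemma row_mx_norm_le (a : 'rV[R]_m1) (b : 'rV[R]_m2) (K : R) :
  `|a| <= K -> `|b| <= K -> `|row_mx a b| <= K.
Proof.
move=> aK bK; apply: mx_norm_le => [|i j]; first exact: le_trans aK.
rewrite mxE; case: splitP => k _.
  by rewrite (le_trans _ aK)// ler_mx_entry.
by rewrite (le_trans _ bK)// ler_mx_entry.
Qed.

Lemma Cn_row_mx (V : normedModType R) k (U : set V) (a : V -> 'rV[R]_m1) (b : V -> 'rV[R]_m2) :
  open U -> Cn k U a -> Cn k U b -> Cn k U (fun x => row_mx (a x) (b x)).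
Proof.
move=> oU /(Cn_mxP _ _ oU) Ca /(Cn_mxP _ _ oU) Cb; apply/(Cn_mxP _ _ oU) => i j.
case: (splitP j) => l jl.
  apply: (eq_Cn oU) (Ca i l) => x _.
  have -> : j = lshift m2 l by exact/val_inj.
  by rewrite row_mxEl.
apply: (eq_Cn oU) (Cb i l) => x _.
have -> : j = rshift m1 l by exact/val_inj.
by rewrite row_mxEr.
Qed.

Lemma is_derive_row_mx (a : R -> 'rV[R]_m1) (b : R -> 'rV[R]_m2) (t : R) a' b' :
  is_derive t 1 a a' -> is_derive t 1 b b' ->
  is_derive t 1 (fun s => row_mx (a s) (b s)) (row_mx a' b').
Proof.
move=> da db; apply: is_derive_mxP => i j.
case: (splitP j) => l jl.
  have -> : j = lshift m2 l by exact/val_inj.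
  rewrite row_mxEl (_ : (fun _ => _) = (fun s => a s i l)).
    exact: is_derive_mxE.
  by apply/funext => s; rewrite row_mxEl.
have -> : j = rshift m1 l by exact/val_inj.
rewrite row_mxEr (_ : (fun _ => _) = (fun s => b s i l)).
  exact: is_derive_mxE.
by apply/funext => s; rewrite row_mxEr.
Qed.

Lemma is_derive_lsubmx (z : R -> 'rV[R]_(m1 + m2)) (t : R) z' :
  is_derive t 1 z z' -> is_derive t 1 (fun s => lsubmx (z s)) (lsubmx z').
Proof.
move=> dz; apply: is_derive_mxP => i j; rewrite mxE.
rewrite (_ : (fun _ => _) = (fun s => z s i (lshift m2 j))).
  exact: is_derive_mxE.
by apply/funext => s; rewrite mxE.
Qed.

Lemma is_derive_rsubmx (z : R -> 'rV[R]_(m1 + m2)) (t : R) z' :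
  is_derive t 1 z z' -> is_derive t 1 (fun s => rsubmx (z s)) (rsubmx z').
Proof.
move=> dz; apply: is_derive_mxP => i j; rewrite mxE.
rewrite (_ : (fun _ => _) = (fun s => z s i (rshift m1 j))).
  exact: is_derive_mxE.
by apply/funext => s; rewrite mxE.
Qed.

End RowMx.

Lemma Cn_precomp (R : realType) (V V' W : normedModType R) k (U : set V) (f : V -> W)
    (L : {linear V' -> V}) : continuous L -> open U -> Cn k U f ->
  Cn k [set y | U (L y)] (fun y => f (L y)).
Proof.
move=> cL oU Cf.
have -> : [set y | U (L y)] = [set y | U (L y + 0)].
  by apply/seteqP; split=> y /=; rewrite addr0.
have -> : (fun y => f (L y)) = (fun y => f (L y + 0)).
  by apply/funext => y; rewrite addr0.
exact: Cn_affine.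
Qed.

Section Clamp.
Variable R : realType.

(** Nonexpansive retraction of the line onto an interval; it makes data that are given on the
    interval global. *)
Definition clamp (lo hi t : R) : R := Num.max lo (Num.min t hi).

Lemma clamp_itv lo hi t : lo <= hi -> lo <= clamp lo hi t <= hi.
Proof. by move=> lh; rewrite /clamp le_max lexx /= ge_max lh ge_min lexx orbT. Qed.

Lemma clamp_id lo hi t : lo <= t <= hi -> clamp lo hi t = t.
Proof. by rewrite /clamp => /andP[h1 h2]; rewrite min_l// max_r. Qed.

Lemma clamp_lip lo hi a b : `|clamp lo hi a - clamp lo hi b| <= `|a - b|.
Proof.
have maxl x y : `|Num.max lo x - Num.max lo y| <= `|x - y|.
  have h1 := ler_norm (x - y); have := ler_norm (y - x); rewrite distrC => h2.
  have h3 := normr_ge0 (x - y).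
  by rewrite ler_norml; have [] := leP lo x; have [] := leP lo y => *; lra.
have minl x y : `|Num.min x hi - Num.min y hi| <= `|x - y|.
  have h1 := ler_norm (x - y); have := ler_norm (y - x); rewrite distrC => h2.
  have h3 := normr_ge0 (x - y).
  by rewrite ler_norml; have [] := leP x hi; have [] := leP y hi => *; lra.
exact: le_trans (maxl _ _) (minl _ _).
Qed.

Lemma nonexpansive_continuous (f : R -> R) :
  (forall a b, `|f a - f b| <= `|a - b|) -> continuous f.
Proof.
move=> Hf t; apply/cvgrPdist_le => e e0.
have /cvgrPdist_le/(_ _ e0) H : s @[s --> t] --> t by exact: cvg_id.
by apply: filterS H => s; exact: le_trans.
Qed.

Lemma clamp_continuous lo hi : continuous (clamp lo hi).
Proof. by apply: nonexpansive_continuous; exact: clamp_lip. Qed.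

Lemma clampN_le (T t : R) : 0 <= T -> `|clamp (- T) T t| <= T.
Proof.
by move=> T0; rewrite ler_norml clamp_itv// (le_trans _ T0)// oppr_le0.
Qed.

Lemma clampN_id (T t : R) : `|t| <= T -> clamp (- T) T t = t.
Proof. by rewrite ler_norml => /clamp_id. Qed.

End Clamp.

Lemma cvg_sumr (R : realType) (T : topologicalType) (W : normedModType R) (I : Type) (r : seq I)
    (f : I -> T -> W) (t : T) :
  (forall i, {for t, continuous (f i)}) ->
  {for t, continuous (fun s => \sum_(i <- r) f i s)}.
Proof.
move=> cf; elim: r => [|i r IH].
  rewrite (_ : (fun _ => _) = fun=> 0); first exact: cvg_cst.
  by apply/funext => s; rewrite big_nil.
rewrite (_ : (fun _ => _) = fun s => f i s + \sum_(j <- r) f j s); first exact: (continuousD (cf i) IH).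
by apply/funext => s; rewrite big_cons.
Qed.

(** * Smooth dependence of flows on initial values *)

Section LinearizedFlow.
Variables (R : realType) (m : nat) (U : set 'rV[R]_m) (F : 'rV[R]_m -> 'rV[R]_m).
Hypotheses (oU : open U) (CF : Cn 1 U F).

(** Clamping the time freezes the trajectory outside [[- T, T]]. This gives a linear equation on the
    whole line whose coefficients are evaluated in [Q], hence have one Lipschitz constant, and
    [picard] applies. *)
Lemma linearized_ode (Q : set 'rV[R]_m) (y : R -> 'rV[R]_m) (T : R) (v : 'rV[R]_m) :
  0 <= T -> compact Q -> Q `<=` U ->
  (forall s : R, `|s| <= T -> Q (y s) /\ {for s, continuous y}) ->
  exists W : R -> 'rV[R]_m, W 0 = v /\
    forall t : R, `|t| <= T -> is_derive t 1 W ('D_(W t) F (y t)).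
Proof.
move=> T0 cQ QU Hy; have [C C0 HC] := derive_mx_bound oU CF cQ QU.
have Qy t : Q (y (clamp (- T) T t)) by have [] := Hy _ (clampN_le t T0).
have Uy t : U (y (clamp (- T) T t)) by exact: QU.
have [||||W [W0 dW]] := @picard R m (fun t w => 'D_w F (y (clamp (- T) T t))) v (C + 1) (C * `|v|).
- by rewrite ltr_wpDl.
- move=> w cw t.
  have -> : (fun t => 'D_(w t) F (y (clamp (- T) T t))) =
      (fun t => \sum_i w t 0 i *: 'D_(delta_mx 0 i) F (y (clamp (- T) T t))).
    by apply/funext => s; rewrite (derive_mx_sum oU CF).
  have cy : {for t, continuous (fun t => y (clamp (- T) T t))}.
    apply: continuous_comp; first exact: clamp_continuous.
    by have [] := Hy _ (clampN_le t T0).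
  apply: (cvg_sumr (f := fun i t => w t 0 i *: 'D_(delta_mx 0 i) F (y (clamp (- T) T t)))) => i; apply: cvgZ.
    exact: ((mx_continuousP _ _).1 (cw t)).
  apply: (@continuous_comp _ _ _ (fun t => y (clamp (- T) T t)) ('D_(delta_mx 0 i) F)) => //.
  exact: (Cn_cont (Cn_derive _ CF)).
- move=> t a b; have -> : 'D_a F (y (clamp (- T) T t)) - 'D_b F (y (clamp (- T) T t)) = 'D_(a - b) F (y (clamp (- T) T t)).
    by rewrite (derive_mxD oU CF)// -[- b]scaleN1r (derive_mxZ oU CF)// scaleN1r.
  by rewrite (le_trans (HC _ _ (Qy t)))// ler_wpM2r// lerDl.
- by move=> t; exact: HC.
exists W; split; first exact: W0.
by move=> t tT; have := dW t; rewrite clampN_id.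
Qed.

(** Compactness of the time interval makes the radius of the strict estimate uniform along the
    trajectory: a radius at [y s] serves, after halving, all nearby base points. *)
Lemma uniform_taylor (y : R -> 'rV[R]_m) (T e : R) : 0 < e ->
  (forall s : R, `|s| <= T -> U (y s) /\ {for s, continuous y}) ->
  exists2 d : R, 0 < d & forall (s : R) b, `|s| <= T -> `|b - y s| < d ->
    `|F b - F (y s) - 'D_(b - y s) F (y s)| <= e * `|b - y s|.
Proof.
move=> e0 Hy.
pose P d s := forall b, `|b - y s| < d ->
    `|F b - F (y s) - 'D_(b - y s) F (y s)| <= e * `|b - y s|.
have NC : near_covering [set s : R | `|s| <= T].
  apply/compact_near_coveringP.
  rewrite (_ : mkset _ = `[- T, T]%classic); first exact: segment_compact.
  by apply/seteqP; split => s /=; rewrite in_itv /= ler_norml.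
have H : \forall d \near 0^'+, [set s : R | `|s| <= T] `<=` P d.
  apply: NC => s /= sT.
  have [Us cs] := Hy s sT; have [d d0 Hd] := strict_derive_near oU CF Us e0.
  have d20 : 0 < d / 2 by rewrite divr_gt0.
  have ys : \forall s' \near s, `|y s - y s'| < d / 2.
    by have /cvgrPdist_lt/(_ _ d20) := cs.
  near=> s' d' => /= b bd.
  have h1 : `|y s - y s'| < d / 2 by near: s'; exact: ys.
  have h2 : d' < d / 2 by near: d'; exact: nbhs_right_lt.
  have [||_] := Hd (y s') b => //.
    by rewrite distrC (lt_trans h1)// ltr_pdivrMr// ltr_pMr// ltr1n.
  rewrite -(subrKA (y s')) (le_lt_trans (ler_normD _ _))// (splitr d) ltrD//.
    exact: lt_trans h2.
  by rewrite distrC.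
near (0 : R)^'+ => d.
have Hd : [set s : R | `|s| <= T] `<=` P d by near: d; exact: H.
by exists d => // s b sT; exact: Hd.
Unshelve. all: by end_near. Qed.

End LinearizedFlow.

Section FlowSmooth.
Variable R : realType.

(* Only the time [T] and the local confinement of the trajectories to compact
   convex subsets of the domain matter, so that the same statement applies to
   the tangent system. *)
Definition flow_on (m : nat) (U : set 'rV[R]_m) (F : 'rV[R]_m -> 'rV[R]_m)
    (B : set 'rV[R]_m) (T : R) (Y : 'rV[R]_m -> R -> 'rV[R]_m) :=
  [/\ forall y, B y -> Y y 0 = y,
      forall y (t : R), B y -> `|t| <= T -> is_derive t 1 (Y y) (F (Y y t)) &
      forall y, B y -> exists Q : set 'rV[R]_m, [/\ compact Q, segment_closed Q, Q `<=` U &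
        \forall z \near y, B z /\ forall t : R, `|t| <= T -> Q (Y z t)]].

(** On the convex compact set that confines nearby trajectories [F] is Lipschitz, and Gronwall's
    lemma applies to the difference of two of them; [L + 1] ensures a positive rate. *)
Lemma flow_lipschitz (m : nat) (U : set 'rV[R]_m) F B (T : R) (Y : 'rV[R]_m -> R -> 'rV[R]_m) y :
  0 <= T -> open U -> Cn 1 U F -> flow_on U F B T Y -> B y ->
  exists2 C : R, 0 <= C & \forall z \near y, B z /\ forall t : R, `|t| <= T ->
    `|Y z t - Y y t| <= C * `|z - y|.
Proof.
move=> T0 oU CF [Y0 dY Yc] By; have [Q [cQ xQ QU nQ]] := Yc y By.
have [L L0 HL] := convex_lipschitz_mx oU CF cQ xQ QU.
exists (2 * expR (2 * (L + 1) * T)); first by rewrite mulr_ge0// expR_ge0.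
have [_ Qy] := nbhs_singleton nQ.
apply: filterS nQ => z [Bz Qz]; split=> // t tT.
have L10 : 0 < L + 1 by rewrite ltr_wpDl.
have h2 (s : R) : `|s| <= T -> is_derive s 1 (fun s => Y z s - Y y s) (F (Y z s) - F (Y y s)).
  by move=> sT; exact: (is_deriveB (dY z s Bz sT) (dY y s By sT)).
have h3 (s : R) : `|s| <= T -> `|F (Y z s) - F (Y y s)| <= (L + 1) * `|Y z s - Y y s| + 0.
  move=> sT; rewrite addr0 (le_trans (HL _ _ (Qy s sT) (Qz s sT)))//.
  by rewrite ler_wpM2r// lerDl.
have := gronwall L10 (lexx 0) h2 h3 tT.
rewrite mul0r addr0 !Y0// => H; apply: (le_trans H).
rewrite mulrAC ler_wpM2r// ler_pM2l// ler_expR ler_wpM2l// mulr_ge0// ltW//.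
Qed.

End FlowSmooth.

Section FlowDerivative.
Variables (R : realType) (m : nat) (U : set 'rV[R]_m) (F : 'rV[R]_m -> 'rV[R]_m).
Variables (B : set 'rV[R]_m) (T : R) (Y : 'rV[R]_m -> R -> 'rV[R]_m).
Hypotheses (T0 : 0 <= T) (oU : open U) (CF : Cn 1 U F) (FY : flow_on U F B T Y).

(** The defect [q = Y z - Y y - h *: W] starts at [0] and solves the linearized equation up to a
    Taylor remainder that is [o(h)] by [uniform_taylor]; by Gronwall's lemma [q] is itself
    [o(h)]. *)
Lemma flow_derivative y v (W : R -> 'rV[R]_m) (t : R) : B y -> W 0 = v ->
  (forall s : R, `|s| <= T -> is_derive s 1 W ('D_(W s) F (Y y s))) ->
  `|t| <= T -> is_derive y v (fun z => Y z t) (W t).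
Proof.
move=> By W0 dW tT; have [C C0 nC] := flow_lipschitz T0 oU CF FY By.
have [Y0 dY Yc] := FY; have [Q [cQ xQ QU nQ]] := Yc y By.
have [_ Qy] := nbhs_singleton nQ.
have [C' C'0 HC'] := derive_mx_bound oU CF cQ QU.
pose E := expR (2 * (C' + 1) * T).
have E0 : 0 < E by exact: expR_gt0.
have C'1 : 0 < C' + 1 by rewrite ltr_wpDl.
pose D := C * `|v| / (C' + 1) * E.
have D0 : 0 <= D.
  by apply: mulr_ge0; [apply: divr_ge0; [exact: mulr_ge0|exact: ltW]|exact: ltW].
have D1 : 0 < D + 1 by rewrite ltr_wpDl.
have Hlim : (fun h : R => h^-1 *: (((fun z => Y z t) \o shift y) (h *: v) - Y y t)) @ 0^' --> W t.
  apply/cvgrPdist_le => e e0.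
  pose e1 := e / (D + 1); have e10 : 0 < e1 by exact: divr_gt0.
  have [|d d0 Hd] := uniform_taylor oU CF (y := Y y) (T := T) e10.
    move=> s sT; split; first exact: QU (Qy s sT).
    by apply/differentiable_continuous/derivable1_diffP; have [] := dY y s By sT.
  have hc : (fun h : R => h *: v + y) @ 0^' --> y.
    have : (fun h : R => h *: v + y) @ 0 --> (0 : R) *: v + y.
      apply: cvgD; last exact: cvg_cst.
      by apply: cvgZr_tmp; exact: cvg_id.
    by rewrite scale0r add0r => H P /H HP; exact: nbhs_dnbhs HP.
  have Hh := hc _ (filterI nC nQ).
  have Cv : 0 < C * `|v| + 1 by rewrite ltr_wpDl// mulr_ge0.
  near=> h.
  have [[Bz Cz] [_ Qz]] : (B (h *: v + y) /\ forall t : R, `|t| <= T ->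
    `|Y (h *: v + y) t - Y y t| <= C * `|(h *: v + y) - y|) /\ (B (h *: v + y) /\
    forall t : R, `|t| <= T -> Q (Y (h *: v + y) t)) by near: h; exact: Hh.
  have h0 : h != 0 by near: h; exact: nbhs_dnbhs_neq.
  have hd : C * (`|h| * `|v|) < d.
    have : `|h| < d / (C * `|v| + 1) by near: h; apply: dnbhs0_lt; rewrite divr_gt0.
    rewrite ltr_pdivlMr// => hd; apply: le_lt_trans hd.
    by rewrite mulrCA ler_wpM2l// lerDl.
  move: Bz Cz Qz; set z := h *: v + y => Bz Cz Qz.
  have zy : z - y = h *: v by rewrite /z addrK.
  pose q s := Y z s - Y y s - h *: W s.
  have dq (s : R) : `|s| <= T ->
      is_derive s 1 q (F (Y z s) - F (Y y s) - h *: 'D_(W s) F (Y y s)).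
    move=> sT; apply: (is_deriveB (is_deriveB (dY z s Bz sT) (dY y s By sT))).
    exact: (is_deriveZ h (dW s sT)).
  have Hq (s : R) : `|s| <= T ->
      `|F (Y z s) - F (Y y s) - h *: 'D_(W s) F (Y y s)| <= (C' + 1) * `|q s| + e1 * (C * (`|h| * `|v|)).
    move=> sT; have Uy := QU _ (Qy s sT).
    have -> : F (Y z s) - F (Y y s) - h *: 'D_(W s) F (Y y s) =
        'D_(q s) F (Y y s) + (F (Y z s) - F (Y y s) - 'D_(Y z s - Y y s) F (Y y s)).
      have -> : 'D_(q s) F (Y y s) = 'D_(Y z s - Y y s) F (Y y s) - h *: 'D_(W s) F (Y y s).
        by rewrite /q (derive_mxD oU CF)// -[- (h *: _)]scaleNr (derive_mxZ oU CF)// scaleNr.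
      by rewrite [RHS]addrC addrA subrK.
    rewrite (le_trans (ler_normD _ _))// lerD//.
      by rewrite (le_trans (HC' _ _ (Qy s sT)))// ler_wpM2r// lerDl.
    have zs := Cz s sT; rewrite zy normrZ in zs.
    rewrite (le_trans (Hd s (Y z s) sT _))//; first exact: le_lt_trans hd.
    by rewrite ler_pM2l.
  have b0 : 0 <= e1 * (C * (`|h| * `|v|)).
    by apply: mulr_ge0; [exact: ltW|apply: mulr_ge0; [exact: C0|exact: mulr_ge0]].
  have := gronwall C'1 b0 dq Hq tT.
  have -> : `|q 0| = 0 by rewrite /q !Y0// W0 zy subrr normr0.
  rewrite mulr0 add0r => Hqt.
  have -> : W t - h^-1 *: (((fun z => Y z t) \o shift y) (h *: v) - Y y t) = - (h^-1 *: q t).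
    have -> : h^-1 *: q t = h^-1 *: (Y z t - Y y t) - W t.
      by rewrite /q [LHS]scalerBr; congr (_ - _); rewrite scalerA mulVf// scale1r.
    by rewrite opprB.
  rewrite normrN normrZ normfV ler_pdivrMl ?normr_gt0// (le_trans Hqt)//.
  have -> : e1 * (C * (`|h| * `|v|)) / (C' + 1) = `|h| * (e1 * (C * `|v| / (C' + 1))).
    by field; rewrite gt_eqF.
  rewrite -mulrA ler_wpM2l// (@le_trans _ _ (e1 * D))//.
    rewrite -[leLHS]mulrA; apply: ler_wpM2l; first exact: ltW.
    apply: ler_wpM2l; first by apply: divr_ge0; [exact: mulr_ge0|exact: ltW].
    by rewrite ler_expR ler_pM2l// mulr_gt0.
  by rewrite /e1 mulrAC ler_pdivrMr// ler_pM2l// lerDl.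
split; last exact: cvg_lim Hlim.
by apply/cvg_ex; exists (W t).
Unshelve. all: by end_near. Qed.

End FlowDerivative.

Section TangentFlow.
Variables (R : realType) (m : nat).
Local Notation l := (@lsubmx R 1 m m).
Local Notation r := (@rsubmx R 1 m m).

(** The variational system: a point moves by [F], a tangent vector over it by the linearization of
    [F]. *)
Definition tangent_field (F : 'rV[R]_m -> 'rV[R]_m) (z : 'rV[R]_(m + m)) : 'rV[R]_(m + m) :=
  row_mx (F (l z)) ('D_(r z) F (l z)).

Lemma open_lsubmx (U : set 'rV[R]_m) : open U -> open [set z | U (l z)].
Proof. by move=> oU; apply: open_comp => // z _; exact: lsubmx_continuous. Qed.

Lemma tangent_field_Cn k (U : set 'rV[R]_m) F : open U -> Cn k.+1 U F ->
  Cn k [set z | U (l z)] (tangent_field F).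
Proof.
move=> oU CF; have oU2 := open_lsubmx oU.
have C1F : Cn 1 U F.
  by clear -CF; elim: k CF => [|k IH] CF; [exact: CF|exact: IH (CnW CF)].
apply: Cn_row_mx => //.
  by apply: Cn_precomp => //; [exact: lsubmx_continuous|exact: CnW].
apply: (@eq_Cn _ _ _ _ _ (fun z => \sum_i (r z) 0 i *: 'D_(delta_mx 0 i) F (l z))) => //.
  by move=> z Uz; rewrite (derive_mx_sum oU C1F).
apply: Cn_sum => // i _; apply: CnZmx => //.
  apply: (Cn_mxP _ _ oU2).1; apply: Cn_linear => //; exact: rsubmx_continuous.
by apply: (Cn_precomp (f := 'D_(delta_mx 0 i) F)) => //; [exact: lsubmx_continuous|exact: Cn_derive].
Qed.

Lemma compact_tangent (Q : set 'rV[R]_m) (M : R) : compact Q ->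
  compact [set z | Q (l z) /\ `|r z| <= M].
Proof.
move=> cQ; apply: bounded_closed_compact.
  have [M' [M'r HM']] := compact_bounded cQ.
  exists (Num.max (M' + 1) M); split; first by rewrite num_real.
  move=> x; rewrite gt_max => /andP[x1 x2] z /= [Qz zM].
  rewrite -[z]hsubmxK; apply: row_mx_norm_le; last by rewrite (le_trans zM)// ltW.
  by apply: HM' Qz; rewrite (lt_trans _ x1)// ltrDl.
apply: closedI.
  apply: closed_comp; first by move=> z _; exact: lsubmx_continuous.
  by apply: compact_closed => //; exact: norm_hausdorff.
apply: (@closed_comp _ _ (fun z => `|r z| : R) [set x | x <= M]); last exact: closed_le.
move=> z _; apply: (@continuous_comp _ _ _ r (fun M => `|M| : R)); first exact: rsubmx_continuous.
exact: norm_continuous.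
Qed.

Lemma segment_closed_tangent (Q : set 'rV[R]_m) (M : R) : segment_closed Q ->
  segment_closed [set z | Q (l z) /\ `|r z| <= M].
Proof.
move=> xQ a b s [Qa aM] [Qb bM] s01; split.
  by rewrite linearD linearZ linearB; exact: xQ.
rewrite linearD linearZ linearB.
have -> : r a + s *: (r b - r a) = (1 - s) *: r a + s *: r b.
  by rewrite scalerBr scalerBl scale1r addrA addrAC.
case/andP: s01 => s0 s1.
rewrite (le_trans (ler_normD _ _))// !normrZ (ger0_norm s0) ger0_norm ?subr_ge0//.
have -> : M = (1 - s) * M + s * M by rewrite -mulrDl subrK mul1r.
by rewrite lerD// ler_wpM2l// subr_ge0.
Qed.

(** A flow with its derivative in the initial value adjoined is again a flow in the sense of
    [flow_on]. The confining set is [Q] times a ball whose radius [M] comes from Gronwall's lemma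
    for the linearized equation. This closes the induction of [flow_Cn]. *)
Lemma tangent_flow (U : set 'rV[R]_m) F B (T : R) (Y : 'rV[R]_m -> R -> 'rV[R]_m) :
  0 <= T -> open U -> Cn 1 U F -> flow_on U F B T Y ->
  exists2 W : 'rV[R]_(m + m) -> R -> 'rV[R]_m,
    flow_on [set z | U (l z)] (tangent_field F) [set z | B (l z)] T
      (fun z t => row_mx (Y (l z) t) (W z t)) &
    forall y v (t : R), B y -> `|t| <= T -> is_derive y v (fun z => Y z t) (W (row_mx y v) t).
Proof.
move=> T0 oU CF FY; have [Y0 dY Yc] := FY.
have /choice[W HW] : forall z : 'rV[R]_(m + m), exists W : R -> 'rV[R]_m, B (l z) ->
    W 0 = r z /\ forall t : R, `|t| <= T -> is_derive t 1 W ('D_(W t) F (Y (l z) t)).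
  move=> z; have [Bz|] := pselect (B (l z)); last by exists (fun=> 0).
  have [Q [cQ xQ QU nQ]] := Yc _ Bz; have [_ Qz] := nbhs_singleton nQ.
  have [|W [W0 dW]] := linearized_ode oU CF (r z) T0 cQ QU (y := Y (l z)).
    move=> s sT; split; first exact: Qz.
    by apply/differentiable_continuous/derivable1_diffP; have [] := dY _ s Bz sT.
  by exists W.
exists W; last first.
  move=> y v t By tT; have [] := HW (row_mx y v); rewrite row_mxKl// row_mxKr => W0 dW.
  exact: (flow_derivative T0 oU CF FY By W0 dW tT).
split.
- by move=> z /= Bz; have [-> _] := HW z Bz; rewrite Y0// hsubmxK.
- move=> z t /= Bz tT; have [_ dW] := HW z Bz.
  rewrite /tangent_field row_mxKl row_mxKr.
  exact: is_derive_row_mx (dY _ t Bz tT) (dW t tT).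
- move=> z /= Bz; have [Q [cQ xQ QU nQ]] := Yc _ Bz.
  have [C C0 HC] := derive_mx_bound oU CF cQ QU.
  pose M := 2 * (`|r z| + 1) * expR (2 * (C + 1) * T).
  exists [set z | Q (l z) /\ `|r z| <= M]; split.
  + exact: compact_tangent.
  + exact: segment_closed_tangent.
  + by move=> z' [/QU].
  + have n1 : \forall z' \near z, B (l z') /\ forall t : R, `|t| <= T -> Q (Y (l z') t).
      exact: lsubmx_continuous nQ.
    have n2 : \forall z' \near z, `|r z'| < `|r z| + 1.
      have cn : `|r z'| @[z' --> z] --> `|r z| by exact: (cvg_norm (@rsubmx_continuous R m m z)).
      by apply: (cvgr_lt (`|r z|) cn); rewrite ltrDl.
    apply: filterS2 n1 n2 => z' [Bz' Qz'] rz'; split=> // t tT /=.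
    rewrite row_mxKl row_mxKr; split; first exact: Qz'.
    have [W0 dW] := HW z' Bz'.
    have C1 : 0 < C + 1 by rewrite ltr_wpDl.
    have h3 (s : R) : `|s| <= T -> `|'D_(W z' s) F (Y (l z') s)| <= (C + 1) * `|W z' s| + 0.
      move=> sT; rewrite addr0 (le_trans (HC _ _ (Qz' s sT)))//.
      by rewrite ler_wpM2r// lerDl.
    have := gronwall C1 (lexx 0) dW h3 tT; rewrite mul0r addr0 W0 => H.
    apply: (le_trans H); apply: ler_pM; [exact: mulr_ge0|exact: expR_ge0| |].
      by rewrite ler_pM2l// ltW.
    by rewrite ler_expR ler_pM2l// mulr_gt0.
Qed.

End TangentFlow.

(** A derivative of the flow is a component of the tangent flow, which lives in dimension [m + m];
    the induction on [k] therefore runs over all dimensions and fields at once. *)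
Theorem flow_Cn (R : realType) k : forall (m : nat) (U : set 'rV[R]_m) F B (T : R)
    (Y : 'rV[R]_m -> R -> 'rV[R]_m),
  0 <= T -> open U -> open B -> smooth U F -> flow_on U F B T Y ->
  forall t : R, `|t| <= T -> Cn k B (fun y => Y y t).
Proof.
elim: k => [|k IH] m U F B T Y T0 oU oB CF FY t tT.
  split; last exact I.
  move=> y By; have [C C0 nC] := flow_lipschitz T0 oU (CF 1%N) FY By.
  apply/(@cvgrPdist_lt _ _ _ (nbhs y) (nbhs_filter y)) => e e0; have C1 : 0 < C + 1 by rewrite ltr_wpDl.
  have e1 : 0 < e / (C + 1) by exact: divr_gt0.
  have /cvgrPdist_lt/(_ _ e1) H : z @[z --> y] --> y by exact: cvg_id.
  near=> z.
  have [Bz Cz] : B z /\ forall t : R, `|t| <= T -> `|Y z t - Y y t| <= C * `|z - y|.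
    by near: z; exact: nC.
  have : `|y - z| < e / (C + 1) by near: z; exact: H.
  rewrite ltr_pdivlMr// distrC => yz.
  rewrite distrC (le_lt_trans (Cz t tT))// (le_lt_trans _ yz)// mulrC.
  by rewrite ler_wpM2l// lerDl.
have [W FW dW] := tangent_flow T0 oU (CF 1%N) FY.
apply: CnS => [y By|v].
  exact: (Cn_cont (IH m U F B T Y T0 oU oB CF FY t tT) By).
have dWt y : B y -> is_derive y v (fun z => Y z t) (W (row_mx y v) t).
  by move=> By; exact: dW.
split=> [y By|]; first by have [] := dWt y By.
have oB2 := open_lsubmx oB; have oU2 := open_lsubmx oU.
have CF2 : smooth [set z | U (lsubmx z)] (tangent_field F).
  by move=> k'; exact: tangent_field_Cn.
have C2 := IH _ _ _ _ _ _ T0 oU2 oB2 CF2 FW t tT.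
have CW : Cn k [set z : 'rV_(m + m) | B (lsubmx z)] (fun z => W z t).
  apply/(Cn_mxP _ _ oB2) => i j.
  apply: (eq_Cn oB2) ((Cn_mxP _ _ oB2).1 C2 i (rshift m j)) => z _.
  by rewrite row_mxEr.
have Crow : Cn k B (fun y => row_mx y v).
  apply: Cn_row_mx => //; last exact: Cn_cst.
  by apply: (@Cn_linear _ _ _ _ _ (@idfun 'rV[R]_m)) => // y; exact: cvg_id.
apply: (eq_Cn oB) (Cn_comp oB oB2 _ Crow CW) => [y By|y By /=].
  by have [_ ->] := dWt y By.
by rewrite row_mxKl.
Unshelve. all: by end_near. Qed.

Lemma curve_derive (R : realType) (W : normedModType R) k (J : set R) (c : R -> W) (t : R) :
  Cn k.+1 (J : set R^o) (c : R^o -> W) -> J t -> is_derive t 1 c (c^`()%classic t).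
Proof.
move=> Cc Jt; have d := Cn_derivable (1 : R^o) Cc Jt.
split; last by rewrite derive1E.
exact d.
Qed.

Lemma derive_scale1 (R : realType) (W : normedModType R) (c : R -> W) (t v : R) :
  derivable c t 1 -> is_derive t v c (v *: 'D_1 c t).
Proof.
move=> dc; have dif : differentiable c t by apply/derivable1_diffP; exact dc.
split; first exact: diff_derivable.
by rewrite !deriveE// -[in LHS](mulr1 v) -[v * 1]/(v *: (1 : R^o)) linearZ.
Qed.

Lemma Cn_curveS (R : realType) (W : normedModType R) k (J : set R) (c c' : R -> W) :
  open J -> (forall t : R, J t -> is_derive t 1 c (c' t)) ->
  Cn k (J : set R^o) (c' : R^o -> W) -> Cn k.+1 (J : set R^o) (c : R^o -> W).
Proof.
move=> oJ dc Cc'; apply: CnS => [t Jt|v].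
  by apply/differentiable_continuous/derivable1_diffP; have [d _] := dc t Jt; exact d.
have dv t : J t -> is_derive t v c (v *: c' t).
  by move=> Jt; have [d <-] := dc t Jt; exact: derive_scale1 d.
split=> [t Jt|]; first by have [d _] := dv t Jt; exact d.
apply: (@eq_Cn _ _ _ _ _ (fun t => v *: c' t)) => // [t Jt|].
  by have [_ d] := dv t Jt; rewrite -d.
exact: CnZ.
Qed.

Lemma Cn_derive1 (R : realType) (W : normedModType R) k (J : set R) (c : R -> W) :
  open J -> Cn k.+1 (J : set R^o) (c : R^o -> W) -> Cn k (J : set R^o) (c^`()%classic : R^o -> W).
Proof.
move=> oJ Cc; have C1 := Cn_derive (1 : R^o) Cc.
apply: (eq_Cn _ _ C1) => // t Jt; by rewrite derive1E.
Qed.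

(** * Scalar products and pairings *)

Section Dot.
Variables (R : realType) (n : nat).
Implicit Types u v w x : 'rV[R]_n.

Definition dot u v : R := (u *m v^T) 0 0.

Lemma dotE u v : dot u v = \sum_i u 0 i * v 0 i.
Proof. by rewrite /dot mxE; apply: eq_bigr => i _; rewrite mxE. Qed.

Lemma dotC u v : dot u v = dot v u.
Proof. by rewrite !dotE; apply: eq_bigr => i _; rewrite mulrC. Qed.

Lemma dotDl u v w : dot (u + v) w = dot u w + dot v w.
Proof. by rewrite /dot mulmxDl mxE. Qed.

Lemma dotZl (a : R) u v : dot (a *: u) v = a * dot u v.
Proof. by rewrite /dot -scalemxAl mxE. Qed.

Lemma dotDr u v w : dot w (u + v) = dot w u + dot w v.
Proof. by rewrite dotC dotDl !(dotC w). Qed.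

Lemma dotZr (a : R) u v : dot u (a *: v) = a * dot u v.
Proof. by rewrite dotC dotZl dotC. Qed.

Lemma dotNr u v : dot u (- v) = - dot u v.
Proof. by rewrite -scaleN1r dotZr mulN1r. Qed.

Lemma dot_gt0 u : u != 0 -> 0 < dot u u.
Proof.
move=> u0; rewrite lt_neqAle dotE sumr_ge0 ?andbT; last by move=> i _; rewrite -expr2 sqr_ge0.
apply: contraNneq u0 => /esym/eqP; rewrite psumr_eq0; last first.
  by move=> i _; rewrite -expr2 sqr_ge0.
move=> /allP H; apply/eqP/rowP => i; rewrite mxE.
by have := H i (mem_index_enum _); rewrite /= mulf_eq0 orbb => /eqP.
Qed.

Lemma dot_mulmx u v (G : 'M[R]_n) : dot (u *m G) v = pairing G u v.
Proof. by []. Qed.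

Lemma mulmx_dot u v w : u *m (v^T *m w) = dot u v *: w.
Proof. by rewrite mulmxA [X in X *m w](mx11_scalar (u *m v^T)) mul_scalar_mx. Qed.

Lemma pairingDl (G : 'M[R]_n) u v w : pairing G (u + v) w = pairing G u w + pairing G v w.
Proof. by rewrite /pairing !mulmxDl mxE. Qed.

Lemma pairingZl (G : 'M[R]_n) (a : R) u v : pairing G (a *: u) v = a * pairing G u v.
Proof. by rewrite /pairing -!scalemxAl mxE. Qed.

Lemma pairingZr (G : 'M[R]_n) (a : R) u v : pairing G u (a *: v) = a * pairing G u v.
Proof. by rewrite /pairing linearZ -scalemxAr mxE. Qed.

Lemma pairingC (G : 'M[R]_n) u v : G^T = G -> pairing G u v = pairing G v u.
Proof.
move=> GT; rewrite /pairing -[in RHS]GT -[in LHS](trmxK (u *m G *m v^T)) mxE.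
by rewrite !trmx_mul trmxK mulmxA GT.
Qed.

Lemma is_derive_dot (a b : R -> 'rV[R]_n) (t : R) a' b' :
  is_derive t 1 a a' -> is_derive t 1 b b' ->
  is_derive t 1 (fun s => dot (a s) (b s)) (dot a' (b t) + dot (a t) b').
Proof.
move=> da db.
have E s : dot (a s) (b s) = (\sum_i (fun s => a s 0 i * b s 0 i : R)) s.
  by rewrite dotE fct_sumE.
have -> : (fun s => dot (a s) (b s)) = \sum_i (fun s => a s 0 i * b s 0 i : R).
  by apply/funext => s; exact: E.
have -> : dot a' (b t) + dot (a t) b' = \sum_i (a t 0 i *: b' 0 i + b t 0 i *: a' 0 i).
  rewrite !dotE -big_split /=; apply: eq_bigr => i _.
  by rewrite [in RHS]addrC; congr (_ + _); rewrite [in RHS]/GRing.scale /= mulrC.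
apply: is_derive_sum => i.
exact: is_deriveM (is_derive_mxE 0 i da) (is_derive_mxE 0 i db).
Qed.

Lemma Cn_dot (V : normedModType R) k (U : set V) (a b : V -> 'rV[R]_n) :
  open U -> Cn k U a -> Cn k U b -> Cn k U (fun z => dot (a z) (b z) : R^o).
Proof.
move=> oU Ca Cb; apply: (Cn_mxP _ _ oU).1; apply: Cn_mulmx => //.
exact: Cn_trmx.
Qed.

End Dot.

(** * Geodesics *)

Section Spray.
Variables (R : realType) (n : nat) (b : bool) (M : set 'rV[R]_n).
(** For [eps = 0] the equation of [M] is void; for [eps = 1] it is that of the unit sphere. The
    formulas below are uniform in [eps]. *)
Let eps : R := b%:R.
Hypothesis HM : forall x, M x <-> eps * (dot x x - 1) = 0.
Variable g : riemannian_metric M.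
Implicit Types u v w x : 'rV[R]_n.
Local Notation l := (@lsubmx R 1 n n).
Local Notation r := (@rsubmx R 1 n n).

Let eps2 : eps * eps = eps.
Proof. by rewrite /eps; case: b; rewrite ?mulr1 ?mulr0. Qed.

Let MN x : M x -> eps * dot x x = eps.
Proof. by move=> /HM; rewrite mulrBr mulr1 => /eqP; rewrite subr_eq0 => /eqP. Qed.

Lemma tangent_dot x v : M x -> tangent M x v -> eps * dot x v = 0.
Proof.
move=> Mx [c [c0 [e e0 [sc Mc]]] dc].
have e0' : (`]- e, e[%classic : set R) (0 : R) by rewrite /= in_itv /= oppr_lt0 e0.
have d0 : is_derive (0 : R) 1 c v by rewrite -dc; exact: curve_derive (sc 1%N) e0'.
have d1 := is_deriveZ eps (is_derive_dot d0 d0).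
have : is_derive (0 : R) 1 (eps *: (fun s => dot (c s) (c s) : R)) 0.
  apply: near_eq_is_derive (is_derive_cst eps (0 : R) 1).
  near=> s; rewrite /cst; apply/esym; apply: (@MN (c s)); apply: Mc.
  have : `|s| < e.
    near: s; have := @cvgr_lt R R (nbhs (0 : R)) _ (fun s => `|s|) 0.
    by apply => //; rewrite -[X in _ --> X](@normr0 _ R); exact: norm_continuous.
  by rewrite ltr_norml.
move=> d2; have := @derive_val _ _ _ _ _ _ _ d1; have -> := @derive_val _ _ _ _ _ _ _ d2.
rewrite c0 (dotC v) => /esym; rewrite -mulr2n [_ *: _]mulrnAr => /eqP.
by rewrite mulrn_eq0 /= => /eqP.
Unshelve. all: by end_near. Qed.

Lemma dot_tangent x v : M x -> eps * dot x v = 0 -> tangent M x v.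
Proof.
(* The value of [a] comes from [(1 - a t^2)^2 + t^2 |v|^2 = (1 + a t^2)^2], which puts the curve on
   the sphere; for [eps = 0] the curve is the line [x + t *: v]. *)
move=> Mx xv; pose a : R := eps * dot v v / 4.
have a0 : 0 <= a.
  apply: divr_ge0 => //; apply: mulr_ge0; first exact: ler0n.
  by have [->|/dot_gt0/ltW//] := eqVneq v 0; rewrite /dot mul0mx mxE.
(* rational parametrization of the great circle through [x] directed by [v] *)
pose c (t : R) := (1 + a * (t * t))^-1 *: ((1 - a * (t * t)) *: x + t *: v).
have s0 (t : R) : 0 < 1 + a * (t * t) by rewrite ltr_wpDr// mulr_ge0// -expr2 sqr_ge0.
exists c; last first.
  rewrite derive1E; apply: (@derive_val _ _ _ _ _ _ v).
  apply: is_derive_mxP => i j.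
  have -> : (fun t => c t i j) = (fun t : R => (1 + a * (t * t))^-1 * ((1 - a * (t * t)) * x i j + t * v i j)).
    by apply/funext => t; rewrite /c !mxE.
  have d1 : is_derive (0 : R) 1 (fun t : R => a * (t * t)) 0.
    have dt := is_deriveM (is_derive_id (0 : R) 1) (is_derive_id (0 : R) 1).
    have := is_deriveZ a dt; rewrite !scale0r addr0 scaler0; exact.
  have d2 : is_derive (0 : R) 1 (fun t : R => (1 + a * (t * t))) 0.
    by have := is_deriveD (is_derive_cst (1 : R) (0 : R) 1) d1; rewrite addr0; exact.
  have d3 : is_derive (0 : R) 1 (fun t : R => (1 + a * (t * t))^-1) 0.
    have n0 : 1 + a * (0 * 0) != 0 by rewrite gt_eqF.
    have := is_deriveV (f := fun t : R => 1 + a * (t * t)) n0 d2; rewrite scaler0; exact.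
  have d4 : is_derive (0 : R) 1 (fun t : R => (1 - a * (t * t))) 0.
    by have := is_deriveB (is_derive_cst (1 : R) (0 : R) 1) d1; rewrite subr0; exact.
  have d5 : is_derive (0 : R) 1 (fun t : R => (1 - a * (t * t)) * x i j + t * v i j) (v i j).
    have e1 := is_deriveM d4 (is_derive_cst (x i j) (0 : R) 1).
    have e2 := is_deriveM (is_derive_id (0 : R) 1) (is_derive_cst (v i j) (0 : R) 1).
    by apply: (is_derive_eq (is_deriveD e1 e2)); rewrite /GRing.scale /= /cst; ring.
  apply: (is_derive_eq (is_deriveM d3 d5)); rewrite /GRing.scale /=.
  by rewrite !mul0r !mulr0 !addr0 invr1 mul1r.
split; first by rewrite /c !mul0r mulr0 addr0 invr1 subr0 !scale1r scale0r addr0.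
exists 1 => //; split.
  move=> k; apply: sub_Cn (@subsetT _ _) _.
  have oT : open [set: R^o] by exact: openT.
  have Ct : Cn k [set: R^o] (fun t : R^o => t : R^o).
    by apply: (@Cn_linear _ _ _ _ _ (@idfun R^o)) => // y; exact: cvg_id.
  have Cs : Cn k [set: R^o] (fun t : R^o => a * (t * t) : R^o).
    by apply: CnM => //; [exact: Cn_cst|exact: CnM].
  apply: CnZmx => //.
    apply: Cn_inv => //; first by move=> t _; rewrite gt_eqF.
    by apply: CnD => //; exact: Cn_cst.
  have C1 : Cn k [set: R^o] (fun t : R^o => 1 - a * (t * t) : R^o).
    have H : Cn k [set: R^o] (fun t : R^o => (1 : R^o) + (- a) * (t * t) : R^o).
      apply: CnD => //; first exact: Cn_cst.
      by apply: CnM => //; [exact: Cn_cst|exact: CnM].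
    by apply: (eq_Cn oT) H => t _; rewrite mulNr.
  by apply: CnD => //; apply: CnZmx => //; exact: Cn_cst.
move=> t _; apply/HM; rewrite /c dotZl dotZr dotDl !dotDr !dotZl !dotZr.
move: a0 s0 xv (MN Mx); rewrite (dotC v x) {}/c /a /eps; case: b; last by rewrite !mul0r.
rewrite !mul1r => a0 s0 -> ->; have := s0 t; set q := dot v v => h.
rewrite -[true%:R]/(1 : R); field; rewrite gt_eqF//; move: h; lra.
Qed.

(** On [M] this is the Euclidean orthogonal projection onto the tangent space, acting on rows; the
    formula makes sense on the whole ambient space. *)
Definition tproj x : 'M[R]_n := 1%:M - eps *: (x^T *m x).

(** The metric is known to be positive only on tangent vectors. Keeping its tangential part and
    putting the Euclidean form on the normal line gives a matrix that is positive definite on [M],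
    hence invertible near [M]. *)
Definition gram x : 'M[R]_n := tproj x *m g x *m tproj x + eps *: (x^T *m x).

Definition christoffel_row x u : 'rV[R]_n :=
  u *m 'D_u g x - 2^-1 *: \row_j pairing ('D_(delta_mx 0 j) g x) u u.

(** On [M], an acceleration [w - (eps |u|^2) x] with [w] tangent satisfies the geodesic equation
    exactly when [g] pairs [w] with tangent vectors as this covector does; the first term
    compensates the normal part of the acceleration. *)
Definition spray_rhs x u : 'rV[R]_n :=
  (eps * dot u u) *: (x *m g x) - christoffel_row x u.

Definition tspray x u : 'rV[R]_n := spray_rhs x u *m tproj x *m invmx (gram x).

(** Equal to [1] in the vector space and to [|x|^2] for the sphere, so that one division serves both
    cases. *)
Definition norm2 x : R := 1 - eps + eps * dot x x.

(** The multiple of the position is chosen so that [eps * (x . x'' + x' . x') = 0] on all of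
    [spray_domain], not merely on [M]. Thus [eps * (x . x')] is conserved, and solutions that start
    tangent to [M] stay in [M]. *)
Definition spray (z : 'rV[R]_(n + n)) : 'rV[R]_n :=
  tspray (l z) (r z) -
  (eps * (dot (l z) (tspray (l z) (r z)) + dot (r z) (r z)) * (norm2 (l z))^-1) *: l z.

Definition spray_domain : set 'rV[R]_n := [set x | \det (gram x) != 0 /\ norm2 x != 0].

Let Cg k : Cn k setT g.
Proof. exact: metric_smooth. Qed.

Lemma christoffel_rowE x u v : christoffel g x u v = dot (christoffel_row x u) v.
Proof.
rewrite /christoffel /christoffel_row dotDl dot_mulmx; congr (_ + _).
rewrite -[X in dot X v]scaleN1r dotZl mulN1r dotZl; congr (- (2^-1 * _)); rewrite dotE.
under [RHS]eq_bigr do rewrite mxE.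
rewrite (derive_mx_sum openT (Cg 1))// /pairing mulmx_sumr mulmx_suml summxE.
by apply: eq_bigr => i _; rewrite -scalemxAr -scalemxAl mxE mulrC.
Qed.

Lemma tprojE x v : v *m tproj x = v - (eps * dot v x) *: x.
Proof. by rewrite /tproj mulmxBr mulmx1 -scalemxAr mulmx_dot scalerA. Qed.

Lemma tproj_tr x : (tproj x)^T = tproj x.
Proof. by rewrite /tproj linearB /= trmx1 linearZ /= trmx_mul trmxK. Qed.

Lemma tproj_tangent x v : M x -> eps * dot x (v *m tproj x) = 0.
Proof.
move=> Mx; rewrite tprojE dotDr dotNr dotZr mulrBr.
have := MN Mx; rewrite (dotC v x) /eps; case: b; last by rewrite !mul0r subrr.
by rewrite !mul1r => ->; rewrite mulr1 subrr.
Qed.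

Lemma gramE x v : v *m gram x = v *m tproj x *m g x *m tproj x + (eps * dot v x) *: x.
Proof. by rewrite /gram mulmxDr !mulmxA -scalemxAr -mulmxA mulmx_dot scalerA. Qed.

Lemma gram_pairing x v :
  pairing (gram x) v v = pairing (g x) (v *m tproj x) (v *m tproj x) + eps * dot v x * dot v x.
Proof.
rewrite -dot_mulmx gramE dotDl dotZl (dotC x v); congr (_ + _).
by rewrite /pairing [in RHS]trmx_mul tproj_tr mulmxA.
Qed.

(** If the tangential part [w] of [v] is nonzero, positivity comes from [g]; otherwise [v] is a
    multiple of [x] and the Euclidean term is positive. *)
Lemma gram_pos x v : M x -> v != 0 -> 0 < pairing (gram x) v v.
Proof.
move=> Mx v0; rewrite gram_pairing; set w := v *m tproj x.
have wt : eps * dot x w = 0 by exact: tproj_tangent.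
have e0 : 0 <= eps * dot v x * dot v x.
  rewrite -mulrA; apply: mulr_ge0; first exact: ler0n.
  by rewrite -expr2 sqr_ge0.
have [w0|wN0] := eqVneq w 0; last first.
  have h := metric_pos g Mx (dot_tangent Mx wt) wN0; lra.
rewrite w0 {1}/pairing mul0mx mul0mx mxE add0r lt_neqAle e0 andbT eq_sym.
move: w0; rewrite /w tprojE /eps; case: b; last by rewrite !mul0r scale0r subr0 => /eqP; rewrite (negPf v0).
rewrite !mul1r => /eqP; rewrite subr_eq0 => /eqP vx.
apply/negP; rewrite mulf_eq0 orbb => /eqP vx0; move: vx v0; rewrite vx0 scale0r => ->.
by rewrite eqxx.
Qed.

Lemma gram_tangent x v : M x -> tangent M x v -> pairing (gram x) v v = pairing (g x) v v.
Proof.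
move=> Mx tv; have := tangent_dot Mx tv; rewrite gram_pairing tprojE (dotC v x) => ->.
by rewrite scale0r subr0 mul0r addr0.
Qed.

Lemma spray_domainP x : M x -> spray_domain x.
Proof.
move=> Mx; split; last first.
  by rewrite /norm2 (MN Mx) subrK oner_neq0.
apply/negP => /det0P[v v0 vG]; have := gram_pos Mx v0.
by rewrite /pairing vG mul0mx mxE ltxx.
Qed.

Let oT : open [set: 'rV[R]_n].
Proof. exact: openT. Qed.

Let Cid k : Cn k [set: 'rV[R]_n] (fun x => x).
Proof. by apply: (@Cn_linear _ _ _ _ _ (@idfun 'rV[R]_n)) => // y; exact: cvg_id. Qed.

Let Cxx k : Cn k [set: 'rV[R]_n] (fun x => eps *: (x^T *m x)).
Proof. by apply: CnZ => //; apply: Cn_mulmx => //; exact: Cn_trmx. Qed.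

Let Ctproj k : Cn k setT tproj.
Proof.
have H : Cn k setT (fun x : 'rV[R]_n => 1%:M + (-1 : R) *: (eps *: (x^T *m x))).
  by apply: CnD => //; [exact: Cn_cst|exact: CnZ].
by apply: (eq_Cn oT) H => x _; rewrite scaleN1r.
Qed.

Lemma gram_Cn k : Cn k setT gram.
Proof. by apply: CnD => //; apply: Cn_mulmx => //; exact: Cn_mulmx. Qed.

Let Cnorm2 k : Cn k setT (norm2 : 'rV[R]_n -> R^o).
Proof.
have H : Cn k setT (fun x : 'rV[R]_n => (1 - eps : R^o) + eps * dot x x : R^o).
  by apply: CnD => //; [exact: Cn_cst|apply: CnM => //; [exact: Cn_cst|exact: Cn_dot]].
by apply: (eq_Cn oT) H.
Qed.

Lemma spray_domain_open : open spray_domain.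
Proof.
have cd : continuous (fun x => \det (gram x) : R).
  by move=> x; exact: (Cn_cont (Cn_det oT (gram_Cn 0))).
have cn : continuous (norm2 : _ -> R) by move=> x; exact: (Cn_cont (Cnorm2 0)).
apply: openI; apply: (open_comp (D := [set y : R | y != 0])) => //; exact: open_neq.
Qed.

Local Notation Om := [set z : 'rV[R]_(n + n) | spray_domain (l z)].

Let oOm : open Om.
Proof. by apply: open_lsubmx; exact: spray_domain_open. Qed.

Let Cpre p q k (f : 'rV[R]_n -> 'M[R]_(p, q)) : Cn k setT f -> Cn k Om (fun z => f (l z)).
Proof.
move=> Cf; apply: sub_Cn (@subsetT _ _) _.
by apply: (Cn_precomp (U := setT)) => //; exact: lsubmx_continuous.
Qed.

Let Cl k : Cn k Om l. Proof. exact: (Cpre (Cid k)). Qed.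

Let Cr k : Cn k Om r.
Proof. by apply: Cn_linear => //; exact: rsubmx_continuous. Qed.

Let CDg k : Cn k Om (fun z => 'D_(r z) g (l z)).
Proof.
apply: (@eq_Cn _ _ _ _ _ (fun z => \sum_i (r z) 0 i *: 'D_(delta_mx 0 i) g (l z))) => //.
  by move=> z _; rewrite (derive_mx_sum oT (Cg 1)).
apply: Cn_sum => // i _; apply: CnZmx => //; first exact: (Cn_mxP _ _ oOm).1 (Cr k) 0 i.
by apply: (Cpre (f := 'D_(delta_mx 0 i) g)); exact: (Cn_derive (delta_mx 0 i) (Cg k.+1)).
Qed.

Let Cchr k : Cn k Om (fun z => christoffel_row (l z) (r z)).
Proof.
have H : Cn k Om (fun z => r z *m 'D_(r z) g (l z) +
    (- 2^-1 : R) *: \row_j pairing ('D_(delta_mx 0 j) g (l z)) (r z) (r z)).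
  apply: CnD => //; first by apply: Cn_mulmx => //.
  apply: CnZ => //; apply/Cn_mxP => // i j.
  apply: (@eq_Cn _ _ _ _ _ (fun z => dot (r z *m 'D_(delta_mx 0 j) g (l z)) (r z))) => //.
    by move=> z _; rewrite mxE.
  have Cd : Cn k Om (fun z => 'D_(delta_mx 0 j) g (l z)).
    by apply: (Cpre (f := 'D_(delta_mx 0 j) g)); exact: (Cn_derive (delta_mx 0 j) (Cg k.+1)).
  exact: (Cn_dot oOm (Cn_mulmx oOm (Cr k) Cd) (Cr k)).
by apply: (eq_Cn oOm) H => z _; rewrite scaleNr.
Qed.

Let Ctspray k : Cn k Om (fun z => tspray (l z) (r z)).
Proof.
apply: Cn_mulmx => //; last first.
  apply: Cn_invmx => //; first by move=> z [].
  exact: Cpre (gram_Cn k).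
apply: Cn_mulmx => //; last exact: Cpre (Ctproj k).
have H : Cn k Om (fun z => (eps * dot (r z) (r z)) *: (l z *m g (l z)) +
    (-1 : R) *: christoffel_row (l z) (r z)).
  apply: CnD => //; last exact: CnZ.
  apply: CnZmx => //; first by apply: CnM => //; [exact: Cn_cst|exact: Cn_dot].
  by apply: Cn_mulmx => //; exact: Cpre (Cg k).
by apply: (eq_Cn oOm) H => z _; rewrite scaleN1r.
Qed.

Lemma spray_smooth : smooth Om spray.
Proof.
move=> k.
have H : Cn k Om (fun z => tspray (l z) (r z) + (-1 : R) *:
  ((eps * (dot (l z) (tspray (l z) (r z)) + dot (r z) (r z)) * (norm2 (l z))^-1) *: l z)).
  apply: CnD => //; apply: CnZ => //; apply: CnZmx => //; apply: CnM => //.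
    apply: CnM => //; first exact: Cn_cst.
    by apply: CnD => //; exact: Cn_dot.
  apply: Cn_inv => //; first by move=> z [].
  apply: sub_Cn (@subsetT _ _) _.
  by apply: (Cn_precomp (U := setT) (f := norm2 : _ -> R^o)) => //; exact: lsubmx_continuous.
by apply: (eq_Cn oOm) H => z _; rewrite scaleN1r.
Qed.

(** Geodesic accelerations are quadratic in the velocity. At zero velocity both [spray] and its
    derivative therefore vanish, which is the smallness behind [local_flow]. *)
Lemma spray_homog x u (h : R) : spray (row_mx x (h *: u)) = (h * h) *: spray (row_mx x u).
Proof.
have Ec : christoffel_row x (h *: u) = (h * h) *: christoffel_row x u.
  rewrite /christoffel_row (derive_mxZ oT (Cg 1))// -scalemxAr -scalemxAl scalerA scalerBr.
  congr (_ - _); rewrite [RHS]scalerA [_ * 2^-1]mulrC -scalerA; congr (_ *: _).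
  by apply/rowP => j; rewrite !mxE pairingZl pairingZr mulrA.
have Et : tspray x (h *: u) = (h * h) *: tspray x u.
  rewrite /tspray /spray_rhs Ec dotZl dotZr.
  have -> : (eps * (h * (h * dot u u))) *: (x *m g x) - (h * h) *: christoffel_row x u =
     (h * h) *: ((eps * dot u u) *: (x *m g x) - christoffel_row x u).
    by rewrite [RHS]scalerBr [in RHS]scalerA; congr (_ + _); congr (_ *: _); ring.
  by rewrite -!scalemxAl.
rewrite /spray !row_mxKl !row_mxKr Et dotZr dotZl dotZr scalerBr [in RHS]scalerA.
by congr (_ - _ *: _); ring.
Qed.

Lemma spray_norm z : Om z -> eps * (dot (l z) (spray z) + dot (r z) (r z)) = 0.
Proof.
move=> [_]; rewrite /spray dotDr dotNr dotZr /norm2 /eps; case: b; last by rewrite !mul0r.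
by rewrite -[true%:R]/(1 : R) subrr add0r !mul1r => q0; field.
Qed.

Lemma spray_geodesic x u v : M x -> eps * dot x v = 0 ->
  pairing (g x) (spray (row_mx x u)) v + christoffel g x u v = 0.
Proof.
move=> Mx xv; have [Gx _] := spray_domainP Mx.
have wG : tspray x u *m gram x = spray_rhs x u *m tproj x.
  by rewrite /tspray mulmxKV// unitmxE unitfE.
have xP : eps *: (x *m tproj x) = 0.
  by rewrite tprojE scalerBr scalerA mulrA eps2 (MN Mx) subrr.
(* Whatever ends with [tproj] is orthogonal to [x], so pairing [wG] with [x] leaves the Euclidean
   term of [gram] alone; hence [tspray] is tangent. *)
have wx : eps * dot x (tspray x u) = 0.
  have := congr1 (fun w => eps * dot w x) wG; rewrite gramE dotDl dotZl.
  have E w : eps * dot (w *m tproj x) x = 0.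
    rewrite dotC; exact: tproj_tangent.
  rewrite mulrDr !E add0r.
  by rewrite -mulrA mulrA eps2 mulrCA (MN Mx) mulrC dotC.
have Pv : v *m tproj x = v by rewrite tprojE dotC xv scale0r subr0.
have Pw : tspray x u *m tproj x = tspray x u by rewrite tprojE dotC wx scale0r subr0.
have E1 : pairing (g x) (tspray x u) v = dot (spray_rhs x u) v.
  have <- : dot (tspray x u *m gram x) v = pairing (g x) (tspray x u) v.
    rewrite gramE Pw dotDl dotZl -mulrA [dot _ x * _]mulrC mulrA xv mul0r addr0.
    by rewrite -[in RHS]Pv /pairing /dot trmx_mul tproj_tr !mulmxA.
  by rewrite wG /dot -[in RHS]Pv trmx_mul tproj_tr !mulmxA.
have q1 : norm2 x = 1 by rewrite /norm2 (MN Mx) subrK.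
rewrite /spray row_mxKl row_mxKr q1 invr1 mulr1 mulrDr wx add0r.
rewrite pairingDl -scaleNr pairingZl E1 /spray_rhs dotDl dotZl dot_mulmx christoffel_rowE.
by rewrite dotC dotNr dotC; ring.
Qed.

End Spray.

Section Box.
Variables (R : realType) (m : nat).
Implicit Types c x y : 'rV[R]_m.

(** Nonexpansive retraction onto a closed ball of the sup norm; it extends a field that is Lipschitz
    on a box to a globally Lipschitz one, as [picard] requires. *)
Definition box_clamp c (d : R) x : 'rV[R]_m :=
  \row_i clamp (c 0 i - d) (c 0 i + d) (x 0 i).

Lemma box_clamp_le c d x : 0 <= d -> `|box_clamp c d x - c| <= d.
Proof.
move=> d0; apply: mx_norm_le => // i j; rewrite !mxE (ord1 i).
have cd : c 0 j - d <= c 0 j + d by lra.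
by have /andP[h1 h2] := clamp_itv (x 0 j) cd; rewrite ler_norml; apply/andP; split; lra.
Qed.

Lemma box_clamp_id c d x : `|x - c| <= d -> box_clamp c d x = x.
Proof.
move=> xc; apply/rowP => i; rewrite mxE clamp_id//.
have := le_trans (ler_mx_entry (x - c) 0 i) xc; rewrite !mxE ler_norml => /andP[h1 h2].
by apply/andP; split; lra.
Qed.

Lemma box_clamp_lip c d x y : `|box_clamp c d x - box_clamp c d y| <= `|x - y|.
Proof.
apply: mx_norm_le => // i j; rewrite !mxE (le_trans (clamp_lip _ _ _ _))//.
by have := ler_mx_entry (x - y) 0 j; rewrite !mxE.
Qed.

Lemma compact_box c (d : R) : compact [set x | `|x - c| <= d].
Proof.
apply: bounded_closed_compact.
  exists (`|c| + d); split; first by rewrite num_real.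
  move=> M HM x /= xc; rewrite (le_trans _ (ltW HM))//.
  by rewrite -[x](subrK c) addrC (le_trans (ler_normD _ _))// lerD2l.
have -> : [set x | `|x - c| <= d] = (fun z => `|z - c| : R) @^-1` [set y | y <= d] by [].
apply: closed_comp; last exact: closed_le.
move=> z _; apply: (@continuous_comp _ _ _ (fun z : 'rV[R]_m => z - c) (fun M : 'rV[R]_m => `|M| : R)).
  exact: (cvgB (@cvg_id _ (nbhs z)) (cvg_cst c)).
exact: norm_continuous.
Qed.

Lemma segment_closed_box c (d : R) : segment_closed [set x | `|x - c| <= d].
Proof.
move=> a b s /= ha hb /andP[s0 s1].
have -> : a + s *: (b - a) - c = (1 - s) *: (a - c) + s *: (b - c).
  have -> : b - a = (b - c) - (a - c) by rewrite opprB addrA subrK.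
  by rewrite addrAC scalerBr scalerBl scale1r addrA addrAC.
rewrite (le_trans (ler_normD _ _))// !normrZ (ger0_norm s0) ger0_norm ?subr_ge0//.
have -> : d = (1 - s) * d + s * d by rewrite -mulrDl subrK mul1r.
by rewrite lerD// ler_wpM2l// subr_ge0.
Qed.

End Box.

Lemma derive_norm_le_sym (R : realType) (p q : nat) (y y' : R -> 'M[R]_(p, q)) (K t : R) :
  (forall s : R, `|s| <= `|t| -> is_derive s 1 y (y' s)) ->
  (forall s : R, `|s| <= `|t| -> `|y' s| <= K) ->
  `|y t - y 0| <= K * `|t|.
Proof.
move=> dy yK; have [t0|t0] := leP 0 t.
  have Hs (s : R) : 0 <= s <= t -> `|s| <= `|t|.
    by move=> /andP[s0 st]; rewrite !ger0_norm.
  have := derive_norm_le t0 (fun s h => dy s (Hs s h)) (fun s h => yK s (Hs s h)).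
  by rewrite subr0 (ger0_norm t0).
have Hs (s : R) : t <= s <= 0 -> `|s| <= `|t|.
  by move=> /andP[s0 st]; rewrite !ler0_norm ?lerN2// ltW.
have := derive_norm_le (ltW t0) (fun s h => dy s (Hs s h)) (fun s h => yK s (Hs s h)).
by rewrite sub0r (ltr0_norm t0) distrC.
Qed.

(** * The geodesic flow near zero velocity *)

Section LocalFlow.
Variables (R : realType) (n : nat) (Om : set 'rV[R]_n) (A : 'rV[R]_(n + n) -> 'rV[R]_n).
Local Notation l := (@lsubmx R 1 n n).
Local Notation r := (@rsubmx R 1 n n).
Local Notation U := [set z : 'rV[R]_(n + n) | Om (l z)].
Hypotheses (oOm : open Om) (sA : smooth U A)
  (hA : forall x u (h : R), A (row_mx x (h *: u)) = (h * h) *: A (row_mx x u)).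

Definition geo_field (z : 'rV[R]_(n + n)) : 'rV[R]_(n + n) := row_mx (r z) (A z).

Let oU : open U.
Proof. exact: open_lsubmx. Qed.

Lemma geo_field_smooth : smooth U geo_field.
Proof.
move=> k; apply: Cn_row_mx => //.
by apply: Cn_linear => //; exact: rsubmx_continuous.
Qed.

Lemma quadratic0 x : A (row_mx x 0) = 0.
Proof. by have := hA x 0 0; rewrite scaler0 mul0r scale0r. Qed.

(** By homogeneity the difference quotient at zero velocity is [h] times a value of [A] with
    velocity [r w], and this value converges as [h] tends to [0]. *)
Lemma derive_quadratic0 x w : Om x -> 'D_w A (row_mx x 0) = 0.
Proof.
move=> Ox; apply: cvg_lim => //.
have E : (fun h : R => h^-1 *: ((A \o shift (row_mx x 0)) (h *: w) - A (row_mx x 0))) =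
    (fun h : R => h *: A (h *: row_mx (l w) 0 + row_mx x (r w))).
  apply/funext => h /=; rewrite quadratic0 subr0.
  have -> : h *: w + row_mx x 0 = row_mx (h *: l w + x) (h *: r w).
    by rewrite -[in LHS](hsubmxK w) scale_row_mx add_row_mx addr0.
  have -> : h *: row_mx (l w) 0 + row_mx x (r w) = row_mx (h *: l w + x) (r w).
    by rewrite scale_row_mx add_row_mx scaler0 add0r.
  rewrite hA scalerA; have [->|h0] := eqVneq h 0; first by rewrite !mulr0 !scale0r.
  by rewrite mulrA mulVf// mul1r.
rewrite E.
have c1 : (fun h : R => A (h *: row_mx (l w) 0 + row_mx x (r w))) @ 0 --> A (row_mx x (r w)).
  have cz : (fun h : R => h *: row_mx (l w) 0 + row_mx x (r w)) @ 0 --> row_mx x (r w).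
    have : (fun h : R => h *: row_mx (l w) 0 + row_mx x (r w)) @ 0 -->
      (0 : R) *: row_mx (l w) 0 + row_mx x (r w).
      by apply: cvgD; [apply: cvgZr_tmp; exact: cvg_id|exact: cvg_cst].
    by rewrite scale0r add0r.
  apply: (cvg_comp _ A cz).
  by apply: (Cn_cont (sA 0%N)); rewrite /= row_mxKl.
have c2 : (fun h : R => h *: A (h *: row_mx (l w) 0 + row_mx x (r w))) @ 0 --> (0 : R) *: A (row_mx x (r w)).
  by apply: cvgZ c1; exact: cvg_id.
by move: c2; rewrite scale0r => c2 P /c2 HP; exact: nbhs_dnbhs HP.
Qed.

(** By [derive_quadratic0] the acceleration has an arbitrarily small Lipschitz constant near zero
    velocity at [p0]. Trajectories are thus close to uniform motion, and the position at time [1] is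
    close, as a Lipschitz map, to position plus velocity. The flow is built up to time [2] so that
    time [1] is interior. *)
Lemma local_flow p0 (eta rmax : R) : Om p0 -> 0 < eta -> 0 < rmax ->
  exists2 rho : R, 0 < rho <= rmax & exists Y : 'rV[R]_(n + n) -> R -> 'rV[R]_(n + n),
    let B := [set z | `|l z - p0| < rho /\ `|r z| < rho / 2] in
    [/\ flow_on U geo_field B 2 Y,
      forall z, B z -> `|l (Y z 1) - l z| <= rho &
      forall z z', B z -> B z' ->
        `|l (Y z 1) - l (Y z' 1) - (l z - l z') - (r z - r z')| <= eta * `|z - z'|].
Proof.
move=> Op eta0 rmax0.
pose C0 : R := 2 * expR (2 * 1 * 2).
have C00 : 0 < C0 by rewrite mulr_gt0// expR_gt0.
(* The value [1 / 12] gives [|A| <= rho / 4] on [Q], whose points are within [3 * rho] of [z0];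
   [eta / C0] is the aimed-for constant divided by the Gronwall factor. *)
pose e0 := Num.min (1 / 12) (eta / C0).
have e00 : 0 < e0 by rewrite lt_min !divr_gt0.
have e012 : e0 <= 1 / 12 by rewrite ge_min lexx.
have e0eta : e0 * C0 <= eta by rewrite -ler_pdivlMr// ge_min lexx orbT.
pose z0 : 'rV[R]_(n + n) := row_mx p0 0.
have Uz0 : U z0 by rewrite /= row_mxKl.
have [d d0 Hd] := strict_derive_mx oU (sA 1%N) Uz0 e00.
pose rho := Num.min (d / 4) rmax.
have rho0 : 0 < rho by rewrite lt_min rmax0 andbT divr_gt0.
have rhod : rho <= d / 4 by rewrite ge_min lexx.
(* Up to time [2], positions leave a ball of radius [rho] by at most [2 * rho], and velocities leave
   a ball of radius [rho / 2] by at most [rho / 2]. *)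
pose Q := [set z | [set x | `|x - p0| <= 3 * rho] (l z) /\ `|r z| <= rho].
have Qd z : Q z -> `|z - z0| <= 3 * rho.
  move=> [zl zr]; rewrite -[z]hsubmxK /z0 opp_row_mx add_row_mx subr0.
  by apply: row_mx_norm_le => //; rewrite (le_trans zr)//; lra.
have Qd' z : Q z -> `|z - z0| < d.
  by move=> /Qd h; apply: (le_lt_trans h); move: rhod d0; lra.
have lipA z z' : Q z -> Q z' -> `|A z' - A z| <= e0 * `|z' - z|.
  move=> Qz Qz'; have [_] := Hd z z' (Qd' _ Qz) (Qd' _ Qz').
  by rewrite derive_quadratic0// subr0.
have QU : Q `<=` U by move=> z Qz; have [] := Hd z z (Qd' _ Qz) (Qd' _ Qz).
have Qz0 : Q z0.
  by split; rewrite /= ?row_mxKl ?row_mxKr ?subrr normr0 ?mulr_ge0// ltW.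
have bA z : Q z -> `|A z| <= rho / 4.
  move=> Qz; have := lipA _ _ Qz0 Qz; rewrite {1}/z0 quadratic0 subr0 => h.
  apply: (le_trans h); apply: (@le_trans _ _ (1 / 12 * (3 * rho))); last by lra.
  by apply: ler_pM => //; [exact: ltW|exact: Qd].
have lipF z z' : Q z -> Q z' -> `|geo_field z' - geo_field z| <= 1 * `|z' - z|.
  move=> Qz Qz'; rewrite /geo_field opp_row_mx add_row_mx mul1r; apply: row_mx_norm_le.
    by rewrite -linearB; exact: rsubmx_norm_le.
  rewrite (le_trans (lipA _ _ Qz Qz'))//; apply: ler_piMl => //.
  by apply: (le_trans e012); lra.
(* Composition with this retraction onto [Q] makes the field globally Lipschitz; trajectories that
   stay in [Q] solve the original system. *)
pose kap z := row_mx (box_clamp p0 (3 * rho) (l z)) (box_clamp 0 rho (r z)).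
have Qk z : Q (kap z).
  split; rewrite /kap /= ?row_mxKl ?row_mxKr; first by apply: box_clamp_le; rewrite mulr_ge0// ltW.
  by have := box_clamp_le 0 (r z) (ltW rho0); rewrite subr0.
have kid z : Q z -> kap z = z.
  move=> [zl zr]; rewrite /kap !box_clamp_id//; first exact: hsubmxK.
  by rewrite subr0.
have klip z z' : `|kap z - kap z'| <= `|z - z'|.
  rewrite /kap opp_row_mx add_row_mx; apply: row_mx_norm_le.
    by rewrite (le_trans (box_clamp_lip _ _ _ _))// -linearB lsubmx_norm_le.
  by rewrite (le_trans (box_clamp_lip _ _ _ _))// -linearB rsubmx_norm_le.
pose G (t : R) z := geo_field (kap z).
have Glip (t : R) z z' : `|G t z - G t z'| <= 1 * `|z - z'|.
  by rewrite (le_trans (lipF _ _ (Qk z') (Qk z)))// !mul1r klip.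
have Gb z (t : R) : `|G t z| <= rho.
  rewrite /G /geo_field; have [_ kr] := Qk z; apply: row_mx_norm_le => //.
  by rewrite (le_trans (bA _ (Qk z)))//; lra.
have Gc (y : R -> 'rV[R]_(n + n)) : continuous y -> continuous (fun t => G t (y t)).
  move=> cy t; apply/cvgrPdist_le => e ep.
  have /cvgrPdist_le/(_ e ep) H := cy t.
  apply: filterS H => s; apply: le_trans.
  by rewrite -[leRHS]mul1r; exact: (Glip t).
have /choice[Y HY] : forall z, exists y : R -> 'rV[R]_(n + n), y 0 = z /\
    forall t : R, is_derive t 1 y (G t (y t)).
  by move=> z; exact: (picard ltr01 Gc Glip (Gb z)).
pose B := [set z | `|l z - p0| < rho /\ `|r z| < rho / 2].
have stay z (t : R) : B z -> `|t| <= 2 -> Q (Y z t).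
  move=> [zl zr] t2; have [Y0 dY] := HY z.
  have dl (s : R) := is_derive_lsubmx (dY s).
  have dr (s : R) := is_derive_rsubmx (dY s).
  have bl (s : R) : `|s| <= `|t| -> `|l (G s (Y z s))| <= rho.
    by move=> _; rewrite (le_trans (lsubmx_norm_le _))// Gb.
  have br (s : R) : `|s| <= `|t| -> `|r (G s (Y z s))| <= rho / 4.
    by move=> _; rewrite /G /geo_field row_mxKr; exact: bA (Qk _).
  have := derive_norm_le_sym (fun s _ => dl s) bl; have := derive_norm_le_sym (fun s _ => dr s) br.
  rewrite Y0 => hr hl; split=> /=.
    rewrite -[l (Y z t)](subrK (l z)) -addrA (le_trans (ler_normD _ _))//.
    have : rho * `|t| <= rho * 2 by rewrite ler_pM2l.
    by move: hl zl; lra.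
  rewrite -[r (Y z t)](subrK (r z)) (le_trans (ler_normD _ _))//.
  have : rho / 4 * `|t| <= rho / 4 * 2 by rewrite ler_pM2l// divr_gt0.
  by move: hr zr; lra.
have oB : open B.
  apply: openI.
    apply: (@open_comp _ _ (fun z => `|l z - p0| : R) [set y | y < rho]); last exact: open_lt.
    move=> z _; apply: (@continuous_comp _ _ _ (fun z => l z - p0) (fun M : 'rV[R]_n => `|M| : R)).
      exact: (cvgB (@lsubmx_continuous R n n z) (cvg_cst p0)).
    exact: norm_continuous.
  apply: (@open_comp _ _ (fun z => `|r z| : R) [set y | y < rho / 2]); last exact: open_lt.
  move=> z _; apply: (@continuous_comp _ _ _ r (fun M : 'rV[R]_n => `|M| : R)).
    exact: rsubmx_continuous.
  exact: norm_continuous.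
have dY z (t : R) : B z -> `|t| <= 2 -> is_derive t 1 (Y z) (geo_field (Y z t)).
  by move=> Bz t2; have [_ /(_ t)] := HY z; rewrite /G kid//; exact: stay.
exists rho; first by rewrite rho0 ge_min lexx orbT.
exists Y => B'; split.
  split; first by move=> z _; have [] := HY z.
    exact: dY.
  move=> z Bz; exists Q; split => //.
  - by apply: compact_tangent; exact: compact_box.
  - by apply: segment_closed_tangent; exact: segment_closed_box.
  - apply: filterS (open_near oB Bz) => z' Bz'; split=> // t t2.
    exact: stay.
  move=> z Bz; have [Y0 dY0] := HY z.
  have := derive_norm_le_sym (t := 1) (K := rho) (fun s _ => is_derive_lsubmx (dY0 s)).
  rewrite normr1 mulr1 Y0; apply=> s _.
  by rewrite (le_trans (lsubmx_norm_le _))// Gb.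
move=> z z' Bz Bz'.
have [Y0 _] := HY z; have [Y'0 _] := HY z'.
have hY (t : R) : `|t| <= 1 -> `|Y z t - Y z' t| <= C0 * `|z - z'|.
  move=> t1; have t2 (s : R) : `|s| <= 1 -> `|s| <= 2 by move=> h; lra.
  have h2 (s : R) : `|s| <= 1 -> is_derive s 1 (fun s => Y z s - Y z' s) (geo_field (Y z s) - geo_field (Y z' s)).
    by move=> s1; exact: (is_deriveB (dY z s Bz (t2 s s1)) (dY z' s Bz' (t2 s s1))).
  have h3 (s : R) : `|s| <= 1 -> `|geo_field (Y z s) - geo_field (Y z' s)| <= 1 * `|Y z s - Y z' s| + 0.
    by move=> s1; rewrite addr0; apply: lipF; apply: stay => //; exact: t2.
  have := gronwall ltr01 (lexx 0) h2 h3 t1; rewrite mul0r addr0 Y0 Y'0 => h.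
  rewrite (le_trans h)// /C0 mulrAC ler_wpM2r// ler_pM2l// ler_expR !mulr1 ler_pM2l//.
  exact: t2.
pose K := e0 * (C0 * `|z - z'|).
(* The difference of velocities departs from its initial value by [q1], which is controlled by the
   Lipschitz bound of [A]; integrating once more, [q2] measures how the difference of positions
   departs from uniform motion. *)
pose q1 t := r (Y z t) - r (Y z' t) - (r z - r z').
have hq1 (t : R) : `|t| <= 1 -> `|q1 t| <= K.
  move=> t1.
  have d1 (s : R) : `|s| <= `|t| -> is_derive s 1 q1 (A (Y z s) - A (Y z' s)).
    move=> st; have s2 : `|s| <= 2 by move: (le_trans st t1); lra.
    have e1 := is_derive_rsubmx (dY z s Bz s2); have e2 := is_derive_rsubmx (dY z' s Bz' s2).
    have := is_deriveB (is_deriveB e1 e2) (is_derive_cst (r z - r z') s 1).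
    by rewrite /geo_field !row_mxKr subr0.
  have b1 (s : R) : `|s| <= `|t| -> `|A (Y z s) - A (Y z' s)| <= K.
    move=> st; have s1 := le_trans st t1; have s2 : `|s| <= 2 by move: s1; lra.
    rewrite (le_trans (lipA _ _ (stay _ _ Bz' s2) (stay _ _ Bz s2)))// /K.
    by apply: ler_wpM2l; [exact: ltW|exact: hY].
  have := derive_norm_le_sym d1 b1.
  have -> : q1 0 = 0 by rewrite /q1 Y0 Y'0 subrr.
  rewrite subr0 => h; apply: (le_trans h); rewrite -[leRHS]mulr1 ler_wpM2l//.
  by apply: mulr_ge0; [exact: ltW|apply: mulr_ge0; [exact: ltW|exact: normr_ge0]].
pose q2 (t : R) := l (Y z t) - l (Y z' t) - (l z - l z') - t *: (r z - r z').
have d2 (s : R) : `|s| <= `|1 : R| -> is_derive s 1 q2 (q1 s).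
  rewrite normr1 => s1; have s2 : `|s| <= 2 by move: s1; lra.
  have e1 := is_derive_lsubmx (dY z s Bz s2); have e2 := is_derive_lsubmx (dY z' s Bz' s2).
  have e3 : is_derive s 1 (fun t : R => t *: (r z - r z')) (r z - r z').
    apply: is_derive_mxP => i j.
    have -> : (fun t : R => (t *: (r z - r z')) i j) = (fun t : R => t * (r z - r z') i j).
      by apply/funext => t; rewrite mxE.
    have := is_deriveM (is_derive_id s 1) (is_derive_cst ((r z - r z') i j) s 1).
    by move=> h; apply: (is_derive_eq h); rewrite /GRing.scale /= /cst; ring.
  have := is_deriveB (is_deriveB (is_deriveB e1 e2) (is_derive_cst (l z - l z') s 1)) e3.
  by rewrite /geo_field !row_mxKl subr0.
have b2 (s : R) : `|s| <= `|1 : R| -> `|q1 s| <= K by rewrite normr1; exact: hq1.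
have := derive_norm_le_sym d2 b2.
have -> : q2 0 = 0 by rewrite /q2 Y0 Y'0 subrr scale0r subr0.
rewrite subr0 normr1 mulr1 /q2 scale1r => h; apply: (le_trans h).
by rewrite /K mulrA ler_wpM2r.
Qed.

End LocalFlow.

(** * Uniqueness of geodesics and the exponential map *)

Section OdeUnique.
Variables (R : realType) (m : nat).

(** A forward variant of [gronwall] with zero initial value, for curves whose equation is known on
    [[0, T]]: the maximum of the weighted norm is at most half of itself. *)
Lemma gronwall0_right (p q : nat) (y y' : R -> 'M[R]_(p, q)) (L T t : R) : 0 < L ->
  (forall s : R, 0 <= s <= T -> is_derive s 1 y (y' s)) ->
  (forall s : R, 0 <= s <= T -> `|y' s| <= L * `|y s|) ->
  y 0 = 0 -> 0 <= t <= T -> y t = 0.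
Proof.
move=> L0 dy yL y0 tT; have T0 : 0 <= T by case/andP: tT; exact: le_trans.
pose f (s : R) := `|y s| * expR (- (2 * L) * s).
have fc : {within `[0, T], continuous f}.
  apply: continuous_in_subspaceT => s; rewrite inE /= in_itv /= => sT.
  apply: (@continuousM _ _ (fun s => `|y s| : R) (fun s : R => expR (- (2 * L) * s))).
    apply: (@continuous_comp _ _ _ y (fun M => `|M| : R)); last exact: norm_continuous.
    by apply/differentiable_continuous/derivable1_diffP; have [] := dy s sT.
  apply: (@continuous_comp _ _ _ (fun s : R => - (2 * L) * s) expR); last exact: continuous_expR.
  by apply: (@continuousM _ _ (fun=> - (2 * L)) id); [exact: cst_continuous|exact: cvg_id].
have [c + cmax] := EVT_max T0 fc; rewrite in_itv /= => cT.
have yE (s : R) : `|y s| = f s * expR (2 * L * s).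
  by rewrite /f -[RHS]mulrA -expRD mulNr addNr expR0 mulr1.
have f0 (s : R) : 0 <= f s by rewrite mulr_ge0// expR_ge0.
have yf (s : R) : 0 <= s <= T -> `|y s| <= f c * expR (2 * L * s).
  by move=> sT; rewrite yE ler_wpM2r ?expR_ge0// cmax// in_itv.
have [c0 cT'] := andP cT.
have Hs (s : R) : 0 <= s <= c -> 0 <= s <= T.
  by move=> /andP[-> sc]; exact: le_trans cT'.
have := @derive_comparison _ _ _ y y' (fun s => f c / 2 * expR (2 * L * s))
  (fun s => f c / 2 * (2 * L) * expR (2 * L * s)) 0 c c0
  (fun s h => dy s (Hs s h)) (fun s _ => is_derive_expRM (2 * L) (f c / 2) s).
rewrite y0 subr0 mulr0 expR0 yE => H.
have fc0 : f c = 0.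
  apply/eqP; rewrite eq_le f0 andbT.
  have {}H : f c * expR (2 * L * c) <= f c / 2 * expR (2 * L * c) - f c / 2 * 1.
    apply: H => s sc; rewrite (le_trans (yL s (Hs s sc)))//.
    have -> : f c / 2 * (2 * L) = L * f c by field.
    by rewrite -[leRHS]mulrA ler_pM2l// yf// Hs.
  have : 0 <= f c * expR (2 * L * c) by rewrite mulr_ge0// expR_ge0.
  by move: H; set a := f c; set e := expR _; have := f0 c; rewrite -/a; lra.
by apply/eqP; rewrite -normr_le0; have := yf t tT; rewrite fc0 mul0r.
Qed.

(** No convex compact set containing both curves is available, so the Lipschitz bound is obtained
    along the pair of curves by compactness of time. Where the curves meet it comes from strict
    differentiability of [F]; where they are apart, the quotient is locally bounded by
    continuity. *)
Lemma ode_unique (U : set 'rV[R]_m) (F : 'rV[R]_m -> 'rV[R]_m) (y1 y2 : R -> 'rV[R]_m) :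
  open U -> Cn 1 U F ->
  (forall s : R, 0 <= s <= 1 -> U (y1 s) /\ is_derive s 1 y1 (F (y1 s))) ->
  (forall s : R, 0 <= s <= 1 -> U (y2 s) /\ is_derive s 1 y2 (F (y2 s))) ->
  y1 0 = y2 0 -> forall t : R, 0 <= t <= 1 -> y1 t = y2 t.
Proof.
move=> oU CF H1 H2 y12 t t01.
have cy y (s : R) w : is_derive s 1 y w -> (y : R -> 'rV[R]_m) @ s --> y s.
  by move=> [d _]; apply/differentiable_continuous/derivable1_diffP; exact d.
pose P L (s : R) := `|F (y1 s) - F (y2 s)| <= L * `|y1 s - y2 s|.
have NC : near_covering [set s : R | 0 <= s <= 1].
  apply/compact_near_coveringP.
  rewrite (_ : mkset _ = `[0, 1]%classic); first exact: segment_compact.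
  by apply/seteqP; split => s /=; rewrite in_itv.
have H : \forall L \near +oo, [set s : R | 0 <= s <= 1] `<=` P L.
  apply: NC => s /= s01; have [U1 d1] := H1 s s01; have [U2 d2] := H2 s s01.
  have c1 := cy _ _ _ d1; have c2 := cy _ _ _ d2.
  have [E|NE] := eqVneq (y1 s) (y2 s).
    have [d d0 Hd] := strict_derive_mx oU CF U1 ltr01.
    pose C : R := m%:R * \sum_i `|'D_(delta_mx 0 i) F (y1 s)|.
    have HC u : `|'D_u F (y1 s)| <= C * `|u|.
      have := @derive_mx_norm_le R m 1 m U F oU CF (y1 s) u (\sum_i `|'D_(delta_mx 0 i) F (y1 s)|) U1; apply=> i.
      by rewrite (bigD1 i)//= lerDl sumr_ge0.
    have /cvgrPdist_lt/(_ _ d0) n1 := c1; have /cvgrPdist_lt/(_ _ d0) n2 := c2.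
    near=> s' L.
    have hL : 1 + C <= L by near: L; apply: nbhs_pinfty_ge; rewrite num_real.
    have h1 : `|y1 s' - y1 s| < d by rewrite distrC; near: s'; exact: n1.
    have h2 : `|y2 s' - y1 s| < d by rewrite E distrC; near: s'; exact: n2.
    have [_ Hab] := Hd (y2 s') (y1 s') h2 h1.
    rewrite /P -(subrK ('D_(y1 s' - y2 s') F (y1 s)) (F (y1 s') - F (y2 s'))).
    apply: (le_trans (ler_normD _ _)).
    have := HC (y1 s' - y2 s') => h3.
    apply: (@le_trans _ _ ((1 + C) * `|y1 s' - y2 s'|)); first by rewrite mulrDl lerD.
    exact: ler_wpM2r hL.
  pose d := `|y1 s - y2 s| / 2.
  have d0 : 0 < d by rewrite divr_gt0// normr_gt0 subr_eq0.
  have cF1 : F (y1 s') @[s' --> s] --> F (y1 s).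
    by apply: (cvg_comp _ F c1); exact: (Cn_cont CF).
  have cF2 : F (y2 s') @[s' --> s] --> F (y2 s).
    by apply: (cvg_comp _ F c2); exact: (Cn_cont CF).
  have cd : `|y1 s' - y2 s'| @[s' --> s] --> `|y1 s - y2 s| by exact: cvg_norm (cvgB c1 c2).
  have cFd : `|F (y1 s') - F (y2 s')| @[s' --> s] --> `|F (y1 s) - F (y2 s)|.
    by exact: cvg_norm (cvgB cF1 cF2).
  have n1 : \forall s' \near s, d < `|y1 s' - y2 s'|.
    by apply: (cvgr_gt (`|y1 s - y2 s|) cd); rewrite /d ltr_pdivrMr// ltr_pMr ?normr_gt0 ?subr_eq0// ltr1n.
  have n2 : \forall s' \near s, `|F (y1 s') - F (y2 s')| < `|F (y1 s) - F (y2 s)| + 1.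
    by apply: (cvgr_lt (`|F (y1 s) - F (y2 s)|) cFd); rewrite ltrDl.
  near=> s' L.
  have h1 : d < `|y1 s' - y2 s'| by near: s'; exact: n1.
  have h2 : `|F (y1 s') - F (y2 s')| < `|F (y1 s) - F (y2 s)| + 1 by near: s'; exact: n2.
  have hL : (`|F (y1 s) - F (y2 s)| + 1) / d <= L by near: L; apply: nbhs_pinfty_ge; rewrite num_real.
  rewrite /P (le_trans (ltW h2))// (@le_trans _ _ (L * d))//; first by rewrite -ler_pdivrMr.
  apply: ler_wpM2l; last exact: ltW.
  by apply: le_trans hL; rewrite divr_ge0// ltW// ltr_wpDl.
near +oo_R => L.
have HL : [set s : R | 0 <= s <= 1] `<=` P L by near: L; exact: H.
have L0 : 0 < L by near: L; apply: nbhs_pinfty_gt; rewrite num_real.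
apply/eqP; rewrite -subr_eq0; apply/eqP.
apply: (@gronwall0_right _ _ (fun s => y1 s - y2 s) (fun s => F (y1 s) - F (y2 s)) L 1) => //.
- by move=> s s01; have [_ d1] := H1 s s01; have [_ d2] := H2 s s01; exact: is_deriveB d1 d2.
- by rewrite y12 subrr.
Unshelve. all: by end_near. Qed.

End OdeUnique.

Section CurveTangent.
Variables (R : realType) (n : nat) (M : set 'rV[R]_n).

Lemma curve_tangent (J : set R) (c : R -> 'rV[R]_n) (t : R) : open J ->
  smooth (J : set R^o) (c : R^o -> 'rV[R]_n) -> (forall s, J s -> M (c s)) -> J t ->
  tangent M (c t) (c^`()%classic t).
Proof.
move=> oJ sc Mc Jt; have /nbhs_ballP[e /= e0 He] := open_near oJ Jt.
have HJ (s : R) : - e < s < e -> J (s + t).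
  rewrite -ltr_norml => se; apply: He; rewrite -ball_normE /= opprD addrCA subrr addr0.
  by rewrite normrN.
have dc : is_derive (0 : R) 1 (fun s => c (s + t)) (c^`()%classic t).
  have d1 := curve_derive (sc 1%N) Jt.
  have := @is_derive_affine R R R _ c (@idfun R) t 0 1; rewrite /= add0r.
  case: d1 => [d1 d2] /(_ d1); by rewrite -derive1E.
exists (fun s => c (s + t)); last by rewrite derive1E; exact: derive_val.
split; first by rewrite add0r.
exists e => //; split; last by move=> s /HJ/Mc.
move=> k; have := @Cn_affine R R^o R^o _ k J c (@idfun R^o) t.
move=> H; apply: sub_Cn (H _ oJ (sc k)); last by move=> y; exact: cvg_id.
by move=> s /=; rewrite in_itv /= => /HJ.
Qed.

End CurveTangent.

Section GeodesicOde.
Variables (R : realType) (n : nat) (b : bool) (M : set 'rV[R]_n).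
Local Notation eps := (b%:R : R).
Hypothesis HM : forall x, M x <-> eps * (dot x x - 1) = 0.
Variable g : riemannian_metric M.
Local Notation l := (@lsubmx R 1 n n).
Local Notation r := (@rsubmx R 1 n n).
Local Notation A := (spray b g).
Local Notation U := [set z : 'rV[R]_(n + n) | spray_domain b g (l z)].

Let oU : open U.
Proof. by apply: open_lsubmx; exact: spray_domain_open. Qed.

Let CF : smooth U (geo_field A).
Proof. by apply: geo_field_smooth; [exact: spray_domain_open|exact: spray_smooth]. Qed.

(** Differentiating the tangency of the velocity shows that the acceleration and the spray have the
    same normal part. Their difference [d] is then tangent, and the geodesic equation tested on [d]
    itself gives [g (d, d) = 0]. *)
Lemma geodesic_ode (J : set R) (c : R -> 'rV[R]_n) (t : R) : open J ->
  geodesic g J c -> J t ->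
  is_derive t 1 (fun s => row_mx (c s) (c^`()%classic s))
    (geo_field A (row_mx (c t) (c^`()%classic t))).
Proof.
move=> oJ [sc Mc gc] Jt.
have sc' : smooth (J : set R^o) (c^`()%classic : R^o -> 'rV[R]_n).
  by move=> k; exact: Cn_derive1 (sc k.+1).
have d1 (s : R) : J s -> is_derive s 1 c (c^`()%classic s) by exact: curve_derive (sc 1%N).
have d2 (s : R) : J s -> is_derive s 1 (c^`()%classic) ((c^`()%classic)^`()%classic s).
  by exact: curve_derive (sc' 1%N).
have tg (s : R) : J s -> eps * dot (c s) (c^`()%classic s) = 0.
  move=> Js; apply: (tangent_dot HM); first exact: Mc.
  exact: curve_tangent sc Mc Js.
set u := c^`()%classic t; set a := (c^`()%classic)^`()%classic t.
have xa : eps * (dot (c t) a + dot u u) = 0.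
  have e1 := is_deriveZ (eps) (is_derive_dot (d1 t Jt) (d2 t Jt)).
  have : is_derive t 1 (eps *: (fun s => dot (c s) (c^`()%classic s) : R)) 0.
    apply: near_eq_is_derive (is_derive_cst (0 : R) t 1).
    by apply: filterS (open_near oJ Jt) => s Js; rewrite /cst -(tg s Js).
  move=> e2; have := @derive_val _ _ _ _ _ _ _ e1; have -> := @derive_val _ _ _ _ _ _ _ e2.
  by move=> h; rewrite addrC; exact: esym h.
have Ox : spray_domain b g (c t) by apply: (spray_domainP HM); exact: Mc.
have xA := @spray_norm R n b M g (row_mx (c t) u); rewrite /= row_mxKl row_mxKr in xA.
have {}xA := xA Ox.
pose d := a - A (row_mx (c t) u).
have xd : eps * dot (c t) d = 0.
  by rewrite /d dotDr dotNr -(addrKA (dot u u)) [dot u u + _]addrC mulrBr xa xA subrr.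
have dt := dot_tangent HM (Mc t Jt) xd.
have g1 := gc t d Jt dt; rewrite /derive1n /= -/u -/a in g1.
have g2 := spray_geodesic HM g u (Mc t Jt) xd.
have d0 : d = 0.
  apply/eqP; apply: contraT => dN0; have := metric_pos g (Mc t Jt) dt dN0.
  have -> : pairing (g (c t)) d d = pairing (g (c t)) a d - pairing (g (c t)) (A (row_mx (c t) u)) d.
    by rewrite {1}/d pairingDl -scaleN1r pairingZl mulN1r.
  by rewrite -(addrKA (christoffel g (c t) u d)) [christoffel _ _ _ _ + _]addrC g1 g2 subrr ltxx.
have -> : geo_field A (row_mx (c t) u) = row_mx u a.
  by rewrite /geo_field row_mxKr; congr row_mx; apply/esym/eqP; rewrite -subr_eq0 -/d d0.
exact: is_derive_row_mx (d1 t Jt) (d2 t Jt).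
Qed.

(** By [spray_norm] the number [eps * dot] of position and velocity is conserved, hence so is
    [eps * dot] of the position with itself, which keeps the solution on [M]. Smoothness is
    bootstrapped from the equation. *)
Lemma ode_geodesic (a0 b0 : R) (y : R -> 'rV[R]_(n + n)) :
  let J := `]a0, b0[%classic : set R in a0 < 0 -> 0 < b0 ->
  (forall t : R, J t -> U (y t) /\ is_derive t 1 y (geo_field A (y t))) ->
  M (l (y 0)) -> eps * dot (l (y 0)) (r (y 0)) = 0 ->
  geodesic g J (fun t => l (y t)) /\ forall t : R, J t -> (fun t => l (y t))^`()%classic t = r (y t).
Proof.
move=> J a00 b00 Hy M0 t0.
have oJ : open J by exact: interval_open.
have J0 : J 0 by rewrite /J /= in_itv /= a00.
have dl (t : R) : J t -> is_derive t 1 (fun t => l (y t)) (r (y t)).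
  by move=> Jt; have [_ /is_derive_lsubmx] := Hy t Jt; rewrite /geo_field row_mxKl.
have dr (t : R) : J t -> is_derive t 1 (fun t => r (y t)) (A (y t)).
  by move=> Jt; have [_ /is_derive_rsubmx] := Hy t Jt; rewrite /geo_field row_mxKr.
have dlE (t : R) : J t -> (fun t => l (y t))^`()%classic t = r (y t).
  by move=> Jt; have [_ <-] := dl t Jt; rewrite derive1E.
have between (t s : R) : J t -> 0 <= s <= t -> J s.
  rewrite /J /= !in_itv /= => /andP[h1 h2] /andP[h3 h4].
  by rewrite (lt_le_trans a00 h3) (le_lt_trans h4).
have between' (t s : R) : J t -> t <= s <= 0 -> J s.
  rewrite /J /= !in_itv /= => /andP[h1 h2] /andP[h3 h4].
  by rewrite (lt_le_trans h1 h3) (le_lt_trans h4).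
have const (f : R -> R) : (forall t : R, J t -> is_derive t 1 f 0) -> forall t, J t -> f t = f 0.
  move=> df t Jt; have [h|h] := leP 0 t.
    by apply/esym/derive0_const => // s /(between _ _ Jt); exact: df.
  by apply: derive0_const (ltW h) _ => s /(between' _ _ Jt); exact: df.
have E1 (t : R) : J t -> eps * dot (l (y t)) (r (y t)) = 0.
  move=> Jt; rewrite -t0.
  apply: (const (fun t => eps * dot (l (y t)) (r (y t)))) => // s Js.
  have := is_deriveZ (eps) (is_derive_dot (dl s Js) (dr s Js)).
  have [Us _] := Hy s Js; have := spray_norm Us => h1 h2.
  by apply: (is_derive_eq h2); rewrite -h1 [LHS]/GRing.scale /= addrC.
have E2 (t : R) : J t -> eps * dot (l (y t)) (l (y t)) = eps * dot (l (y 0)) (l (y 0)).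
  move=> Jt; apply: (const (fun t => eps * dot (l (y t)) (l (y t)))) => // s Js.
  have h2 := is_deriveZ (eps) (is_derive_dot (dl s Js) (dl s Js)).
  apply: (is_derive_eq h2); rewrite [LHS]/GRing.scale /= (dotC (r _)) mulrDr.
  by rewrite E1// addr0.
have My (t : R) : J t -> M (l (y t)).
  by move=> Jt; apply/HM; rewrite mulrBr E2//; move/HM: M0; rewrite mulrBr.
have sy : smooth (J : set R^o) (y : R^o -> 'rV[R]_(n + n)).
  elim=> [|k IH].
    split; last exact I; move=> t Jt.
    by apply/differentiable_continuous/derivable1_diffP; have [_ [d _]] := Hy t Jt; exact d.
  apply: (@Cn_curveS _ _ _ _ _ (geo_field A \o y)) => //.
    by move=> t Jt; have [_] := Hy t Jt.
  apply: (@Cn_comp R R^o (n + n)%N 1 (n + n)%N k J U y (geo_field A)) => //.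
  by move=> t Jt; have [] := Hy t Jt.
split=> //; split=> //.
  move=> k; have Cl : Cn k [set: 'rV[R]_(n + n)] l.
    by apply: Cn_linear; [exact: lsubmx_continuous|exact: openT].
  by apply: (@Cn_comp R R^o (n + n)%N 1 n k J setT y l) => //; exact: openT.
move=> t v Jt tv; rewrite dlE// /derive1n /=.
have -> : ((fun t => l (y t))^`()%classic)^`()%classic t = A (y t).
  have [_ <-] := dr t Jt; rewrite derive1E; apply: near_eq_derive.
  by apply: filterS (open_near oJ Jt) => s; exact: dlE.
have := spray_geodesic HM g (r (y t)) (My t Jt) (tangent_dot HM (My t Jt) tv).
by rewrite hsubmxK.
Qed.

(** The position at time [1] of the local flow extends [Exp] to an open set. The solution lives on
    the interval of [exp_value] with [e = 1], and by uniqueness the value picked by [xget] is this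
    one, whichever geodesic witnesses it. *)
Lemma local_exp p0 (eta rmax : R) : M p0 -> 0 < eta -> 0 < rmax ->
  exists2 rho : R, 0 < rho & exists E : 'rV[R]_(n + n) -> 'rV[R]_n,
    let B := [set z | `|l z - p0| < rho /\ `|r z| < rho] in
    [/\ smooth B E, forall z, B z -> `|E z - l z| <= rmax,
      forall z z', B z -> B z' -> `|E z - E z' - (l z - l z') - (r z - r z')| <= eta * `|z - z'| &
      forall p v, B (row_mx p v) -> M p -> tangent M p v ->
        [/\ exp_domain g (p, v), Exp g (p, v) = E (row_mx p v) & M (E (row_mx p v))]].
Proof.
move=> Mp eta0 rmax0; have Op := spray_domainP HM g Mp.
have [rho /andP[rho0 rhom] [Y /= [FY near_p near_id]]] := local_flow (@spray_domain_open _ _ b _ g)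
  (@spray_smooth _ _ b _ g) (@spray_homog _ _ b _ g) Op eta0 rmax0.
exists (rho / 2); first exact: divr_gt0.
exists (fun z => l (Y z 1)); rewrite /=.
pose B := [set z : 'rV[R]_(n + n) | `|l z - p0| < rho / 2 /\ `|r z| < rho / 2].
pose B0 := [set z : 'rV[R]_(n + n) | `|l z - p0| < rho /\ `|r z| < rho / 2].
have BB0 : B `<=` B0 by move=> z [h1 h2]; split=> //; move: h1; lra.
have [Y0 dY Yc] := FY.
have oB0 : open B0.
  rewrite openE => z Bz; have [Q [_ _ _ nQ]] := Yc z Bz.
  by apply: filterS nQ => z' [].
split.
- move=> k; apply: (sub_Cn BB0).
  have Cl : Cn k [set: 'rV[R]_(n + n)] l.
    by apply: Cn_linear; [exact: lsubmx_continuous|exact: openT].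
  apply: (Cn_comp oB0 openT _ _ Cl) => //.
  apply: (flow_Cn k (ler0n _ 2) oU oB0 CF FY).
  by rewrite normr1 ler1n.
- by move=> z /BB0 Bz; exact: le_trans (near_p z Bz) rhom.
- by move=> z z' /BB0 Bz /BB0 Bz'; exact: near_id.
- move=> p v Bz Mp' tv; have B0z := BB0 _ Bz.
  set z := row_mx p v in Bz B0z *.
  pose J := `]- (1 : R), 1 + 1[%classic : set R.
  have Hy (t : R) : J t -> U (Y z t) /\ is_derive t 1 (Y z) (geo_field A (Y z t)).
    rewrite /J /= in_itv /= => /andP[h1 h2].
    have t2 : `|t| <= 2 by rewrite ler_norml; apply/andP; split; lra.
    split; last exact: dY.
    have [Q [_ _ QU nQ]] := Yc z B0z; have [_ Qz] := nbhs_singleton nQ.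
    exact: QU (Qz t t2).
  have z0 : Y z 0 = z by exact: Y0.
  have M0 : M (l (Y z 0)) by rewrite z0 row_mxKl.
  have T0 : eps * dot (l (Y z 0)) (r (Y z 0)) = 0.
    by rewrite z0 row_mxKl row_mxKr; exact: (tangent_dot HM).
  have [geo dgeo] := @ode_geodesic (- 1) (1 + 1) (Y z) (ltrN10 R) (ltr0Sn _ 1) Hy M0 T0.
  have ev : exp_value g (p, v) (l (Y z 1)).
    exists 1 => //; exists (fun t => l (Y z t)); split=> //=.
    + by rewrite z0 row_mxKl.
    + rewrite dgeo; last by rewrite /= in_itv /=; apply/andP; split; lra.
      by rewrite z0 row_mxKr.
  have uniq y : exp_value g (p, v) y -> y = l (Y z 1).
    move=> [e e0 [c [gc c0 c'0 <-]]].
    have oJ' : open (`]- e, 1 + e[%classic : set R) by exact: interval_open.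
    have Js (s : R) : 0 <= s <= 1 -> (`]- e, 1 + e[%classic : set R) s.
      by move=> /andP[h1 h2]; rewrite /= in_itv /=; apply/andP; split; lra.
    have := @ode_unique _ _ U (geo_field A) (fun s => row_mx (c s) (c^`()%classic s)) (Y z) oU (CF 1%N).
    have -> : c 1 = l (row_mx (c 1) (c^`()%classic 1)) by rewrite row_mxKl.
    move=> H; congr (l _); apply: H; last by rewrite ler01 lexx.
    + move=> s /Js s01; split; last exact: geodesic_ode gc s01.
      by rewrite /= row_mxKl; apply: (spray_domainP HM); have [_ + _] := gc; apply.
    + by move=> s /andP[h1 h2]; apply: Hy; rewrite /J /= in_itv /=; apply/andP; split; lra.
    + by rewrite z0 c0 c'0.
  split; first by exists (l (Y z 1)).
    by rewrite /Exp; apply: uniq; exact: (xgetPex 0 (ex_intro _ _ ev)).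
  by have [_ + _] := geo; apply; rewrite /= in_itv /=; apply/andP; split; lra.
Qed.

End GeodesicOde.

Section CnLocal.
Variables (R : realType) (V W : normedModType R).

Lemma Cn_local k (U : set V) (f : V -> W) :
  (forall x, U x -> exists V', [/\ open V', V' x & Cn k V' f]) -> Cn k U f.
Proof.
elim: k f => [|k IH] f H.
  split; last exact I; move=> x /H[V' [oV V'x Cf]]; exact: (Cn_cont Cf).
apply: CnS => [x /H[V' [oV V'x Cf]]|v]; first exact: (Cn_cont Cf).
split=> [x /H[V' [oV V'x Cf]]|]; first exact: (Cn_derivable v Cf).
by apply: IH => x /H[V' [oV V'x Cf]]; exists V'; split=> //; exact: Cn_derive.
Qed.

End CnLocal.

(** * Loops and their C^2 neighbourhoods *)

Section Turn.
Variable R : realType.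

Lemma Cn_cos_sin k : Cn k [set: R^o] (@cos R : R^o -> R^o) /\ Cn k [set: R^o] (@sin R : R^o -> R^o).
Proof.
elim: k => [|k [IHc IHs]].
  by split; (split; last exact I) => x _; [exact: continuous_cos|exact: continuous_sin].
have oT : open [set: R] by exact: openT.
split; last by apply: (Cn_curveS (c' := cos)) => // t _; exact: is_derive_sin.
apply: (Cn_curveS (c' := fun t => - sin t)) => //.
by apply: (eq_Cn _ _ (CnZ (-1) _ IHs)) => // t _; rewrite scaleN1r.
Qed.

Lemma turn_smooth : smooth [set: R^o] (@turn R : R^o -> 'rV[R]_2).
Proof.
have oT : open [set: R^o] by exact: openT.
move=> k; apply/(Cn_mxP _ _ oT) => i j; have [Cc Cs] := Cn_cos_sin k.
have [j0|j0] := boolP (j == 0).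
  by apply: (eq_Cn _ _ Cc) => // t _; rewrite mxE j0.
by apply: (eq_Cn _ _ Cs) => // t _; rewrite mxE (negPf j0).
Qed.

Lemma turn_circle t : circle (turn t : 'rV[R]_2).
Proof. by rewrite /circle /= !mxE /= cos2Dsin2. Qed.

Lemma turn_shift t : turn (t + 2 * pi) = turn t :> 'rV[R]_2.
Proof.
apply/rowP => j; rewrite !mxE; have -> : 2 * pi = pi *+ 2 :> R by rewrite mulr_natl.
by rewrite cosD2pi sinD2pi.
Qed.

Lemma turn_derive (t : R) : is_derive t 1 (@turn R) (\row_(j < 2) (if j == 0 then - sin t else cos t)).
Proof.
apply: is_derive_mxP => i j; rewrite mxE.
have -> : (fun t : R => turn t i j) = (if j == 0 then cos else sin).
  by apply/funext => s; rewrite mxE; case: ifP.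
by case: ifP => _; [exact: is_derive_cos|exact: is_derive_sin].
Qed.

(** Equal points force [cos (t - s) = 1], which the double angle formula excludes strictly inside a
    period; the last two cases are the two ends of the closed period. *)
Lemma turn_inj (t s : R) : 0 <= t <= 2 * pi -> 0 <= s <= 2 * pi -> turn t = turn s ->
  [\/ t = s, t = s + 2 * pi | s = t + 2 * pi].
Proof.
move=> t0 s0 E.
have Ec : cos t = cos s by have /rowP/(_ 0) := E; rewrite !mxE.
have Es : sin t = sin s by have /rowP/(_ 1) := E; rewrite !mxE.
have key (x : R) : 0 < x -> x < 2 * pi -> cos x != 1.
  move=> x0 x2; have h : 0 < sin (x / 2).
    by apply: sin_gt0_pi; apply/andP; split; lra.
  have -> : x = (x / 2) *+ 2 by rewrite -mulr_natr divfK.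
  rewrite cos_mulr2n; apply/eqP => h2.
  have := cos2Dsin2 (x / 2); nra.
have c1 : cos (t - s) = 1 by rewrite cosB Ec Es -!expr2 cos2Dsin2.
have c2 : cos (s - t) = 1 by rewrite -opprB cosN.
have [ts|ts|->] := ltgtP t s; last by constructor 1.
- have [h|h] := ltP (s - t) (2 * pi).
    by have := key (s - t); rewrite c2 eqxx subr_gt0 => /(_ ts h).
  by constructor 3; move: t0 s0 h => /andP[h1 h2] /andP[h3 h4] h; lra.
- have [h|h] := ltP (t - s) (2 * pi).
    by have := key (t - s); rewrite c1 eqxx subr_gt0 => /(_ ts h).
  by constructor 2; move: t0 s0 h => /andP[h1 h2] /andP[h3 h4] h; lra.
Qed.

Lemma turn_reduce (t : R) : exists k : int, 0 <= t - k%:~R * (2 * pi) <= 2 * pi.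
Proof.
have pi0 : 0 < 2 * pi :> R by rewrite mulr_gt0// pi_gt0.
exists (Num.floor (t / (2 * pi))).
have /andP[h1 h2] := floor_itv (t / (2 * pi)).
rewrite ler_pdivlMr// in h1; rewrite ltr_pdivrMr// intrD in h2.
by apply/andP; split; [lra|move: h2; rewrite mulrDl mul1r; lra].
Qed.

End Turn.

Section Loops.
Variables (R : realType) (n : nat) (M : set 'rV[R]_n).
Implicit Types c : Emb M.

Lemma loopP c : exists2 f, smooth_embedding (@circle R) M f & loop c = f \o @turn R.
Proof. by rewrite /loop; case: c => c cP /=; have := set_mem cP. Qed.

Lemma loop_mem c t : M (loop c t).
Proof. by have [f [Mf _ _ _ _] ->] := loopP c; apply: Mf; exact: turn_circle. Qed.

Lemma loop_smooth c : smooth [set: R^o] (loop c : R^o -> 'rV[R]_n).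
Proof.
have [f [_ sf _ _ _] ->] := loopP c; move=> k.
apply: Cn_local => t _; have [U [F [oU Ut sF FE]]] := sf _ (turn_circle t).
have oV : open ((@turn R : R^o -> 'rV[R]_2) @^-1` U).
  have ct s : {for s, continuous (@turn R : R^o -> _)} by exact: (Cn_cont (turn_smooth R 0) I).
  apply: open_comp oU => s _; exact: ct.
exists (@turn R @^-1` U); split=> //.
have Cc : Cn k ((@turn R : R^o -> 'rV[R]_2) @^-1` U) (F \o @turn R).
  apply: (@Cn_comp R R^o 2 1 n k _ U (@turn R) F) => //.
  by apply: sub_Cn (turn_smooth R k); exact: subsetT.
by apply: (eq_Cn _ _ Cc) => // s Us; apply: FE; split=> //; exact: turn_circle.
Qed.

Lemma loop_inj c t s : loop c t = loop c s -> turn t = turn s :> 'rV[R]_2.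
Proof.
have [f [_ _ _ fi _] ->] := loopP c => /fi; apply; rewrite inE; exact: turn_circle.
Qed.

Lemma loop_shift c (t : R) (k : int) : loop c (t + k%:~R * (2 * pi)) = loop c t.
Proof.
have [f _ ->] := loopP c; rewrite /=; congr f.
have nat_shift (s : R) (m : nat) : turn (s + m%:R * (2 * pi)) = turn s :> 'rV[R]_2.
  elim: m => [|m IH]; first by rewrite mul0r addr0.
  by rewrite -natr1 mulrDl mul1r addrA turn_shift.
case: k => m; first exact: nat_shift.
rewrite NegzE mulrNz mulNr -[in RHS](subrK (m.+1%:R * (2 * pi)) t).
by rewrite nat_shift.
Qed.

Lemma loop_derive c (t : R) : is_derive t 1 (loop c) ((loop c)^`()%classic t).
Proof. exact: curve_derive (loop_smooth c 1%N) _. Qed.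

Lemma loop_derive2 c (t : R) :
  is_derive t 1 ((loop c)^`()%classic) (derive1n 2 (loop c) t).
Proof.
have C1 : Cn 1 [set: R^o] ((loop c)^`()%classic : R^o -> 'rV[R]_n).
  by apply: Cn_derive1; [exact: openT|exact: (loop_smooth c 2%N)].
exact: curve_derive C1 _.
Qed.

Lemma loop_derive_shift c (t : R) (k : int) :
  (loop c)^`()%classic (t + k%:~R * (2 * pi)) = (loop c)^`()%classic t.
Proof.
rewrite !derive1E -[RHS](_ : 'D_1 (fun s => loop c (s + k%:~R * (2 * pi))) t = _).
  have d : derivable (loop c) (@idfun R t + k%:~R * (2 * pi)) (@idfun R 1).
    by have [d _] := loop_derive c (t + k%:~R * (2 * pi)); exact d.
  by have [_ ->] := is_derive_affine d.
by congr ('D_1 _ t); apply/funext => s; rewrite loop_shift.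
Qed.

Lemma loop_tangent c (t : R) : tangent M (loop c t) ((loop c)^`()%classic t).
Proof.
apply: (@curve_tangent _ _ _ setT) => //; [exact: openT|exact: loop_smooth|].
by move=> s _; exact: loop_mem.
Qed.

(** The immersion clause is tested on the curve [turn (s + t)] in the circle, whose velocity at
    [s = 0] is nonzero. *)
Lemma loop_immersed c (t : R) : (loop c)^`()%classic t != 0.
Proof.
have [f [_ _ fi _ _] cE] := loopP c.
pose ct (s : R) : 'rV[R]_2 := turn (s + t).
have dct : is_derive (0 : R) 1 ct (\row_(j < 2) (if j == 0 then - sin t else cos t)).
  have := turn_derive t; rewrite -[t in is_derive t]add0r => -[d1 d2].
  have := @is_derive_affine R R R _ (@turn R) (@idfun R) t 0 1 d1.
  by rewrite /= d2.
have := fi (turn t) ct (turn_circle t).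
have -> : (f \o ct)^`()%classic 0 = (loop c)^`()%classic t.
  rewrite !derive1E cE.
  have := loop_derive c t; rewrite -[t in is_derive t]add0r => -[d1 _].
  rewrite cE in d1.
  have := @is_derive_affine R R R _ (f \o @turn R) (@idfun R) t 0 1 d1.
  by move=> [_]; rewrite /= add0r.
apply.
  split; first by rewrite /ct add0r.
  exists 1 => //; split; last by move=> s _; exact: turn_circle.
  move=> k; apply: sub_Cn (@subsetT _ _) _.
  have := @Cn_affine R R^o R^o _ k setT (@turn R) (@idfun R^o) t.
  by apply; [move=> y; exact: cvg_id|exact: openT|exact: (turn_smooth R k)].
rewrite derive1E; have [_ ->] := dct; apply/eqP => /rowP E.
have := E 0; have := E 1; rewrite !mxE /= => c0 /eqP; rewrite oppr_eq0 => /eqP s0.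
by have := cos2Dsin2 t; rewrite c0 s0 expr0n addr0 => /eqP; rewrite eq_sym oner_eq0.
Qed.

Definition C2close c0 (d : R) c := forall (k : nat) (t : R), (k <= 2)%N ->
  `|derive1n k (loop c) t - derive1n k (loop c0) t| < d.

Lemma C2close_nbhs c0 (d : R) : 0 < d -> \forall c \near c0, C2close c0 d c.
Proof.
move=> d0.
have H k : \forall c \near c0, forall t : R, `|derive1n k (loop c) t - derive1n k (loop c0) t| < d.
  have cJ : continuous (fun c : Emb M => jets c k : {uniform R -> 'rV[R]_n}).
    move=> c; apply: (@continuous_comp (Emb M) {ptws nat -> {uniform R -> 'rV[R]_n}}
      {uniform R -> 'rV[R]_n} (fun c => jets c) (fun j => j k)).
      exact: initial_continuous.
    exact: (@proj_continuous nat (fun=> {uniform R -> 'rV[R]_n}) k).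
  have nP : nbhs (jets c0 k : {uniform R -> 'rV[R]_n})
      [set h | forall t : R, `|h t - derive1n k (loop c0) t| < d].
    apply/uniform_nbhs; exists [set xy : 'rV[R]_n * 'rV[R]_n | ball xy.1 d xy.2]; split.
      exact: (entourage_ball _ (PosNum d0)).
    by move=> h Hh t; have := Hh t I; rewrite -ball_normE /= distrC.
  exact: (cJ c0 _ nP).
apply: filterS3 (H 0%N) (H 1%N) (H 2%N) => c h0 h1 h2 k t.
by case: k => [|[|[|k]]] //.
Qed.

End Loops.

Lemma dot_norm_le (R : realType) (n : nat) (u v : 'rV[R]_n) : `|dot u v| <= n%:R * (`|u| * `|v|).
Proof.
rewrite dotE (le_trans (ler_norm_sum _ _ _))//.
apply: (@le_trans _ _ (\sum_(i < n) `|u| * `|v|)).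
  by apply: ler_sum => i _; rewrite normrM ler_pM// ler_mx_entry.
by rewrite sumr_const card_ord -[leLHS]mulr_natl.
Qed.

Section IntervalBounds.
Variables (R : realType) (t0 d : R).
Let I (s : R) := `|s - t0| < d.

Lemma between_ball (a b s : R) : I a -> I b -> a <= s <= b -> I s.
Proof.
rewrite /I !ltr_norml => /andP[h1 h2] /andP[h3 h4] /andP[h5 h6].
by apply/andP; split; lra.
Qed.

Lemma derive_norm_le_ball (p q : nat) (y y' : R -> 'M[R]_(p, q)) (K t s : R) : I t -> I s ->
  (forall x, I x -> is_derive x 1 y (y' x)) -> (forall x, I x -> `|y' x| <= K) ->
  `|y t - y s| <= K * `|t - s|.
Proof.
move=> It Is dy yK; have [ts|st] := leP t s.
  rewrite distrC [`|t - s|]distrC (ger0_norm (x := s - t)) ?subr_ge0//.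
  by apply: (derive_norm_le ts) => x /(between_ball It Is); [exact: dy|exact: yK].
rewrite (gtr0_norm (x := t - s)) ?subr_gt0//.
by apply: (derive_norm_le (ltW st)) => x /(between_ball Is It); [exact: dy|exact: yK].
Qed.

Lemma derive_lower_ball (f f' : R -> R) (m t s : R) : I t -> I s ->
  (forall x, I x -> is_derive x 1 f (f' x)) -> (forall x, I x -> m <= f' x) ->
  m * `|t - s| <= `|f t - f s|.
Proof.
have key (a b : R) : a <= b -> I a -> I b -> (forall x, I x -> is_derive x 1 f (f' x)) ->
    (forall x, I x -> m <= f' x) -> m * (b - a) <= f b - f a.
  move=> ab Ia Ib df fm.
  suff : f a - m * a <= f b - m * b by lra.
  apply: (@derive_ge0_le _ (fun x => f x - m * x) (fun x => f' x - m) a b ab) => x xab.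
    have h := is_deriveB (df x (between_ball Ia Ib xab)) (is_deriveZ m (is_derive_id x 1)).
    by apply: (is_derive_eq h); rewrite [m *: _]mulr1.
  by rewrite subr_ge0; exact: fm (between_ball Ia Ib xab).
move=> It Is df fm; have [ts|st] := leP t s.
  rewrite distrC [`|f t - f s|]distrC (ger0_norm (x := s - t)) ?subr_ge0//.
  exact: le_trans (key t s ts It Is df fm) (ler_norm _).
rewrite (gtr0_norm (x := t - s)) ?subr_gt0//.
exact: le_trans (key s t (ltW st) Is It df fm) (ler_norm _).
Qed.

End IntervalBounds.

(** * Lower bounds for the normal exponential map *)

Section NormalVectors.
Variables (R : realType) (n : nat) (b : bool) (M : set 'rV[R]_n).
Local Notation eps := (b%:R : R).
Hypothesis HM : forall x, M x <-> eps * (dot x x - 1) = 0.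
Variable g : riemannian_metric M.
Local Notation l := (@lsubmx R 1 n n).
Local Notation r := (@rsubmx R 1 n n).
Implicit Types c : Emb M.
Local Notation vel c := ((loop c)^`()%classic).

Definition normal_vector c t (d : R) v := [/\ tangent M (loop c t) v,
  pairing (g (loop c t)) v (vel c t) = 0 & pairing (g (loop c t)) v v < d ^+ 2].

(** The tangent spaces on which [g] is positive move with [p], whereas [gram] at [p0] is positive on
    the whole compact unit sphere. The resulting bound persists near [p0], and [gram] agrees with
    [g] on tangent vectors. *)
Lemma tangent_norm_bound p0 : M p0 -> exists2 m : R, 0 < m &
  forall p v, M p -> `|p - p0| < m -> tangent M p v -> m * `|v| ^+ 2 <= pairing (g p) v v.
Proof.
move=> Mp0.
pose h (z : 'rV[R]_(n + n)) : R := pairing (gram b g (l z)) (r z) (r z).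
have ch z : {for z, continuous h}.
  have oT : open [set: 'rV[R]_(n + n)] by exact: openT.
  have Cr : Cn 0 [set: 'rV[R]_(n + n)] r by apply: Cn_linear => //; exact: rsubmx_continuous.
  have Cg : Cn 0 [set: 'rV[R]_(n + n)] (fun z => gram b g (l z)).
    apply: (Cn_precomp (f := gram b g) (U := setT)); [exact: lsubmx_continuous|exact: openT|exact: gram_Cn].
  have Ch : Cn 0 [set: 'rV[R]_(n + n)] (fun z => dot (r z *m gram b g (l z)) (r z) : R^o).
    exact: (Cn_dot oT (Cn_mulmx oT Cr Cg) Cr).
  exact: (Cn_cont Ch I).
have cS : compact [set v : 'rV[R]_n | `|v| = 1].
  apply: bounded_closed_compact.
    exists 1; split; first by rewrite num_real.
    by move=> x x1 v /= ->; exact: ltW.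
  have -> : [set v : 'rV[R]_n | `|v| = 1] = (fun v : 'rV[R]_n => `|v| : R) @^-1` [set 1] by [].
  apply: closed_comp; last exact: closed_eq.
  by move=> v _; exact: norm_continuous.
pose P (m : R) (v : 'rV[R]_n) := forall p, `|p - p0| < m -> m <= pairing (gram b g p) v v.
have H : \forall m \near (0 : R)^'+, [set v : 'rV[R]_n | `|v| = 1] `<=` P m.
  move/compact_near_coveringP : cS; apply => v /= v1.
  have v0 : v != 0 by rewrite -normr_gt0 v1.
  have h0 : 0 < h (row_mx p0 v) by rewrite /h row_mxKl row_mxKr; exact: (gram_pos HM).
  have h2 : h (row_mx p0 v) / 2 < h (row_mx p0 v) by lra.
  have nb : \forall z \near row_mx p0 v, h (row_mx p0 v) / 2 < h z.
    exact: (cvgr_gt (h (row_mx p0 v)) (ch (row_mx p0 v)) _ h2).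
  have /nbhs_ballP[e /= e0 He] := nb.
  near=> v' m => p pm.
  have ve : `|v' - v| < e by near: v'; apply/nbhs_ballP; exists e => // w; rewrite -ball_normE /= distrC.
  have me : m < e by near: m; exact: nbhs_right_lt.
  have mh : m < h (row_mx p0 v) / 2 by near: m; apply: nbhs_right_lt; lra.
  have := He (row_mx p v'); move: mh; rewrite /h !row_mxKl !row_mxKr => mh hh.
  apply: (le_trans (ltW mh)); apply/ltW/hh.
  rewrite -ball_normE /= distrC opp_row_mx add_row_mx.
  pose K := Num.max `|p - p0| `|v' - v|.
  apply: (@le_lt_trans _ _ K); last by rewrite gt_max ve andbT (lt_trans pm).
  by apply: row_mx_norm_le; rewrite /K le_max lexx ?orbT.
near (0 : R)^'+ => m.
have Hm : [set v : 'rV[R]_n | `|v| = 1] `<=` P m by near: m; exact: H.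
have m0 : 0 < m by near: m; exact: nbhs_right_gt.
exists m => // p v Mp pm tv.
have [->|v0] := eqVneq v 0.
  by rewrite normr0 expr0n /= mulr0 /pairing mul0mx mul0mx mxE.
rewrite -(gram_tangent HM g Mp tv).
have nv : 0 < `|v| by rewrite normr_gt0.
have := Hm (`|v|^-1 *: v).
rewrite /= normrZ normfV normr_id mulVf ?gt_eqF// => /(_ erefl) /(_ p pm).
rewrite pairingZl pairingZr => h1.
have -> : pairing (gram b g p) v v = `|v| ^+ 2 * (`|v|^-1 * (`|v|^-1 * pairing (gram b g p) v v)).
  by field; rewrite gt_eqF.
by rewrite mulrC ler_pM2l// exprn_gt0.
Unshelve. all: by end_near. Qed.

(** A single number [de] bounds both the C^2 distance of the loops and the [g]-length of normal
    vectors; [tangent_norm_bound] converts the latter into ambient length. *)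
Lemma normal_small c0 t0 (e : R) : 0 < e -> exists2 d : R, 0 < d &
  forall de c t, 0 < de <= d -> C2close c0 de c -> `|t - t0| < d ->
  [/\ `|loop c t - loop c0 t0| < e, `|vel c t - vel c0 t0| < e,
      `|derive1n 2 (loop c) t| <= `|derive1n 2 (loop c0) t0| + 1 &
      forall v, normal_vector c t de v -> `|v| < e].
Proof.
move=> e0; have [m m0 Hm] := tangent_norm_bound (loop_mem c0 t0).
pose e1 := Num.min (Num.min (e / 2) (m / 2)) (1 / 2).
have e10 : 0 < e1 by rewrite !lt_min !divr_gt0.
have e1e : e1 <= e / 2 by rewrite !ge_min lexx.
have e1m : e1 <= m / 2 by rewrite !ge_min lexx orbT.
have e12 : e1 <= 1 / 2 by rewrite !ge_min lexx !orbT.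
clearbody e1.
have Cloop := loop_smooth c0; have oT : open [set: R] by exact: openT.
have C0 : (loop c0 : R -> 'rV[R]_n) @ t0 --> loop c0 t0 by exact: (Cn_cont (Cloop 0%N) I).
have C1 : (vel c0 : R -> 'rV[R]_n) @ t0 --> vel c0 t0.
  by exact: (Cn_cont (Cn_derive1 oT (Cloop 1%N)) I).
have C2 : (derive1n 2 (loop c0) : R -> 'rV[R]_n) @ t0 --> derive1n 2 (loop c0) t0.
  by exact: (Cn_cont (Cn_derive1 oT (Cn_derive1 oT (Cloop 2%N))) I).
have /cvgrPdist_lt/(_ _ e10)/nbhs_ballP[d0 /= d00 H0] := C0.
have /cvgrPdist_lt/(_ _ e10)/nbhs_ballP[d1 /= d10 H1] := C1.
have /cvgrPdist_lt/(_ _ e10)/nbhs_ballP[d2 /= d20 H2] := C2.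
(* The entry [m * e] serves the last clause: together with [de <= e] it gives
   [de ^+ 2 <= m * e ^+ 2], whereas [m * |v| ^+ 2 < de ^+ 2]. *)
pose d := Num.min (Num.min e1 (m * e)) (Num.min d0 (Num.min d1 d2)).
have dd : 0 < d by rewrite !lt_min e10 mulr_gt0// d00 d10.
exists d => // de c t /andP[de0 ded] Cc.
have de1 : de <= e1 by rewrite (le_trans ded)// /d !ge_min lexx.
have dme : de <= m * e by rewrite (le_trans ded)// !ge_min lexx orbT.
rewrite !lt_min => /andP[_ /and3P[t0' t1' t2']].
have B (x : R) : `|t - t0| < x -> ball t0 x t by rewrite -ball_normE /= distrC.
have h0 := H0 t (B _ t0'); have h1 := H1 t (B _ t1'); have h2 := H2 t (B _ t2').
have k0 := Cc 0%N t isT; have k1 := Cc 1%N t isT; have k2 := Cc 2%N t isT.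
rewrite /= in k0 k1.
have g0 : `|loop c t - loop c0 t0| < de + e1.
  have h0' : `|loop c0 t - loop c0 t0| < e1 by rewrite distrC; exact: h0.
  by rewrite -(subrKA (loop c0 t)) (le_lt_trans (ler_normD _ _))// ltrD.
split.
- by apply: (lt_le_trans g0); clear -de1 e1e; lra.
- rewrite -(subrKA (vel c0 t)) (le_lt_trans (ler_normD _ _))//.
  have h1' : `|vel c0 t - vel c0 t0| < e1 by rewrite distrC; exact: h1.
  have k1' : `|vel c t - vel c0 t| < de by exact: k1.
  apply: (lt_le_trans (ltrD k1' h1')); clear -de1 e1e; lra.
- have h2' : `|derive1n 2 (loop c0) t - derive1n 2 (loop c0) t0| < e1 by rewrite distrC; exact: h2.
  have h3 := ler_distD (derive1n 2 (loop c0) t) (derive1n 2 (loop c) t) (derive1n 2 (loop c0) t0).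
  have h4 := le_trans h3 (ltW (ltrD k2 h2')).
  rewrite -lerBlDl (le_trans (lerB_dist _ _))// (le_trans h4)//.
  by clear -de1 e12; lra.
- move=> v [tv _ vd].
  have lm : `|loop c t - loop c0 t0| < m by apply: (lt_le_trans g0); clear -de1 e1m; lra.
  have h := Hm _ _ (loop_mem c t) lm tv.
  rewrite ltNge; apply/negP => ev.
  have f1 : de ^+ 2 <= m * e * e.
    rewrite expr2; apply: ler_pM; [exact: ltW|exact: ltW|exact: dme|].
    by clear -de1 e1e e0; lra.
  have f2 : e * e <= `|v| ^+ 2.
    by rewrite expr2; apply: ler_pM => //; exact: ltW.
  have f3 : m * (e * e) <= m * `|v| ^+ 2 by rewrite ler_pM2l.
  rewrite -mulrA in f1; have := lt_le_trans (le_lt_trans (le_trans f3 h) vd) f1.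
  by rewrite ltxx.
Qed.

End NormalVectors.

Lemma dotNl (R : realType) (n : nat) (u v : 'rV[R]_n) : dot (- u) v = - dot u v.
Proof. by rewrite dotC dotNr dotC. Qed.

Lemma dot_split (R : realType) (n : nat) (a u x x0 : 'rV[R]_n) :
  dot a x = dot u x0 + dot (a - u) x + dot u (x - x0).
Proof. by rewrite dotDl dotNl dotDr dotNr; ring. Qed.

Lemma half_le_perturbed (R : realType) (m a b A B : R) : 0 < m -> `|a| <= A -> `|b| <= B ->
  A + B <= m / 4 -> m / 2 <= m + a + b.
Proof. by rewrite !ler_norml => m0 /andP[? _] /andP[? _] ?; lra. Qed.

Lemma dot_normal_diff (R : realType) (n : nat) (v w x x' : 'rV[R]_n) :
  dot v x = 0 -> dot w x' = 0 -> dot (v - w) x = - dot w (x - x').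
Proof. by move=> vx wx'; rewrite dotDl dotNl dotDr dotNr vx wx' add0r oppr0 addr0. Qed.

Section PairBounds.
Variables (R : realType) (n : nat) (b : bool) (M : set 'rV[R]_n).
Local Notation eps := (b%:R : R).
Hypothesis HM : forall x, M x <-> eps * (dot x x - 1) = 0.
Variable g : riemannian_metric M.
Local Notation l := (@lsubmx R 1 n n).
Local Notation r := (@rsubmx R 1 n n).
Implicit Types c : Emb M.
Local Notation vel c := ((loop c)^`()%classic).

Definition pair_bound c (t s d : R) := forall v w, normal_vector g c t d v -> normal_vector g c s d w ->
  d * (`|loop c t - loop c s| + `|v - w|) <= `|Exp g (loop c t, v) - Exp g (loop c s, w)|.

(** The form in which [smooth_on] gets verified: near a given normal vector, [Exp] agrees on all
    tangent vectors of [M] with a smooth map on an open set of pairs, joined into one row. *)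
Definition exp_extends c (t d : R) := forall v, normal_vector g c t d v ->
  exists (B : set 'rV[R]_(n + n)) (E : 'rV[R]_(n + n) -> 'rV[R]_n),
    [/\ open B, B (row_mx (loop c t) v), smooth B E &
      forall p v', B (row_mx p v') -> M p -> tangent M p v' ->
        [/\ exp_domain g (p, v'), Exp g (p, v') = E (row_mx p v') & M (E (row_mx p v'))]].

Lemma open_double_ball (p0 : 'rV[R]_n) (rho : R) :
  open [set z : 'rV[R]_(n + n) | `|l z - p0| < rho /\ `|r z| < rho].
Proof.
apply: openI.
  apply: (@open_comp _ _ (fun z : 'rV[R]_(n + n) => `|l z - p0| : R) [set y | y < rho]); last exact: open_lt.
  move=> z _; apply: (@continuous_comp _ _ _ (fun z => l z - p0) (fun M : 'rV[R]_n => `|M| : R)).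
    exact: (cvgB (@lsubmx_continuous R n n z) (cvg_cst p0)).
  exact: norm_continuous.
apply: (@open_comp _ _ (fun z : 'rV[R]_(n + n) => `|r z| : R) [set y | y < rho]); last exact: open_lt.
move=> z _; apply: (@continuous_comp _ _ _ r (fun M : 'rV[R]_n => `|M| : R)).
  exact: rsubmx_continuous.
exact: norm_continuous.
Qed.

(* The covector [g(c', .)] along the curve detects the tangential displacement,
   while on normal vectors it vanishes up to an error of size [|t - s|]. *)
Lemma normal_bundle_bound c0 (t0 : R) : exists2 k : R, 0 < k & exists2 d : R, 0 < d &
  forall de c t s v w, 0 < de <= d -> C2close c0 de c -> `|t - t0| < d -> `|s - t0| < d ->
  normal_vector g c t de v -> normal_vector g c s de w ->
  k * (`|loop c t - loop c s| + `|v - w|) <= `|loop c t - loop c s + (v - w)|.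
Proof.
pose p0 := loop c0 t0; pose u0 := vel c0 t0; pose z0 : 'rV[R]_(n + n) := row_mx p0 u0.
pose theta (z : 'rV[R]_(n + n)) := r z *m g (l z).
have oT : open [set: 'rV[R]_(n + n)] by exact: openT.
have Cth : Cn 1 [set: 'rV[R]_(n + n)] theta.
  have Cr : Cn 1 [set: 'rV[R]_(n + n)] r by apply: Cn_linear => //; exact: rsubmx_continuous.
  have Cg : Cn 1 [set: 'rV[R]_(n + n)] (fun z => g (l z)).
    apply: (Cn_precomp (f := g) (U := setT)); [exact: lsubmx_continuous|exact: openT|exact: metric_smooth].
  exact: (Cn_mulmx oT Cr Cg).
have [Lt Lt0 HLt] := convex_lipschitz_mx oT Cth (@compact_box _ _ z0 1) (@segment_closed_box _ _ z0 1) (@subsetT _ _).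
have bz0 : `|z0 - z0| <= 1 by rewrite subrr normr0.
pose m0 := dot u0 (theta z0).
have m00 : 0 < m0.
  rewrite /m0 /theta /z0 row_mxKl row_mxKr dotC dot_mulmx.
  by have := metric_pos g (loop_mem c0 t0) (loop_tangent c0 t0) (loop_immersed c0 t0); exact.
pose K := `|theta z0| + Lt + 1.
have K0 : 0 < K by rewrite /K ltr_wpDl// addr_ge0.
have HK z : `|z - z0| <= 1 -> `|theta z| <= K.
  move=> zz; have := HLt z0 z bz0 zz => h.
  have h2 : `|theta z| <= `|theta z0| + `|theta z - theta z0|.
    by rewrite -lerBlDl lerB_dist.
  apply: (le_trans h2); rewrite /K -addrA lerD2l (le_trans h)//.
  by rewrite -[leLHS]addr0 lerD// ler_piMr.
pose N : R := n%:R + 1.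
have N0 : 0 < N by rewrite /N ltr_wpDl.
have Hdot (x y : 'rV[R]_n) (X Y : R) : `|x| <= X -> `|y| <= Y -> `|dot x y| <= N * (X * Y).
  move=> xX yY; apply: (le_trans (dot_norm_le _ _)).
  apply: ler_pM; [exact: ler0n|exact: mulr_ge0|by rewrite /N lerDl|].
  by apply: ler_pM.
pose K2 := `|u0| + `|derive1n 2 (loop c0) t0| + 1.
have K20 : 0 < K2 by rewrite /K2 ltr_wpDl// addr_ge0.
(* The summands [K] and [|u0| * Lt] pay for the variation of the velocity and of the covector in
   [lower]; [K2 * Lt] pays in [upperz] for pairing short normal vectors with the moving covector. *)
pose e := Num.min (1 / 2) (m0 / 4 / (N * (K + K2 * Lt + `|u0| * Lt + 1))).
have D0 : 0 < N * (K + K2 * Lt + `|u0| * Lt + 1).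
  rewrite mulr_gt0// ltr_wpDl// addr_ge0// ?mulr_ge0//.
  by rewrite addr_ge0 ?mulr_ge0// ltW.
have e0 : 0 < e by rewrite lt_min !divr_gt0.
have e1 : e <= 1 / 2 by rewrite ge_min lexx.
have eD : e * (N * (K + K2 * Lt + `|u0| * Lt + 1)) <= m0 / 4.
  by rewrite -ler_pdivlMr// ge_min lexx orbT.
have e11 : e <= 1 by rewrite (le_trans e1)// ler_pdivrMr// mul1r ler1n.
clearbody e.
have [d d0 Hd] := normal_small HM g c0 t0 e0.
pose kk := 8 * K2 * (N * K) / m0 + 1.
have kk0 : 0 < kk.
  rewrite /kk ltr_wpDl//; apply: divr_ge0; last exact: ltW.
  apply: mulr_ge0; first by apply: mulr_ge0 => //; exact: ltW.
  by apply: mulr_ge0; exact: ltW.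
exists kk^-1; first by rewrite invr_gt0.
exists d => // de c t s v w de0 Cc td sd Nv Nw.
have [t1 t2 t3 t4] := Hd de c t de0 Cc td; have [s1 s2 s3 s4] := Hd de c s de0 Cc sd.
pose Z (x : R) := row_mx (loop c x) (vel c x) : 'rV[R]_(n + n).
have ZE x : Z x - z0 = row_mx (loop c x - p0) (vel c x - u0).
  by rewrite /Z /z0 opp_row_mx add_row_mx.
have Zb x : `|x - t0| < d -> `|Z x - z0| <= e.
  move=> xd; have [x1 x2 _ _] := Hd de c x de0 Cc xd.
  by rewrite ZE; apply: row_mx_norm_le; exact: ltW.
have Zb1 x : `|x - t0| < d -> `|Z x - z0| <= 1.
  by move=> /Zb h; exact: le_trans h e11.
have thE x : theta (Z x) = vel c x *m g (loop c x) by rewrite /theta row_mxKl row_mxKr.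
have velK x : `|x - t0| < d -> `|vel c x| <= K2.
  move=> xd; have [_ x2 _ _] := Hd de c x de0 Cc xd.
  have h2 : `|vel c x| <= `|u0| + `|vel c x - u0| by rewrite -lerBlDl lerB_dist.
  apply: (le_trans h2); rewrite /K2 -addrA lerD2l (le_trans (ltW x2))//.
  by rewrite -[leLHS]add0r; apply: lerD.
have cK : `|loop c t - loop c s| <= K2 * `|t - s|.
  by apply: (derive_norm_le_ball td sd) velK => x _; exact: loop_derive.
have vK : `|vel c t - vel c s| <= K2 * `|t - s|.
  apply: (derive_norm_le_ball td sd) => [x _|x xd]; first exact: loop_derive2.
  have [_ _ x3 _] := Hd de c x de0 Cc xd; apply: (le_trans x3).
  by rewrite /K2 -addrA lerDr.
have thL : `|theta (Z t) - theta (Z s)| <= Lt * (K2 * `|t - s|).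
  rewrite (le_trans (HLt _ _ (Zb1 s sd) (Zb1 t td)))// ler_wpM2l//.
  by rewrite /Z opp_row_mx add_row_mx; exact: row_mx_norm_le.
have lower : m0 / 2 * `|t - s| <= `|dot (loop c t - loop c s) (theta (Z t))|.
  have -> : dot (loop c t - loop c s) (theta (Z t)) =
      dot (loop c t) (theta (Z t)) - dot (loop c s) (theta (Z t)).
    by rewrite -!(dotC (theta (Z t))) dotDr dotNr.
  apply: (@derive_lower_ball _ t0 d (fun x => dot (loop c x) (theta (Z t)))
    (fun x => dot (vel c x) (theta (Z t))) (m0 / 2) t s td sd) => [x _|x xd].
    have h := is_derive_dot (loop_derive c x) (is_derive_cst (theta (Z t)) x 1).
    apply: (is_derive_eq h).
    have -> : dot (loop c x) 0 = 0 by rewrite dotC /dot mul0mx mxE.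
    by rewrite addr0.
  have [_ x2 _ _] := Hd de c x de0 Cc xd.
  have E := dot_split (vel c x) u0 (theta (Z t)) (theta z0).
  have h1 := Hdot _ _ _ _ (ltW x2) (HK _ (Zb1 t td)).
  have h2 : `|dot u0 (theta (Z t) - theta z0)| <= N * (`|u0| * (Lt * e)).
    apply: Hdot => //; rewrite (le_trans (HLt _ _ bz0 (Zb1 t td)))// ler_wpM2l//.
    exact: Zb.
  have h3 : N * (e * K) + N * (`|u0| * (Lt * e)) <= m0 / 4.
    apply: le_trans eD.
    have -> : N * (e * K) + N * (`|u0| * (Lt * e)) = e * (N * (K + `|u0| * Lt)) by ring.
    rewrite ler_pM2l// ler_pM2l//.
    have : 0 <= K2 * Lt by rewrite mulr_ge0// ltW.
    by set x3 := K2 * Lt; set x4 := `|u0| * Lt; clear -m00; lra.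
  by rewrite E; exact: (half_le_perturbed m00 h1 h2 h3).
have nv : dot v (theta (Z t)) = 0.
  have [_ nv _] := Nv; rewrite thE dotC dot_mulmx.
  by rewrite (pairingC _ _ (Defs.metric_sym g (loop c t))); exact: nv.
have nw : dot w (theta (Z s)) = 0.
  have [_ nw _] := Nw; rewrite thE dotC dot_mulmx.
  by rewrite (pairingC _ _ (Defs.metric_sym g (loop c s))); exact: nw.
have upperz : `|dot (v - w) (theta (Z t))| <= m0 / 4 * `|t - s|.
  rewrite (dot_normal_diff nv nw).
  rewrite normrN (le_trans (Hdot _ _ _ _ (ltW (s4 w Nw)) thL))//.
  have -> : N * (e * (Lt * (K2 * `|t - s|))) = e * (N * (K2 * Lt)) * `|t - s| by ring.
  rewrite ler_wpM2r// (le_trans _ eD)// ler_pM2l// ler_pM2l//.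
  have : 0 <= `|u0| * Lt by rewrite mulr_ge0.
  by set x3 := K2 * Lt; set x4 := `|u0| * Lt; clear -K0; lra.
set y := loop c t - loop c s in cK lower *; set z := v - w in upperz *.
(* The tangential displacement is detected at rate [m0 / 2] and the normal vectors spoil at most
   [m0 / 4]; what remains bounds [|t - s|], hence [|y|], by [|y + z|]. *)
have hyz : m0 / 4 * `|t - s| <= N * (`|y + z| * K).
  apply: le_trans (Hdot (y + z) (theta (Z t)) _ _ (lexx _) (HK _ (Zb1 t td))).
  rewrite dotDl; have := lerB_normD (dot y (theta (Z t))) (dot z (theta (Z t))).
  by move: lower upperz; set a := `|dot y _|; set a' := `|dot z _|; clear -m00; lra.
have hy : `|y| <= 4 * K2 * (N * K) / m0 * `|y + z|.
  apply: (le_trans cK).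
  have -> : 4 * K2 * (N * K) / m0 * `|y + z| = K2 * (N * (`|y + z| * K) / (m0 / 4)).
    by field; rewrite gt_eqF.
  rewrite ler_pM2l// ler_pdivlMr ?divr_gt0//; first by rewrite mulrC.
have hz : `|z| <= `|y + z| + `|y|.
  by have := ler_normB (y + z) y; rewrite [y + z - y]addrC addKr.
rewrite mulrC ler_pdivrMr// /kk mulrDr mulr1.
have -> : `|y + z| * (8 * K2 * (N * K) / m0) = 2 * (4 * K2 * (N * K) / m0 * `|y + z|) by ring.
by move: hy hz; set a := _ * `|y + z|; clear -m00; lra.
Qed.

End PairBounds.

Lemma row_mx_norm_le_add (R : realType) (n m : nat) (a : 'rV[R]_n) (b : 'rV[R]_m) :
  `|row_mx a b| <= `|a| + `|b|.
Proof. by apply: row_mx_norm_le; rewrite ?lerDl ?lerDr. Qed.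

Section UniformBounds.
Variables (R : realType) (n : nat) (b : bool) (M : set 'rV[R]_n).
Local Notation eps := (b%:R : R).
Hypothesis HM : forall x, M x <-> eps * (dot x x - 1) = 0.
Variable g : riemannian_metric M.
Local Notation l := (@lsubmx R 1 n n).
Local Notation r := (@rsubmx R 1 n n).
Implicit Types c : Emb M.
Local Notation vel c := ((loop c)^`()%classic).

Let locally (c0 : Emb M) (t0 s0 : R) (P : R -> Emb M -> R -> R -> Prop) := exists2 d : R, 0 < d &
  forall de c t s, 0 < de <= d -> C2close c0 de c -> `|t - t0| < d -> `|s - s0| < d -> P de c t s.

(** [local_exp] is used with [eta = k / 2], where [k] is the constant of [normal_bundle_bound]:
    replacing addition by [Exp] costs half of the lower bound, and the other half remains. *)
Lemma near_diagonal c0 (t0 : R) :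
  locally c0 t0 t0 (fun de c t s => pair_bound g c t s de /\ exp_extends g c t de).
Proof.
have [k k0 [d1 d10 H1]] := normal_bundle_bound HM g c0 t0.
have k20 : 0 < k / 2 by exact: divr_gt0.
have [rho rho0 [E /= [sE _ nE EE]]] := local_exp HM g (loop_mem c0 t0) k20 ltr01.
have [d2 d20 H2] := normal_small HM g c0 t0 rho0.
have d0 : 0 < Num.min (k / 2) (Num.min d1 d2) by rewrite !lt_min k20 d10.
exists (Num.min (k / 2) (Num.min d1 d2)) => // de c t s; rewrite !le_min !lt_min.
move=> /andP[de0 /and3P[dek de1 de2]] Cc /and3P[_ t1 t2] /and3P[_ s1 s2].
have hd1 : 0 < de <= d1 by rewrite de0. have hd2 : 0 < de <= d2 by rewrite de0.
have [tp _ _ tv] := H2 de c t hd2 Cc t2; have [sp _ _ sv] := H2 de c s hd2 Cc s2.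
have Bt v : normal_vector g c t de v ->
    `|l (row_mx (loop c t) v) - loop c0 t0| < rho /\ `|r (row_mx (loop c t) v)| < rho.
  by move=> Nv; rewrite row_mxKl row_mxKr; split; [exact: tp|exact: tv].
have Bs w : normal_vector g c s de w ->
    `|l (row_mx (loop c s) w) - loop c0 t0| < rho /\ `|r (row_mx (loop c s) w)| < rho.
  by move=> Nw; rewrite row_mxKl row_mxKr; split; [exact: sp|exact: sv].
split=> [v w Nv Nw|v Nv]; last first.
  exists [set z | `|l z - loop c0 t0| < rho /\ `|r z| < rho], E; split=> //.
  - exact: open_double_ball.
  - exact: Bt.
have [tgv _ _] := Nv; have [tgw _ _] := Nw.
have [_ -> _] := EE _ _ (Bt v Nv) (loop_mem c t) tgv.
have [_ -> _] := EE _ _ (Bs w Nw) (loop_mem c s) tgw.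
have hk := H1 de c t s v w hd1 Cc t1 s1 Nv Nw.
have := nE _ _ (Bt v Nv) (Bs w Nw).
rewrite !row_mxKl !row_mxKr opp_row_mx add_row_mx.
have hrow := row_mx_norm_le_add (loop c t - loop c s) (v - w).
set y := loop c t - loop c s in hk hrow *; set z := v - w in hk hrow *.
set e := E _ - E _ => he.
have h3 : `|y + z| <= `|e| + `|e - y - z|.
  rewrite (_ : y + z = e - (e - y - z)); last by apply/matrixP => i j; rewrite !mxE; ring.
  exact: ler_normB.
have h4 : `|e - y - z| <= k / 2 * (`|y| + `|z|).
  by apply: (le_trans he); apply: ler_wpM2l => //; exact: ltW.
have h5 : de * (`|y| + `|z|) <= k / 2 * (`|y| + `|z|) by rewrite ler_wpM2r// addr_ge0.
have h6 := le_trans hk (le_trans h3 (lerD (lexx _) h4)).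
apply: (le_trans h5); rewrite -(lerD2r (k / 2 * (`|y| + `|z|))).
by rewrite -mulrDl -splitr.
Qed.

Lemma off_diagonal c0 (t0 s0 : R) : loop c0 t0 != loop c0 s0 ->
  locally c0 t0 s0 (fun de c t s => pair_bound g c t s de).
Proof.
move=> ts; pose D := `|loop c0 t0 - loop c0 s0|.
have D0 : 0 < D by rewrite normr_gt0 subr_eq0.
have D80 : 0 < D / 8 by exact: divr_gt0.
have [rt rt0 [Et /= [_ bEt _ EEt]]] := local_exp HM g (loop_mem c0 t0) ltr01 D80.
have [rs rs0 [Es /= [_ bEs _ EEs]]] := local_exp HM g (loop_mem c0 s0) ltr01 D80.
have et0 : 0 < Num.min rt (D / 8) by rewrite lt_min rt0.
have es0 : 0 < Num.min rs (D / 8) by rewrite lt_min rs0.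
have [d1 d10 H1] := normal_small HM g c0 t0 et0.
have [d2 d20 H2] := normal_small HM g c0 s0 es0.
(* The four errors of size [D / 8] leave the values of [Exp] at distance at least [D / 2], while the
   bracket multiplied by [de] is at most [3 * D / 2]; hence [1 / 3]. *)
have d0 : 0 < Num.min (1 / 3) (Num.min d1 d2) by rewrite !lt_min d10 d20 divr_gt0.
exists (Num.min (1 / 3) (Num.min d1 d2)) => // de c t s; rewrite !le_min !lt_min.
move=> /andP[de0 /and3P[dek de1 de2]] Cc /and3P[_ t1 t2] /and3P[_ s1 s2] v w Nv Nw.
have hd1 : 0 < de <= d1 by rewrite de0. have hd2 : 0 < de <= d2 by rewrite de0.
have [tp _ _ tv] := H1 de c t hd1 Cc t1; have [sp _ _ sv] := H2 de c s hd2 Cc s2.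
have := tp; rewrite lt_min => /andP[tpr tpD]; have := sp; rewrite lt_min => /andP[spr spD].
have := tv v Nv; rewrite lt_min => /andP[tvr tvD]; have := sv w Nw; rewrite lt_min => /andP[svr svD].
have Bt : `|l (row_mx (loop c t) v) - loop c0 t0| < rt /\ `|r (row_mx (loop c t) v)| < rt.
  by rewrite row_mxKl row_mxKr.
have Bs : `|l (row_mx (loop c s) w) - loop c0 s0| < rs /\ `|r (row_mx (loop c s) w)| < rs.
  by rewrite row_mxKl row_mxKr.
have [tgv _ _] := Nv; have [tgw _ _] := Nw.
have [_ -> _] := EEt _ _ Bt (loop_mem c t) tgv.
have [_ -> _] := EEs _ _ Bs (loop_mem c s) tgw.
have := bEt _ Bt; have := bEs _ Bs; rewrite !row_mxKl.
set e1 := Et _; set e2 := Es _; set p := loop c t in tpD *; set q := loop c s in spD *.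
move=> he2 he1.
have up : `|p - q| <= D + D / 8 + D / 8.
  have -> : p - q = (loop c0 t0 - loop c0 s0) + (p - loop c0 t0) - (q - loop c0 s0).
    by apply/matrixP => i j; rewrite !mxE; ring.
  apply: (le_trans (ler_normB _ _)); apply: lerD; last exact: ltW.
  by apply: (le_trans (ler_normD _ _)); apply: lerD; [exact: lexx|exact: ltW].
have vw : `|v - w| <= D / 8 + D / 8.
  by apply: (le_trans (ler_normB _ _)); apply: lerD; exact: ltW.
have low : `|loop c0 t0 - loop c0 s0| <= `|e1 - e2| + D / 8 + D / 8 + D / 8 + D / 8.
  have -> : loop c0 t0 - loop c0 s0 =
      (e1 - e2) - (e1 - p) + (e2 - q) - (p - loop c0 t0) + (q - loop c0 s0).
    by apply/matrixP => i j; rewrite !mxE; ring.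
  apply: (le_trans (ler_normD _ _)); apply: lerD; last exact: (ltW spD).
  apply: (le_trans (ler_normB _ _)); apply: lerD; last exact: (ltW tpD).
  apply: (le_trans (ler_normD _ _)); apply: lerD; last exact: he2.
  by apply: (le_trans (ler_normB _ _)); apply: lerD; [exact: lexx|exact: he1].
apply: (@le_trans _ _ (1 / 3 * (D + D / 8 + D / 8 + (D / 8 + D / 8)))).
  by apply: ler_pM; [exact: ltW|rewrite addr_ge0|exact: dek|exact: lerD].
by move: low; rewrite -/D; set x := `|e1 - e2|; clear -D0; lra.
Qed.

Lemma normal_vector_shift c t (k : int) d v :
  normal_vector g c (t + k%:~R * (2 * pi)) d v <-> normal_vector g c t d v.
Proof. by rewrite /normal_vector loop_shift loop_derive_shift. Qed.

Lemma pair_bound_shift c t s (k : int) d :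
  pair_bound g c t (s + k%:~R * (2 * pi)) d -> pair_bound g c t s d.
Proof.
move=> H v w Nv Nw; have := H v w Nv ((normal_vector_shift c s k d w).2 Nw).
by rewrite loop_shift.
Qed.

(** Parameters of equal points differ by a multiple of [2 * pi], so the two ends of the closed
    period also count as near the diagonal, after a shift of [s]. *)
Lemma local_pair_bound c0 (t0 s0 : R) : 0 <= t0 <= 2 * pi -> 0 <= s0 <= 2 * pi ->
  locally c0 t0 s0 (fun de c t s => pair_bound g c t s de /\ exp_extends g c t de).
Proof.
move=> t02 s02; have [d1 d10 H1] := near_diagonal c0 t0.
have [E|NE] := eqVneq (loop c0 t0) (loop c0 s0); last first.
  have [d2 d20 H2] := off_diagonal NE.
  exists (Num.min d1 d2); first by rewrite lt_min d10.
  move=> de c t s; rewrite le_min !lt_min => /and3P[de0 de1 de2] Cc /andP[t1 t2] /andP[s1 s2].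
  split; first by apply: (H2 de c t s) => //; rewrite de0.
  by have [] := H1 de c t t _ Cc t1 t1; rewrite ?de0.
exists d1 => // de c t s de0 Cc td sd.
have [_ Ht] := H1 de c t t de0 Cc td td; split=> //.
have [k hk] : exists k : int, s0 + k%:~R * (2 * pi) = t0.
  have [->|->|->] := turn_inj t02 s02 (loop_inj E).
  - by exists 0; rewrite mul0r addr0.
  - by exists 1; rewrite mul1r.
  - by exists (-1); rewrite mulN1r addrK.
apply: (pair_bound_shift (k := k)); apply: (H1 de c t _ de0 Cc td _).1.
by rewrite -hk opprD addrACA subrr addr0.
Qed.

(** Compactness of the square of one period makes the local radii uniform as they shrink to [0];
    periodicity then covers all parameters. *)
Lemma uniform_pair_bound c0 : exists2 d : R, 0 < d & forall c, C2close c0 d c ->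
  forall t s : R, pair_bound g c t s d /\ exp_extends g c t d.
Proof.
pose I2 := `[0, 2 * pi]%classic : set R.
have cI : compact (I2 `*` I2) by apply: compact_setX; exact: segment_compact.
pose P (d : R) (ts : R * R) := forall c, C2close c0 d c ->
  pair_bound g c ts.1 ts.2 d /\ exp_extends g c ts.1 d.
have H : \forall d \near (0 : R)^'+, I2 `*` I2 `<=` P d.
  move/compact_near_coveringP : cI; apply => -[t0 s0] [].
  rewrite /I2 /= !in_itv /= => t02 s02; have [d d0 Hd] := local_pair_bound c0 t02 s02.
  have nb : nbhs (t0, s0) [set ts : R * R | `|ts.1 - t0| < d /\ `|ts.2 - s0| < d].
    exists ([set t : R | `|t - t0| < d], [set s : R | `|s - s0| < d]) => //=.
    by split; apply/nbhs_ballP; exists d => // x; rewrite /ball /= distrC.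
  near=> ts de => c Cc.
  have [tsd1 tsd2] : `|ts.1 - t0| < d /\ `|ts.2 - s0| < d by near: ts; exact: nb.
  have de0 : 0 < de by near: de; exact: nbhs_right_gt.
  have ded : de <= d by near: de; exact: nbhs_right_le.
  by apply: (Hd de c ts.1 ts.2) => //; rewrite de0.
near (0 : R)^'+ => d.
have Hd : I2 `*` I2 `<=` P d by near: d; exact: H.
have d0 : 0 < d by near: d; exact: nbhs_right_gt.
exists d => // c Cc t s.
have [kt ht] := turn_reduce t; have [ks hs] := turn_reduce s.
have shiftE (x : R) (k : int) : x = x - k%:~R * (2 * pi) + k%:~R * (2 * pi) by rewrite subrK.
have [Hp He] : pair_bound g c (t - kt%:~R * (2 * pi)) (s - ks%:~R * (2 * pi)) d /\
    exp_extends g c (t - kt%:~R * (2 * pi)) d.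
  by apply: (Hd (t - kt%:~R * (2 * pi), s - ks%:~R * (2 * pi))) => //; split; rewrite /I2 /= in_itv.
split.
  move=> v w; rewrite (shiftE t kt) (shiftE s ks) !normal_vector_shift !loop_shift.
  exact: Hp.
move=> v; rewrite (shiftE t kt) normal_vector_shift !loop_shift; exact: He.
Unshelve. all: by end_near. Qed.

End UniformBounds.

(** * Thickness and ropelength *)

Section EmbeddingRadius.
Variables (R : realType) (n : nat) (M : set 'rV[R]_n).
Variable g : riemannian_metric M.
Implicit Types c : Emb M.
Local Notation V2 := ('rV[R]_n * 'rV[R]_n)%type.
Local Notation join := (fun p : V2 => row_mx p.1 p.2 : 'rV[R]_(n + n)).

Lemma smooth_join : smooth [set: V2] join.
Proof.
move=> k; have oT : open [set: V2] by exact: openT.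
by apply: (Cn_row_mx oT); apply: Cn_linear => //;
  [move=> ?; exact: cvg_fst|move=> ?; exact: cvg_snd].
Qed.

Lemma derivable_linear (V W : normedModType R) (L : {linear V -> W}) (y : R -> V) (t : R) :
  continuous L -> derivable y t 1 -> derivable (fun s => L (y s)) t 1.
Proof.
move=> cL /cvg_ex[l hl]; apply/cvg_ex; exists (L l).
have -> : (fun h : R => h^-1 *: (((fun s => L (y s)) \o shift t) (h *: 1) - L (y t))) =
    L \o (fun h : R => h^-1 *: ((y \o shift t) (h *: 1) - y t)).
  by apply/funext => h; rewrite /= [RHS]linearZ_LR [in RHS](linearB L).
by apply: cvg_comp hl _; exact: cL.
Qed.

Lemma derive_norm_lower (V W : normedModType R) (y : R -> V) (f : R -> W) (t d : R) : 0 <= d ->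
  derivable y t 1 -> derivable f t 1 ->
  (\forall s \near t, d * `|y s - y t| <= `|f s - f t|) ->
  d * `|'D_1 y t| <= `|'D_1 f t|.
Proof.
move=> d0 dy df H.
have cy : d * `|h^-1 *: (y (h *: 1 + t) - y t)| @[h --> (0 : R)^'] --> d * `|'D_1 y t|.
  by apply: cvgMr; apply: cvg_norm; exact: dy.
have cf : `|h^-1 *: (f (h *: 1 + t) - f t)| @[h --> (0 : R)^'] --> `|'D_1 f t|.
  by apply: cvg_norm; exact: df.
apply: (ler_cvg_to cy cf).
have Hs : \forall h \near (0 : R)^', d * `|y (h *: 1 + t) - y t| <= `|f (h *: 1 + t) - f t|.
  have c0 : (h *: 1 + t : R) @[h --> (0 : R)^'] --> t.
    have {2}-> : t = 0 *: 1 + t :> R by rewrite scale0r add0r.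
    apply: cvgD; last exact: cvg_cst.
    apply: (@cvgZr_tmp); exact: cvg_within.
  exact: (c0 _ H).
near=> h; rewrite !normrZ mulrCA; apply: ler_wpM2l; first exact: normr_ge0.
by near: h.
Unshelve. all: by end_near. Qed.

(** The inequality [low] gives injectivity and the continuity of the inverse directly, and the
    immersion property after passing to difference quotients. [exp_extends] supplies smoothness and
    the derivability of [Exp] along curves. *)
Lemma embedding_radius_of c (d : R) : 0 < d ->
  (forall t s : R, pair_bound g c t s d /\ exp_extends g c t d) -> embedding_radius g c d.
Proof.
move=> d0 H; have Np p : normal_disc_bundle g c d p ->
    exists2 t : R, p.1 = loop c t & normal_vector g c t d p.2.
  by case=> t [h1 h2 h3 h4]; exists t => //; split; rewrite -?h1.
have low p q : normal_disc_bundle g c d p -> normal_disc_bundle g c d q ->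
    d * `|p - q| <= `|Exp g p - Exp g q|.
  move=> /Np[t pt Nt] /Np[s qs Ns]; have [hp _] := H t s.
  apply: (@le_trans _ _ (d * (`|p.1 - q.1| + `|p.2 - q.2|))).
    by rewrite ler_pM2l// ge_max lerDl lerDr !normr_ge0.
  have := hp _ _ Nt Ns; rewrite -pt -qs.
  by case: (p) (q) => [? ?] [? ?].
have ext p : normal_disc_bundle g c d p -> exists (B : set 'rV[R]_(n + n)) E,
    [/\ open B, B (join p), smooth B E & forall q, B (join q) -> normal_disc_bundle g c d q ->
      [/\ exp_domain g q, Exp g q = E (join q) & M (Exp g q)]].
  move=> /Np[t pt Nt]; have [_ /(_ _ Nt)[B [E [oB Bp sE HE]]]] := H t t.
  exists B, E; split=> //; first by rewrite pt.
  move=> q Bq [s [qs tq _ _]]; have Mq : M q.1 by rewrite qs; exact: loop_mem.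
  have [h1 h2 h3] := HE _ _ Bq Mq tq.
  by move: h1 h2; rewrite -surjective_pairing => h1 h2; split; rewrite ?h2.
split=> //; first by move=> p Np'; have [B [E [_ Bp _ /(_ p Bp Np')[]]]] := ext p Np'.
split.
- by move=> p Np'; have [B [E [_ Bp _ /(_ p Bp Np')[]]]] := ext p Np'.
- move=> p Np'; have [B [E [oB Bp sE HE]]] := ext p Np'.
  have oU : open [set q : V2 | B (join q)].
    by apply: open_comp => // q _; exact: (Cn_cont (smooth_join 0%N)).
  exists [set q | B (join q)], (E \o join); split=> //.
    move=> k; apply: (Cn_comp oU oB _ _ (sE k)); first by [].
    exact: (sub_Cn (@subsetT _ _) (smooth_join k)).
  by move=> q [Bq Nq]; have [_ -> _] := HE q Bq Nq.
- move=> p y Np' [y0 [e e0 [sy yN]]] dy0.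
  have [B [E [oB Bp sE HE]]] := ext p Np'.
  have I0 : (`]- e, e[%classic : set R) 0 by rewrite /= in_itv /= oppr_lt0 e0.
  have oI : open (`]- e, e[%classic : set R) by exact: interval_open.
  have dy := Cn_derivable (1 : R^o) (sy 1%N) I0.
  have dy1 : derivable (fun s => (y s).1) 0 1 by apply: (derivable_linear _ dy) => ?; exact: cvg_fst.
  have dy2 : derivable (fun s => (y s).2) 0 1 by apply: (derivable_linear _ dy) => ?; exact: cvg_snd.
  have dj : is_derive (0 : R) 1 (fun s => join (y s)) (row_mx ('D_1 (fun s => (y s).1) 0) ('D_1 (fun s => (y s).2) 0)).
    exact: (is_derive_row_mx (derivableP dy1) (derivableP dy2)).
  have [ddj _] := dj.
  have Bp0 : B (join (y 0)) by rewrite y0.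
  have ddE : derivable (E \o (fun s : R => join (y s))) (0 : R) (1 : R).
    by have [h _] := @is_derive_chain R (n + n) 1 n B E oB (sE 1%N) R^o (fun s : R => join (y s)) 0 1 Bp0 ddj.
  have nE : {near (0 : R), E \o (fun s => join (y s)) =1 Exp g \o y}.
    have cj : {for (0 : R), continuous (fun s => join (y s))}.
      by apply/differentiable_continuous/derivable1_diffP; exact: ddj.
    have nB : \forall s \near (0 : R), B (join (y s)) by exact: (cj _ (open_near oB Bp0)).
    have nI := open_near oI I0.
    near=> s; have Bs : B (join (y s)) by near: s; exact: nB.
    have Is : (`]- e, e[%classic : set R) s by near: s; exact: nI.
    have es : - e < s < e by move: Is; rewrite /= in_itv.
    have [_ h _] := HE _ Bs (yN s es). by rewrite /= h.
  have df : derivable (Exp g \o y) 0 1.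
    by apply: near_eq_derivable nE _ => //; exact: ddE.
  have : d * `|'D_1 y 0| <= `|'D_1 (Exp g \o y) (0 : R)|.
    apply: (derive_norm_lower (ltW d0) dy df); near=> s.
    have Is : (`]- e, e[%classic : set R) s by near: s; exact: (open_near oI I0).
    have es : - e < s < e by move: Is; rewrite /= in_itv.
    by apply: low; [exact: yN|rewrite y0].
  rewrite !derive1E => h; rewrite -normr_gt0; apply: lt_le_trans h.
  by rewrite mulr_gt0// normr_gt0 -derive1E.
- move=> p q /set_mem Np' /set_mem Nq Epq; apply/eqP; rewrite -subr_eq0 -normr_le0.
  have := low p q Np' Nq; rewrite Epq subrr normr0.
  by rewrite pmulr_rle0.
- move=> p Np' P /nbhs_ballP[e /= e0 PP].
  exists (ball (Exp g p) (d * e)); first by apply: nbhsx_ballx; exact: mulr_gt0.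
  move=> q Nq; rewrite -ball_normE /= => hq; apply: PP; rewrite -ball_normE /=.
  by rewrite -(ltr_pM2l d0); apply: le_lt_trans hq; exact: low.
Unshelve. all: by end_near. Qed.

End EmbeddingRadius.

Lemma is_derive_continuous (R : realType) (W : normedModType R) (y : R -> W) (t : R) y' :
  is_derive t 1 y y' -> {for t, continuous y}.
Proof. by case=> d _; apply/differentiable_continuous/derivable1_diffP. Qed.

Lemma Rintegral_segment_le (R : realType) (f : R -> R) (b K : R) : 0 <= b ->
  continuous f -> (forall t, 0 <= t <= b -> f t <= K) ->
  \int[@lebesgue_measure R]_(t in `[0, b]%classic) f t <= K * b.
Proof.
move=> b0 cf fK.
have cI : compact (`[0, b]%classic : set R) by exact: segment_compact.
have iF (h : R -> R) : continuous h -> (@lebesgue_measure R).-integrable `[0, b]%classic (EFin \o h).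
  by move=> ch; apply: continuous_compact_integrable => //; exact: continuous_subspaceT.
apply: (@le_trans _ _ (\int[@lebesgue_measure R]_(t in `[0, b]%classic) cst K t)).
  apply: le_Rintegral; [by []|exact: iF|by apply: (iF (cst K)) => ?; exact: cvg_cst|].
  by move=> t; rewrite /= in_itv; exact: fK.
rewrite Rintegral_cst//= lebesgue_measure_itv /= lte_fin.
by move: b0; rewrite le_eqVlt => /predU1P[<-|->]; rewrite ?ltxx//= ?oppr0 ?addr0 ?subr0.
Qed.

Section RopeBound.
Variables (R : realType) (n : nat) (b : bool) (M : set 'rV[R]_n).
Local Notation eps := (b%:R : R).
Hypothesis HM : forall x, M x <-> eps * (dot x x - 1) = 0.
Variable g : riemannian_metric M.
Local Notation l := (@lsubmx R 1 n n).
Local Notation r := (@rsubmx R 1 n n).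
Implicit Types c : Emb M.
Local Notation vel c := ((loop c)^`()%classic).

Let speed (z : 'rV[R]_(n + n)) : R := Num.sqrt (pairing (g (l z)) (r z) (r z)).

Let speed_continuous : continuous speed.
Proof.
have oT : open [set: 'rV[R]_(n + n)] by exact: openT.
have Cr : Cn 0 [set: 'rV[R]_(n + n)] r by apply: Cn_linear => //; exact: rsubmx_continuous.
have Cg : Cn 0 [set: 'rV[R]_(n + n)] (fun z => g (l z)).
  apply: (Cn_precomp (f := g) (U := setT)); [exact: lsubmx_continuous|exact: openT|exact: metric_smooth].
have Ch := Cn_dot oT (Cn_mulmx oT Cr Cg) Cr.
move=> z; apply: (@continuous_comp _ _ _ (fun z => pairing (g (l z)) (r z) (r z)) (@Num.sqrt R)).
  rewrite (_ : (fun z => _) = (fun z => dot (r z *m g (l z)) (r z))); last first.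
    by apply/funext => z'; rewrite dot_mulmx.
  exact: (Cn_cont Ch I).
exact: sqrt_continuous.
Qed.

(** Loops at C^2 distance below [1] have positions and velocities in one box, of radius [B + 1], on
    which the speed is bounded. *)
Lemma Len_near_bounded c0 : exists2 A : R, 0 <= A & forall c, C2close c0 1 c -> 0 <= Len g c <= A.
Proof.
pose z c (t : R) : 'rV[R]_(n + n) := row_mx (loop c t) (vel c t).
have cz c : continuous (z c).
  by move=> t; exact: (is_derive_continuous (is_derive_row_mx (loop_derive c t) (loop_derive2 c t))).
have [B B0 HB] : exists2 B : R, 0 <= B & forall t : R, 0 <= t <= 2 * pi -> `|z c0 t| <= B.
  have [B B0 HB] := @compact_bound R R `[0, 2 * pi]%classic (fun t => `|z c0 t|) (@segment_compact _ _ _)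
    (fun t _ => continuous_comp (cz c0 t) (@norm_continuous _ _ _)).
  by exists B => // t t2; rewrite -[leLHS]normr_id; apply: HB; rewrite /= in_itv.
have [K K0 HK] := @compact_bound R _ _ speed (@compact_box _ _ 0 (B + 1)) (fun x _ => @speed_continuous x).
have pi20 : 0 <= 2 * pi :> R by rewrite mulr_ge0// pi_ge0.
exists (K * (2 * pi)) => [|c Cc]; first exact: mulr_ge0.
have LE : Len g c = \int[@lebesgue_measure R]_(t in `[0, 2 * pi]%classic) speed (z c t).
  by rewrite /Len; congr (Rintegral _ _ _); apply/funext => t; rewrite /speed row_mxKl row_mxKr.
rewrite LE; apply/andP; split; first by apply: Rintegral_ge0 => t _; exact: sqrtr_ge0.
apply: (Rintegral_segment_le pi20) => [t|t t2].
  exact: (continuous_comp (cz c t) (@speed_continuous _)).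
apply: (le_trans (ler_norm _)); apply: HK; rewrite /= subr0 -[z c t](subrK (z c0 t)) addrC.
apply: (le_trans (ler_normD _ _)); apply: lerD; first exact: HB.
rewrite /z opp_row_mx add_row_mx; apply: row_mx_norm_le; apply: ltW.
  exact: (Cc 0%N).
by have := Cc 1%N t isT; rewrite /= .
Qed.

Lemma Rop_near_bounded c0 : exists A : R, \forall c \near c0, (Rop g c <= A%:E)%E.
Proof.
have [d d0 Hd] := uniform_pair_bound HM g c0.
have [A A0 HA] := Len_near_bounded c0.
exists (A / d); near=> c.
have Cd : C2close c0 d c by near: c; exact: C2close_nbhs.
have C1 : C2close c0 1 c by near: c; exact: C2close_nbhs.
have er := embedding_radius_of d0 (Hd c Cd).
have dT : (d%:E <= Thi g c)%E by apply: ereal_sup_ubound; exists d.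
have /andP[L0 LA] := HA c C1.
(* An infinite thickness is treated as well: its inverse is [0], so the ropelength is then [0]. *)
rewrite /Rop; case: (Thi g c) dT => [x||] //; last first.
  by move=> _; rewrite invey mule0 lee_fin divr_ge0// ltW.
rewrite lee_fin => dx; have x0 := lt_le_trans d0 dx.
rewrite inver gt_eqF// -EFinM lee_fin; apply: ler_pM => //.
  by rewrite invr_ge0 ltW.
by rewrite lef_pV2 ?posrE.
Unshelve. all: by end_near. Qed.

Lemma compact_Rop_bounded (C : set (Emb M)) : compact C ->
  \forall A \near +oo, forall c, C c -> (Rop g c <= A%:E)%E.
Proof.
move=> /compact_near_coveringP cC.
apply: (cC R (pinfty_nbhs R) (fun A c => (Rop g c <= A%:E)%E)) => c0 _.
have [A HA] := Rop_near_bounded c0.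
near=> c A' => /=; apply: (@le_trans _ _ A%:E).
  by near: c.
by rewrite lee_fin; near: A'; exact: nbhs_pinfty_ge (num_real A).
Unshelve. all: by end_near. Qed.

End RopeBound.

(** * The telescope *)

Lemma sub_set_continuous (Z T : topologicalType) (A : set T) (h : Z -> A) :
  continuous (fun z => set_val (h z)) -> continuous h.
Proof. exact: continuous_comp_initial. Qed.

Lemma set_val_continuous (T : topologicalType) (A : set T) : continuous (@set_val T A).
Proof. exact: initial_continuous. Qed.

Lemma incl_continuous (T : topologicalType) (A B : set T) (AB : A `<=` B) : continuous (Defs.incl AB).
Proof. apply: (@sub_set_continuous A T B (Defs.incl AB)) => x; exact: set_val_continuous. Qed.

Lemma pair_continuous (Z U V : topologicalType) (f : Z -> U) (h : Z -> V) z :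
  {for z, continuous f} -> {for z, continuous h} -> {for z, continuous (fun z => (f z, h z))}.
Proof. by move=> cf ch; exact: (cvg_pair cf ch). Qed.

Lemma truncn_lt0 (R : realType) (x : R) : x < 0 -> Num.truncn x = 0%N.
Proof.
by move=> x0; apply/eqP; rewrite -leqn0 leqNgt truncn_gt0 -ltNge (lt_trans x0).
Qed.

Section Telescope.
Local Open Scope quotient_scope.
Variables (R : realType) (T : topologicalType) (A : nat -> set T) (B : set T).
Variables (AS : forall i, A i `<=` A i.+1) (AB : forall i, A i `<=` B).
Local Notation X := (fun i => A i : topologicalType).
Local Notation Y := (Defs.telescope R (fun i => Defs.incl (@AS i))).
Local Notation C := (cylinders R X).
Local Notation I := (`[0, 1]%classic : set R).
Local Notation p := (tel_inclusion R AS AB).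
Local Notation cl := (@clamp R 0 1).

Let cl01 (t : R) : 0 <= cl t <= 1.
Proof. exact: clamp_itv. Qed.

Lemma I_bounds (s : I) : 0 <= set_val s <= 1.
Proof. by have := set_mem (valP s); rewrite /= in_itv. Qed.

Fact unit_clamp_subproof (t : R) : cl t \in I.
Proof. by rewrite inE /= in_itv /=; exact: cl01. Qed.
Definition unit_clamp (t : R) : I := exist _ (cl t) (unit_clamp_subproof t).

Lemma unit_clamp_continuous : continuous unit_clamp.
Proof. by apply: (@sub_set_continuous R R I) => t; exact: clamp_continuous. Qed.

Definition cyl i (x : A i) (s : I) : Y := \pi_Y (existT (fun i => (X i * I)%type) i (x, s)).

Lemma cylP (q : Y) : exists i x s, q = @cyl i x s.
Proof. by rewrite -(reprK q); case: (repr q) => i [x s]; exists i, x, s. Qed.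

Lemma cyl_glue i (x : A i) (s t : I) : set_val s = 1 -> set_val t = 0 ->
  cyl x s = cyl (Defs.incl (@AS i) x) t.
Proof.
move=> s1 t0; apply/eqmodP/asboolP; apply: rst_step.
by exists i, x, s, t.
Qed.

(** [repr] chooses an arbitrary representative; compatibility with the gluing makes the value of [F]
    there computable. Functions on the telescope are defined through [repr] and evaluated on
    cylinders by this lemma. *)
Lemma descend_repr (Z : Type) (F : C -> Z) :
  (forall i (x : A i) (s t : I), set_val s = 1 -> set_val t = 0 ->
    F (existT _ i (x, s)) = F (existT _ i.+1 (Defs.incl (@AS i) x, t))) ->
  forall i (x : A i) (s : I), F (repr (cyl x s)) = F (existT _ i (x, s)).
Proof.
move=> FG i x s.
have : tel_rel (fun i => Defs.incl (@AS i)) (repr (cyl x s)) (existT _ i (x, s)).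
  by have /eqmodP := reprK (cyl x s); exact.
move: (repr _) (existT _ _ _) => c c' /asboolP; elim=> {c c'}.
- by move=> c c' [j [y [u [v [u1 v0 -> ->]]]]]; exact: FG.
- by [].
- by move=> c c' _ ->.
- by move=> c c' e _ -> _ ->.
Qed.

Lemma tel_continuous (Z : topologicalType) (F : Y -> Z) :
  (forall i, continuous (fun xs : (A i * I)%type => F (cyl xs.1 xs.2))) -> continuous F.
Proof.
move=> cF; apply/quotient_continuous => -[i [x s]] P nP.
have nF : nbhs (x, s) (fun xs : (A i * I)%type => P (F (cyl xs.1 xs.2))) by exact: (cF i (x, s) P nP).
have E : (fun xs : (A i * I)%type => P (F (\pi_Y (existT _ i xs)))) = (fun xs => P (F (cyl xs.1 xs.2))).
  by apply/funext => -[].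
by rewrite -E in nF.
Qed.

Lemma cyl_continuous i : continuous (fun xs : (A i * I)%type => cyl xs.1 xs.2).
Proof.
have -> : (fun xs : (A i * I)%type => cyl xs.1 xs.2) =
    \pi_Y \o existT (fun i => (X i * I)%type) i by apply/funext => -[].
move=> xs; apply: continuous_comp; first exact: existT_continuous.
exact: pi_continuous.
Qed.

Definition height (q : Y) : R := let c := repr q in (projT1 c)%:R + set_val (projT2 c).2.

Lemma height_cyl i (x : A i) s : height (cyl x s) = i%:R + set_val s.
Proof.
apply: (descend_repr (F := fun c : C => (projT1 c)%:R + set_val (projT2 c).2)).
by move=> j y u v u1 v0 /=; rewrite u1 v0 addr0 -natr1.
Qed.

Lemma height_continuous : continuous height.
Proof.
apply: tel_continuous => i xs.
rewrite (_ : (fun _ => _) = (fun xs : (A i * I)%type => i%:R + set_val xs.2)); last first.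
  by apply/funext => ys; rewrite height_cyl.
apply: cvgD; first exact: cvg_cst.
by apply: (@continuous_comp _ _ _ (fun xs : (A i * I)%type => xs.2) (@set_val _ _));
  [exact: cvg_snd|exact: set_val_continuous].
Qed.

Lemma inclusion_cyl i (x : A i) s : p (cyl x s) = Defs.incl (@AB i) x.
Proof. by rewrite /tel_inclusion tel_descE// => j y; apply/val_inj. Qed.

Lemma inclusion_continuous : continuous p.
Proof.
apply: tel_continuous => i xs.
rewrite (_ : (fun _ => _) = (fun xs : (A i * I)%type => Defs.incl (@AB i) xs.1)); last first.
  by apply/funext => ys; rewrite inclusion_cyl.
by apply: (@continuous_comp _ _ _ (fun xs : (A i * I)%type => xs.1) (Defs.incl (@AB i)));
  [exact: cvg_fst|exact: incl_continuous].
Qed.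

(** Equal heights force either the same stage and parameter, or the top end of one stage and the
    bottom end of the next, which are glued. The maps between stages are inclusions, so the image
    determines the point of the stage. *)
Lemma tel_inj (q q' : Y) : p q = p q' -> height q = height q' -> q = q'.
Proof.
have [i [x [s ->]]] := cylP q; have [j [y [t ->]]] := cylP q'.
rewrite !inclusion_cyl !height_cyl => /(congr1 set_val) /= xy.
wlog ij : i j x y s t xy / (i <= j)%N.
  move=> H; have [ij|/ltnW ji] := leqP i j; first exact: H.
  by move=> /esym e; apply/esym; exact: H.
have /andP[s0 s1] := I_bounds s; have /andP[t0 t1] := I_bounds t.
move: ij; rewrite leq_eqVlt => /predU1P[e|ij].
  case: j / e y t xy t0 t1 => y t xy _ _ /addrI st.
  by congr cyl; exact/val_inj.
rewrite -(ler_nat R) -natr1 in ij => e.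
have e1 : set_val s = 1 by lra.
have e2 : set_val t = 0 by lra.
have ej : i.+1 = j by apply/eqP; rewrite -(eqr_nat R) -natr1; apply/eqP; lra.
case: j / ej y t xy e2 {ij e t0 t1} => y t xy e2.
rewrite (cyl_glue x e1 e2); congr cyl; exact/val_inj.
Qed.

Lemma A_le i k : (i <= k)%N -> A i `<=` A k.
Proof.
move=> /subnK <-; elim: (k - i)%N => [|m IH]; first exact: subset_refl.
by rewrite addSn; apply: subset_trans IH _; exact: AS.
Qed.

(** The segment over [x] at stage [i + m], parametrized by the height [w] above [i] and constant
    beyond both ends of that stage. *)
Definition rung i m (x : A i) (w : R) : Y :=
  cyl (Defs.incl (A_le (leq_addr m i)) x) (unit_clamp (w - m%:R)).

(** The ray over [x]: the rung is selected by the integral part of [w], which is [0] for negative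
    [w]. *)
Definition lev i (x : A i) (w : R) : Y := rung (Num.truncn w) x w.

Lemma inclusion_rung i m (x : A i) w : p (rung m x w) = Defs.incl (@AB i) x.
Proof. by rewrite inclusion_cyl; exact/val_inj. Qed.

Lemma height_rung i m (x : A i) w : height (rung m x w) = i%:R + (m%:R + cl (w - m%:R)).
Proof. by rewrite height_cyl natrD addrA. Qed.

Lemma height_lev i (x : A i) w : height (lev x w) = i%:R + Num.max 0 w.
Proof.
rewrite height_rung; congr (_ + _); have [w0|w0] := leP 0 w.
  have /andP[h1 h2] := truncn_itv w0; rewrite -natr1 in h2.
  by rewrite clamp_id; [rewrite addrC subrK|apply/andP; split; lra].
by rewrite truncn_lt0// subr0 add0r /clamp max_l// ge_min ltW.
Qed.

Lemma rung_lev i m (x : A i) (w : R) : m%:R <= Num.max 0 w <= m%:R + 1 -> rung m x w = lev x w.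
Proof.
move=> mw; apply: tel_inj; first by rewrite !inclusion_rung.
rewrite height_rung height_lev; congr (_ + _).
move: mw; have [w0|w0] := leP 0 w; move=> /andP[h1 h2].
  by rewrite clamp_id; [rewrite addrC subrK|apply/andP; split; lra].
have m0 : m%:R = 0 :> R by apply/eqP; rewrite eq_le h1 ler0n.
by rewrite m0 subr0 add0r /clamp max_l// ge_min ltW.
Qed.

Lemma rung_continuous i m : continuous (fun xw : (A i * R)%type => rung m xw.1 xw.2).
Proof.
move=> xw; pose h (xw : (A i * R)%type) := (Defs.incl (A_le (leq_addr m i)) xw.1, unit_clamp (xw.2 - m%:R)).
apply: (@continuous_comp _ _ _ h (fun xs : (A (i + m)%N * I)%type => cyl xs.1 xs.2)); last exact: cyl_continuous.
apply: pair_continuous.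
  by apply: (@continuous_comp _ _ _ (fun xw : (A i * R)%type => xw.1) (Defs.incl (A_le (leq_addr m i))));
    [exact: cvg_fst|exact: incl_continuous].
apply: (@continuous_comp _ _ _ (fun xw : (A i * R)%type => xw.2 - m%:R) unit_clamp); last exact: unit_clamp_continuous.
apply: cvgB; [exact: cvg_snd|exact: cvg_cst].
Qed.

(** Strictly between integers one rung computes [lev]. At a positive integer [m] the rungs [m.-1]
    and [m] take the same value, and a neighbourhood good for both is used. At [0] there is no lower
    rung, but [rung 0] is constant for negative [w]. *)
Lemma lev_continuous i : continuous (fun xw : (A i * R)%type => lev xw.1 xw.2).
Proof.
move=> [x0 w0] P /= nP.
have H m : m%:R <= Num.max 0 w0 <= m%:R + 1 ->
    \forall xw \near (x0, w0), P (rung m xw.1 xw.2).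
  by move=> /(rung_lev x0) E; apply: (@rung_continuous i m (x0, w0)); rewrite /= E.
have near2 (Q : R -> Prop) : (\forall w \near w0, Q w) -> \forall xw \near (x0, w0), Q xw.2.
  move=> nQ; exists (setT, Q); first by split; [exact: filterT|].
  by move=> xw [].
pose m := Num.truncn w0.
have mw : m%:R <= Num.max 0 w0 < m%:R + 1.
  rewrite natr1 /m; have [/truncn_itv //|w00] := leP 0 w0.
  by rewrite truncn_lt0// lexx ltr01.
have /andP[m1 m2] := mw.
have Hm := H m ltac:(by rewrite m1 ltW).
have lt1 : \forall xw \near (x0, w0), xw.2 < m%:R + 1.
  by apply: (near2 (fun w => w < m%:R + 1)); apply: lt_nbhsl; apply: le_lt_trans m2; rewrite le_max lexx orbT.
have lev_m (xw : (A i * R)%type) : P (rung m xw.1 xw.2) -> xw.2 < m%:R + 1 ->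
    m%:R <= Num.max 0 xw.2 -> P (lev xw.1 xw.2).
  move=> Pm lm ml; rewrite -(rung_lev (m := m)) ?ml//=; rewrite ge_max (ltW lm) andbT.
  exact: addr_ge0.
change (\forall xw \near (x0, w0), P (lev xw.1 xw.2)).
have [m0|m0] := posnP m.
  near=> xw; apply: lev_m; [near: xw; exact: Hm|near: xw; exact: lt1|].
  by rewrite m0 le_max lexx.
have mE : m%:R = m.-1%:R + 1 :> R by rewrite natr1 prednK.
have m0' : 0 < m%:R :> R by rewrite ltr0n.
have w0E : Num.max 0 w0 = w0.
  apply: max_r; rewrite leNgt; apply/negP => w00.
  have := lt_le_trans m0' m1; rewrite (max_l (ltW w00)).
  by rewrite ltxx.
rewrite w0E in m1 m2; move: m1; rewrite le_eqVlt => /predU1P[mw0|mw0]; last first.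
  have gt : \forall xw \near (x0, w0), m%:R < xw.2 by apply: (near2 (fun w => m%:R < w)); exact: lt_nbhsr.
  near=> xw; apply: lev_m; [near: xw; exact: Hm|near: xw; exact: lt1|].
  by rewrite le_max; apply/orP; right; apply: ltW; near: xw; exact: gt.
have Hm' : \forall xw \near (x0, w0), P (rung m.-1 xw.1 xw.2).
  by apply: H; rewrite w0E -mw0 -mE lexx andbT mE lerDl.
have gt : \forall xw \near (x0, w0), m.-1%:R < xw.2.
  by apply: (near2 (fun w => m.-1%:R < w)); apply: lt_nbhsr; rewrite -mw0 mE ltrDl.
near=> xw; have [le|lt] := leP m%:R xw.2.
  apply: lev_m; [near: xw; exact: Hm|near: xw; exact: lt1|].
  by rewrite le_max le orbT.
rewrite -(rung_lev (m := m.-1)); first by near: xw; exact: Hm'.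
have g0 : m.-1%:R < xw.2 by near: xw; exact: gt.
rewrite -mE max_r; first by rewrite !ltW.
by apply: ltW; apply: le_lt_trans g0; exact: ler0n.
Unshelve. all: by end_near. Qed.

(** The maximum makes [push] only raise: a target [u] below the present height leaves the point
    where it is. *)
Definition push (q : Y) (u : R) : Y :=
  let c := repr q in
  lev (projT2 c).1 (Num.max (set_val (projT2 c).2) (u - (projT1 c)%:R)).

Lemma push_cyl i (x : A i) s u : push (cyl x s) u = lev x (Num.max (set_val s) (u - i%:R)).
Proof.
apply: (descend_repr (F := fun c : C => lev (projT2 c).1 (Num.max (set_val (projT2 c).2) (u - (projT1 c)%:R)))).
move=> j y a b a1 b0 /=; apply: tel_inj.
  by rewrite !inclusion_rung; exact/val_inj.
rewrite !height_lev a1 b0 -natr1 -addrA; congr (_ + _).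
rewrite [in RHS]maxA maxxx addr_maxr addr0 (max_r (x := 0)); last by rewrite le_max ler01.
by congr Num.max; ring.
Qed.

Lemma inclusion_push q u : p (push q u) = p q.
Proof. by have [i [x [s ->]]] := cylP q; rewrite push_cyl inclusion_rung inclusion_cyl. Qed.

Lemma height_push q u : height (push q u) = Num.max (height q) u.
Proof.
have [i [x [s ->]]] := cylP q; have /andP[s0 _] := I_bounds s.
rewrite push_cyl height_lev height_cyl (max_r (x := 0)); last by rewrite le_max s0.
by rewrite addr_maxr addrCA subrr addr0.
Qed.

Lemma height_ge0 q : 0 <= height q.
Proof.
by have [i [x [s ->]]] := cylP q; have /andP[s0 _] := I_bounds s; rewrite height_cyl addr_ge0.
Qed.

Let push_cyl_continuous i : continuous (fun z : ((A i * I) * R)%type => push (cyl z.1.1 z.1.2) z.2).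
Proof.
move=> z0; rewrite (_ : (fun _ => _) =
  (fun z : ((A i * I) * R)%type => lev z.1.1 (Num.max (set_val z.1.2) (z.2 - i%:R)))); last first.
  by apply/funext => z; rewrite push_cyl.
pose h (z : ((A i * I) * R)%type) := (z.1.1, Num.max (set_val z.1.2) (z.2 - i%:R)).
apply: (@continuous_comp _ _ _ h (fun xw : (A i * R)%type => lev xw.1 xw.2)); last exact: lev_continuous.
apply: pair_continuous.
  by apply: (@continuous_comp _ _ _ (fun z : ((A i * I) * R)%type => z.1) fst); exact: cvg_fst.
apply: (@continuous_max R _ (fun z : ((A i * I) * R)%type => set_val z.1.2 : R^o) (fun z => z.2 - i%:R)).
  apply: (@continuous_comp _ _ _ (fun z : ((A i * I) * R)%type => z.1.2) (@set_val _ _)).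
    by apply: (@continuous_comp _ _ _ (fun z : ((A i * I) * R)%type => z.1) snd); [exact: cvg_fst|exact: cvg_snd].
  exact: set_val_continuous.
apply: cvgB; [exact: cvg_snd|exact: cvg_cst].
Qed.

(* The tube lemma for a compact interval of parameters makes [push] jointly
   continuous, although products do not commute with quotients in general. *)
Lemma push_continuous : continuous (fun qu : (Y * R)%type => push qu.1 qu.2).
Proof.
move=> [q0 u0] P /= nP; pose Q := P^°%classic.
have oQ : open Q by exact: open_interior.
have Qq : Q (push q0 u0) by exact: nP.
have QP : Q `<=` P by exact: interior_subset.
have cu q : continuous (push q).
  have [i [x [s ->]]] := cylP q => u.
  apply: (@continuous_comp _ _ _ (fun u : R => ((x, s), u)) (fun z => push (cyl z.1.1 z.1.2) z.2)).
    by apply: pair_continuous; [exact: cvg_cst|exact: cvg_id].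
  exact: push_cyl_continuous.
have /nbhs_ballP[e /= e0 He] : \forall u \near u0, Q (push q0 u) by apply: cu; exact: open_nbhs_nbhs.
pose U := `[u0 - e / 2, u0 + e / 2]%classic : set R.
pose W : set Y := [set q | forall u, U u -> Q (push q u)].
have oW : open W.
  apply/sigT_openP => i; rewrite openE => -[x s] Wxs.
  have /compact_near_coveringP cU : compact U by exact: segment_compact.
  suff : \forall xs \near (x, s), forall u, U u -> Q (push (cyl xs.1 xs.2) u).
    by apply: (@filterS (A i * I)%type) => -[].
  apply: (cU (A i * I)%type (nbhs (x, s)) (fun xs u => Q (push (cyl xs.1 xs.2) u))) => u Uu.
  have nQ : nbhs ((x, s), u) (fun z : ((A i * I) * R)%type => Q (push (cyl z.1.1 z.1.2) z.2)).
    by apply: push_cyl_continuous; apply: open_nbhs_nbhs; split; [|exact: Wxs].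
  case: nQ => [[N1 N2] [/= h1 h2] h]; exists (N2, N1) => //.
  move=> [v xs] [/= Nv Nxs]; exact: (h (xs, v) (conj Nxs Nv)).
have Uu0 : U u0 by rewrite /U /= in_itv /=; apply/andP; split; lra.
have Wq : W q0.
  move=> u; rewrite /U /= in_itv /= => /andP[h1 h2]; apply: He.
  by rewrite /ball /= ltr_norml; apply/andP; split; lra.
exists (W, [set u | `|u0 - u| < e / 2]).
  split; first by apply: open_nbhs_nbhs.
  by apply/nbhs_ballP; exists (e / 2) => /=; [exact: divr_gt0|].
move=> [q u] [/= Wq' hu]; apply: QP; apply: Wq'.
by move: hu; rewrite /U /= in_itv /= ltr_norml => /andP[h1 h2]; apply/andP; split; lra.
Qed.

End Telescope.

(** * Pasting, paths and homotopies of cubes *)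

Lemma paste_continuous (R : realType) (Z X : topologicalType) (tau : Z -> R) (k : R) (f h : Z -> X) :
  continuous tau -> continuous f -> continuous h -> (forall z, tau z = k -> f z = h z) ->
  continuous (fun z => if tau z <= k then f z else h z).
Proof.
move=> ct cf ch fh z P nP.
change (\forall y \near z, P (if tau y <= k then f y else h y)).
move: nP => /=; case: (ltgtP (tau z) k) => [lt|gt|eq] nP.
- have nt : \forall y \near z, tau y < k by exact: (ct z (fun r => r < k) (lt_nbhsl lt)).
  have nf : \forall y \near z, P (f y) by exact: cf.
  by near=> y; rewrite /= ifT; [near: y|apply: ltW; near: y].
- have nt : \forall y \near z, k < tau y by exact: (ct z (fun r => k < r) (lt_nbhsr gt)).
  have nh : \forall y \near z, P (h y) by exact: ch.
  by near=> y; rewrite /= ifF; [near: y|apply/negbTE; rewrite -ltNge; near: y].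
- have nf : \forall y \near z, P (f y) by exact: cf.
  have nh : \forall y \near z, P (h y) by apply: ch; rewrite -fh.
  by near=> y; rewrite /=; case: ifP => _; near: y.
Unshelve. all: by end_near. Qed.

Lemma continuous_comp_within (Z X Y : topologicalType) (S : set X) (f : X -> Y) (r : Z -> X) :
  {within S, continuous f} -> continuous r -> (forall z, S (r z)) -> continuous (f \o r).
Proof.
move=> /subspace_continuousP cf cr Sr z P /(cf (r z) (Sr z)) nP.
have nQ : \forall y \near r z, S y -> P (f y) by exact: nP.
have nR : \forall y \near z, S (r y) -> P (f (r y)) by exact: (cr z _ nQ).
change (\forall y \near z, P (f (r y))).
by apply: filterS nR => y; apply; exact: Sr.
Qed.

Section Paths.
Variables (R : realType) (X : topologicalType).
Implicit Types x y z : X.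

Lemma joinedP x y : joined R x y <-> exists2 q : R -> X, continuous q & q 0 = x /\ q 1 = y.
Proof.
split=> [[q [cq q0 q1]]|[q cq [q0 q1]]]; last first.
  by exists q; split=> //; exact: continuous_subspaceT.
exists (q \o clamp 0 1) => /=; last by rewrite !clamp_id ?lexx ?ler01.
apply: (continuous_comp_within cq); first exact: clamp_continuous.
by move=> t; rewrite /= in_itv /= clamp_itv.
Qed.

Lemma joined_sym x y : joined R x y -> joined R y x.
Proof.
move=> /joinedP[q cq [q0 q1]]; apply/joinedP.
exists (fun t => q (1 - t)); last by rewrite subr0 subrr.
move=> t; apply: (@continuous_comp _ _ _ (fun t : R => 1 - t) q); last exact: cq.
by apply: cvgB; [exact: cvg_cst|exact: cvg_id].
Qed.

Lemma affine_continuous (a b : R) : continuous (fun t : R => a * t + b).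
Proof. by move=> t; apply: cvgD; [apply: cvgMr; exact: cvg_id|exact: cvg_cst]. Qed.

Lemma joined_trans x y z : joined R x y -> joined R y z -> joined R x z.
Proof.
move=> /joinedP[q cq [q0 q1]] /joinedP[q' cq' [q0' q1']]; apply/joinedP.
exists (fun t => if t <= 2^-1 then q (2 * t + 0) else q' (2 * t + (-1))).
  apply: (paste_continuous (tau := id)).
  - by move=> t; exact: cvg_id.
  - by move=> t; apply: (@continuous_comp _ _ _ (fun t : R => 2 * t + 0) q); [exact: affine_continuous|exact: cq].
  - by move=> t; apply: (@continuous_comp _ _ _ (fun t : R => 2 * t + (-1)) q'); [exact: affine_continuous|exact: cq'].
  by move=> t ->; rewrite mulfV ?pnatr_eq0// addr0 subrr q1 q0'.
rewrite ifT ?invr_ge0// mulr0 addr0 ifF; first by rewrite mulr1 -[2]natr1 addrK.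
by apply/negbTE; rewrite -ltNge invf_lt1// ltr1n.
Qed.

Variable n : nat.
Implicit Types a b c : 'rV[R]_n -> X.

(** Expansion about the centre of the cube by the factor [1 + t], followed by the retraction onto
    the cube. [zoom 0] is that retraction, and [zoom 1] stretches the inner cube over the whole cube
    and sends the collar to the boundary. *)
Definition zoom (t : R) (s : 'rV[R]_n) : 'rV[R]_n :=
  \row_i clamp 0 1 (2^-1 + (1 + t) * (s 0 i - 2^-1)).

Lemma cube_zoom t s : cube (zoom t s).
Proof. by move=> i; rewrite mxE clamp_itv. Qed.

Lemma zoom0 s : cube s -> zoom 0 s = s.
Proof.
by move=> cs; apply/rowP => i; rewrite mxE addr0 mul1r addrC subrK clamp_id//.
Qed.

Lemma zoom_boundary t s : 0 <= t -> cube_boundary s -> cube_boundary (zoom t s).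
Proof.
move=> t0 [_ [i si]]; split; first exact: cube_zoom.
exists i; rewrite mxE /clamp; case: si => ->; [left|right].
  by rewrite max_l// ge_min; apply/orP; left; lra.
by rewrite min_r ?max_r//; lra.
Qed.

Lemma zoom_continuous : continuous (fun ts : R * 'rV[R]_n => zoom ts.1 ts.2).
Proof.
move=> ts; apply/(mx_continuousP (fun ts : R * 'rV[R]_n => zoom ts.1 ts.2)) => i j.
rewrite (_ : (fun _ => _) = (fun ts : R * 'rV[R]_n =>
  clamp 0 1 (2^-1 + (1 + ts.1) * (ts.2 0 j - 2^-1)))); last first.
  by apply/funext => us; rewrite mxE.
apply: (@continuous_comp _ _ _ (fun ts : R * 'rV[R]_n => 2^-1 + (1 + ts.1) * (ts.2 0 j - 2^-1)));
  last exact: clamp_continuous.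
apply: cvgD; first exact: cvg_cst.
apply: cvgM; first by apply: cvgD; [exact: cvg_cst|exact: cvg_fst].
apply: cvgB; last exact: cvg_cst.
apply: (@continuous_comp _ _ _ snd (fun s : 'rV[R]_n => s 0 j)); first exact: cvg_snd.
exact: coord_continuous.
Qed.

Lemma zoom_continuousr t : continuous (zoom t).
Proof.
move=> s; apply: (@continuous_comp _ _ _ (fun s : 'rV[R]_n => (t, s)) (fun ts : R * 'rV[R]_n => zoom ts.1 ts.2)).
  apply: (@pair_continuous _ _ _ (fun=> t) id); [exact: cst_continuous|exact: cvg_id].
exact: zoom_continuous.
Qed.

(** Sup-norm distance from the centre, so it grows outwards: the cube reaches to [1 / 2], and the
    inner cube that [zoom 1] stretches reaches to [1 / 4]. *)
Definition depth (s : 'rV[R]_n) : R := `|s - const_mx 2^-1|.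

Lemma depth_continuous : continuous depth.
Proof.
move=> s; apply: (@continuous_comp _ _ _ (fun s : 'rV[R]_n => s - const_mx 2^-1) (fun v : 'rV[R]_n => `|v| : R)).
  have c := @cst_continuous 'rV[R]_n 'rV[R]_n (const_mx 2^-1) s.
  exact: (cvgB (@cvg_id _ (nbhs s)) c).
exact: norm_continuous.
Qed.

Lemma depth_boundary s : cube_boundary s -> 2^-1 <= depth s.
Proof.
move=> [_ [i si]]; apply: le_trans (ler_mx_entry _ 0 i); rewrite !mxE.
case: si => ->; first by rewrite sub0r normrN ger0_norm// invr_ge0.
by rewrite ger0_norm; lra.
Qed.

Lemma zoom_outer s : 4^-1 <= depth s -> cube_boundary (zoom 1 s).
Proof.
move=> sd; split; first exact: cube_zoom.
have [i si] : exists i, 4^-1 <= `|s 0 i - 2^-1|.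
  apply: contrapT => /forallNP H.
  suff : depth s < 4^-1 by rewrite ltNge sd.
  rewrite /depth distrC.
  have : ball (const_mx 2^-1 : 'rV[R]_n) 4^-1 s.
    split; first by rewrite invr_gt0.
    move=> i j; rewrite mxE /ball /= (ord1 i) distrC ltNge; apply/negP; exact: H.
  by rewrite -ball_normE.
exists i; rewrite mxE /clamp; move: si; rewrite ler_normr => /orP[h|h]; [right|left].
  by rewrite min_r ?max_r//; lra.
by rewrite max_l// ge_min; apply/orP; left; lra.
Qed.

Definition based_homotopy x a b := exists H : R * 'rV[R]_n -> X,
  [/\ continuous H, (forall s, cube s -> H (0, s) = a s /\ H (1, s) = b s) &
      forall t s, 0 <= t <= 1 -> cube_boundary s -> H (t, s) = x].

(** Precomposition with the retraction onto the product of the unit interval and the cube trades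
    continuity within that set for continuity everywhere, so pasting and composing involve no
    subspaces. *)
Lemma homotopicP x a b : homotopic x a b <-> based_homotopy x a b.
Proof.
split=> -[H [cH He Hb]]; last by exists H; split=> //; exact: continuous_subspaceT.
pose r (ts : R * 'rV[R]_n) := (clamp 0 1 ts.1, zoom 0 ts.2).
have cr : continuous r.
  move=> ts; apply: (@pair_continuous _ _ _ (fun ts : R * 'rV[R]_n => clamp 0 1 ts.1) (fun ts => zoom 0 ts.2)).
    by apply: (@continuous_comp _ _ _ fst); [exact: cvg_fst|exact: clamp_continuous].
  by apply: (@continuous_comp _ _ _ snd); [exact: cvg_snd|exact: zoom_continuousr].
exists (H \o r); split.
- apply: (continuous_comp_within cH cr) => ts; split; last exact: cube_zoom.
  by rewrite /= in_itv /= clamp_itv.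
- by move=> s cs; rewrite /r /= zoom0// !clamp_id ?lexx ?ler01//; exact: He.
- move=> t s t01 bs; rewrite /r /= zoom0 ?clamp_id//; first exact: Hb.
  by case: bs.
Qed.

Lemma homotopic_sym x a b : homotopic x a b -> homotopic x b a.
Proof.
move=> /homotopicP[H [cH He Hb]]; apply/homotopicP.
exists (fun ts => H (1 - ts.1, ts.2)); split.
- move=> ts; apply: (@continuous_comp _ _ _ (fun ts : R * 'rV[R]_n => (1 - ts.1, ts.2)) H); last exact: cH.
  apply: (@pair_continuous _ _ _ (fun ts : R * 'rV[R]_n => 1 - ts.1) snd); last exact: cvg_snd.
  by apply: cvgB; [exact: cvg_cst|exact: cvg_fst].
- by move=> s cs /=; rewrite subr0 subrr; have [] := He s cs.
- by move=> t s /andP[t0 t1] bs; apply: Hb => //; apply/andP; split=> /=; lra.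
Qed.

Lemma homotopic_trans x a b c : homotopic x a b -> homotopic x b c -> homotopic x a c.
Proof.
move=> /homotopicP[H [cH He Hb]] /homotopicP[K [cK Ke Kb]]; apply/homotopicP.
(* Both halves are evaluated inside the cube, where they agree at time [2^-1]. *)
pose r (d : R) (ts : R * 'rV[R]_n) := (2 * ts.1 + d, zoom 0 ts.2).
have cr d : continuous (r d).
  move=> ts; apply: (@pair_continuous _ _ _ (fun ts : R * 'rV[R]_n => 2 * ts.1 + d) (fun ts => zoom 0 ts.2)).
    by apply: cvgD; [apply: cvgMr; exact: cvg_fst|exact: cvg_cst].
  by apply: (@continuous_comp _ _ _ snd); [exact: cvg_snd|exact: zoom_continuousr].
exists (fun ts => if ts.1 <= 2^-1 then H (r 0 ts) else K (r (-1) ts)); split.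
- apply: (paste_continuous (tau := fst)).
  + by move=> ts; exact: cvg_fst.
  + by move=> ts; apply: (@continuous_comp _ _ _ (r 0) H); [exact: cr|exact: cH].
  + by move=> ts; apply: (@continuous_comp _ _ _ (r (-1)) K); [exact: cr|exact: cK].
  move=> ts t2; rewrite /r t2 mulfV ?pnatr_eq0// addr0 subrr.
  by have [_ ->] := He _ (cube_zoom 0 ts.2); have [-> _] := Ke _ (cube_zoom 0 ts.2).
- move=> s cs; rewrite /r /= zoom0// ifT ?invr_ge0// mulr0 addr0 ifF.
    by rewrite mulr1 -[2]natr1 addrK; have [-> _] := He s cs; have [_ ->] := Ke s cs.
  by apply/negbTE; rewrite -ltNge invf_lt1// ltr1n.
- move=> t s /andP[t0 t1] bs; have [cs _] := bs; rewrite /r /= zoom0//.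
  by case: ifPn => [th|]; [apply: Hb|rewrite -ltNge => th; apply: Kb] => //; apply/andP; split; lra.
Qed.

Lemma homotopic_eq x a a' b b' : (forall s, cube s -> a s = a' s) ->
  (forall s, cube s -> b s = b' s) -> homotopic x a b -> homotopic x a' b'.
Proof.
move=> aa bb [H [cH He Hb]]; exists H; split=> // s cs.
by have [h1 h2] := He s cs; rewrite -aa// -bb.
Qed.

End Paths.

(** * Lifting compact families to the telescope *)

Section WeakEquivalence.
Variables (R : realType) (T : topologicalType) (A : nat -> set T) (B : set T).
Variables (AS : forall i, A i `<=` A i.+1) (AB : forall i, A i `<=` B).
Local Notation Y := (Defs.telescope R (fun i => Defs.incl (@AS i))).
Local Notation p := (tel_inclusion R AS AB).
Local Notation height := (@height R T A AS).
Local Notation push := (@push R T A AS).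

Hypothesis exhaust : forall C : set T, compact C -> C `<=` B -> \forall N \near \oo, C `<=` A N.

Lemma image_near_level (Z : topologicalType) (S : set Z) (f : Z -> B) : compact S -> continuous f ->
  \forall N \near \oo, forall z, S z -> A N (set_val (f z)).
Proof.
move=> cS cf.
have cI : compact ((fun z => set_val (f z)) @` S).
  apply: continuous_compact => //; apply: continuous_subspaceT => z.
  by apply: continuous_comp; [exact: cf|exact: set_val_continuous].
have IB : ((fun z => set_val (f z)) @` S) `<=` B by move=> _ [z _ <-]; exact: (set_mem (valP (f z))).
by apply: filterS (exhaust cI IB) => N H z Sz; apply: H; exists z.
Qed.

Lemma height_near_le (Z : topologicalType) (S : set Z) (a : Z -> Y) : compact S -> continuous a ->
  \forall N \near \oo, forall z, S z -> height (a z) <= N%:R.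
Proof.
move=> cS ca; have [K K0 HK] := compact_bound (g := height \o a) cS
  (fun z _ => continuous_comp (ca z) (@height_continuous _ _ _ _ _)).
have nK : \forall N \near \oo, K <= N%:R by exact: nbhs_infty_ger.
by apply: filterS nK => N NK z Sz; apply: le_trans NK; apply: le_trans (ler_norm _) (HK z Sz).
Qed.

Lemma inclusion_lev i (x : A i) (w : R) : p (lev AS x w) = Defs.incl (@AB i) x.
Proof. by rewrite inclusion_rung. Qed.

Definition to_level (Z : Type) N (f : Z -> B) (H : forall z, A N (set_val (f z))) (z : Z) : A N :=
  exist _ (set_val (f z)) (mem_set (H z)).

Lemma to_level_continuous (Z : topologicalType) N (f : Z -> B) (H : forall z, A N (set_val (f z))) :
  continuous f -> continuous (to_level H).
Proof.
move=> cf; apply: (@sub_set_continuous Z T (A N) (to_level H)) => z.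
by apply: (continuous_comp (cf z)); exact: set_val_continuous.
Qed.

Lemma incl_to_level (Z : Type) N (f : Z -> B) (H : forall z, A N (set_val (f z))) z :
  Defs.incl (@AB N) (to_level H z) = f z.
Proof. exact/val_inj. Qed.

Lemma level_continuous (Z : topologicalType) N (f : Z -> A N) :
  continuous f -> continuous (fun z => lev AS (f z) (0 : R)).
Proof.
move=> cf z; apply: (@continuous_comp _ _ _ (fun z => (f z, 0 : R)) (fun xw : (A N * R)%type => lev AS xw.1 xw.2)).
  by apply: (@pair_continuous _ _ _ f (fun=> 0 : R)); [exact: cf|exact: cst_continuous].
exact: lev_continuous.
Qed.

Lemma height_level N (x : A N) : height (lev AS x 0) = N%:R.
Proof. by rewrite height_lev maxxx addr0. Qed.

Lemma push_comp_continuous (Z : topologicalType) (a : Z -> Y) (u : Z -> R) :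
  continuous a -> continuous u -> continuous (fun z => push (a z) (u z)).
Proof.
move=> ca cu z; apply: (@continuous_comp _ _ _ (fun z => (a z, u z)) (fun qu : (Y * R)%type => push qu.1 qu.2)).
  by apply: (@pair_continuous _ _ _ a u); [exact: ca|exact: cu].
exact: push_continuous.
Qed.

Lemma push0 x : push x 0 = x.
Proof.
apply: (tel_inj (AB := AB)); first exact: inclusion_push.
by rewrite (height_push AB) max_l// height_ge0.
Qed.

(** The path raises [x] vertically; its end has the image and the height of the point at level [N],
    and [tel_inj] identifies the two. *)
Lemma joined_level N (x : Y) (y : A N) : height x <= N%:R -> set_val y = set_val (p x) ->
  joined R x (lev AS y 0).
Proof.
move=> hx yx; apply/joinedP; exists (fun t => push x (N%:R * t)).
  apply: push_comp_continuous; first exact: cst_continuous.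
  by move=> t; apply: cvgMr; exact: cvg_id.
rewrite mulr0 push0; split=> //; apply: (tel_inj (AB := AB)).
  by rewrite inclusion_push inclusion_lev; exact/val_inj.
by rewrite (height_push AB) height_level mulr1 max_r.
Qed.

Lemma joined_tel x x' : joined R (p x) (p x') -> joined R x x'.
Proof.
move=> /joinedP[q cq [q0 q1]].
have cI : compact (`[0, 1]%classic : set R) by exact: segment_compact.
near \oo => N.
have hx : height x <= N%:R by near: N; exact: nbhs_infty_ger.
have hx' : height x' <= N%:R by near: N; exact: nbhs_infty_ger.
have HN : forall t, (`[0, 1]%classic : set R) t -> A N (set_val (q t)).
  by near: N; exact: image_near_level.
pose q' := q \o clamp (0 : R) 1.
have cq' : continuous q'.
  by move=> t; apply: continuous_comp; [exact: clamp_continuous|exact: cq].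
have H t : A N (set_val (q' t)) by apply: HN; rewrite /= in_itv /= clamp_itv.
have q'0 : q' 0 = p x by rewrite /q' /= clamp_id ?lexx ?ler01.
have q'1 : q' 1 = p x' by rewrite /q' /= clamp_id ?lexx ?ler01.
apply: joined_trans (joined_level (y := to_level H 0) hx _) _; first by rewrite -q'0.
apply: joined_trans (joined_sym (joined_level (y := to_level H 1) hx' _)); last by rewrite -q'1.
apply/joinedP; exists (fun t => lev AS (to_level H t) 0) => //.
exact: (level_continuous (to_level_continuous cq')).
Unshelve. all: by end_near. Qed.

Section Spheroids.
Variables (n : nat) (x : Y) (N : nat).
Hypothesis hx : height x <= N%:R.

(** Cut-off equal to [1] on the inner cube and to [0] on the boundary; [N%:R * lam] is the height to
    which [x] is pushed over the collar. *)
Let lam (s : 'rV[R]_n) : R := clamp 0 1 (- 4 * depth s + 2).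

Let lam_continuous : continuous lam.
Proof.
move=> s; apply: (@continuous_comp _ _ _ (fun s => - 4 * depth s + 2) (clamp 0 1)); last exact: clamp_continuous.
apply: (@continuous_comp _ _ _ (@depth R n) (fun t => - 4 * t + 2)); first exact: depth_continuous.
exact: affine_continuous.
Qed.

Let lam_boundary s : cube_boundary s -> lam s = 0.
Proof.
move=> /depth_boundary ds; rewrite /lam /clamp max_l// ge_min; apply/orP; left.
by lra.
Qed.

Let lam_inner s : depth s <= 4^-1 -> lam s = 1.
Proof. by move=> ds; rewrite /lam /clamp min_r ?max_r//; lra. Qed.

(* On the inner cube the family [f], rescaled by [zoom 1], is lifted at height
   [N]; the collar joins its boundary value to [x]. *)
Definition lift_family (f : R * 'rV[R]_n -> A N) (ts : R * 'rV[R]_n) : Y :=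
  if depth ts.2 <= 4^-1 then lev AS (f (ts.1, zoom 1 ts.2)) 0 else push x (N%:R * lam ts.2).

Variable f : R * 'rV[R]_n -> A N.
Hypothesis cf : continuous f.
Hypothesis fx : forall t s, cube_boundary s -> set_val (f (t, s)) = set_val (p x).

Lemma lift_family_continuous : continuous (lift_family f).
Proof.
apply: (paste_continuous (tau := fun ts : R * 'rV[R]_n => depth ts.2)).
- by move=> ts; apply: (@continuous_comp _ _ _ snd); [exact: cvg_snd|exact: depth_continuous].
- apply: (level_continuous (f := fun ts : R * 'rV[R]_n => f (ts.1, zoom 1 ts.2))) => ts.
  apply: (@continuous_comp _ _ _ (fun ts : R * 'rV[R]_n => (ts.1, zoom 1 ts.2)) f); last exact: cf.
  apply: (@pair_continuous _ _ _ fst (fun ts : R * 'rV[R]_n => zoom 1 ts.2)); first exact: cvg_fst.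
  by apply: (@continuous_comp _ _ _ snd); [exact: cvg_snd|exact: zoom_continuousr].
- apply: push_comp_continuous; first exact: cst_continuous.
  move=> ts; apply: cvgMr.
  by apply: (@continuous_comp _ _ _ snd); [exact: cvg_snd|exact: lam_continuous].
move=> [t s] /= ds; apply: (tel_inj (AB := AB)).
  rewrite inclusion_push inclusion_lev; apply/val_inj => /=.
  by apply: fx; apply: zoom_outer; rewrite ds.
by rewrite height_level (height_push AB) lam_inner ?ds// mulr1 max_r.
Qed.

Lemma lift_family_boundary t s : cube_boundary s -> lift_family f (t, s) = x.
Proof.
move=> bs; rewrite /lift_family ifF; first by rewrite lam_boundary// mulr0 push0.
by have /= := depth_boundary bs; move=> ds; apply/negbTE; rewrite -ltNge; lra.
Qed.

Lemma inclusion_lift_family t s : p (lift_family f (t, s)) = Defs.incl (@AB N) (f (t, zoom 1 s)).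
Proof.
rewrite /lift_family /=; case: ifPn => [_|]; first by rewrite inclusion_lev.
rewrite -ltNge => /ltW ds; rewrite inclusion_push; apply/val_inj => /=.
by rewrite fx//; exact: zoom_outer.
Qed.

(** At time [u] the map [a] is zoomed by [u] and pushed up to height [u * (N * lam)]. At time [1]
    image and height agree with those of the lift: on the inner cube at level [N], on the collar
    because [a \o zoom 1] is [x] there. On the boundary [lam] vanishes and [zoom] stays on the
    boundary, so the base point is fixed. *)
Lemma homotopic_lift (a : 'rV[R]_n -> Y) t : continuous a -> (forall s, cube_boundary s -> a s = x) ->
  (forall s, cube s -> height (a s) <= N%:R) ->
  (forall s, cube s -> set_val (f (t, s)) = set_val (p (a s))) ->
  homotopic x a (fun s => lift_family f (t, s)).
Proof.
move=> ca ax ha fa; apply/homotopicP.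
exists (fun us => push (a (zoom us.1 us.2)) (us.1 * (N%:R * lam us.2))); split.
- apply: push_comp_continuous => us.
    by apply: (@continuous_comp _ _ _ (fun us : R * 'rV[R]_n => zoom us.1 us.2) a); [exact: zoom_continuous|exact: ca].
  apply: cvgM; first exact: cvg_fst.
  apply: cvgMr.
  by apply: (@continuous_comp _ _ _ snd); [exact: cvg_snd|exact: lam_continuous].
- move=> s cs /=; rewrite mul0r push0 zoom0//; split=> //.
  apply: (tel_inj (AB := AB)).
    rewrite inclusion_push inclusion_lift_family; apply/val_inj => /=.
    by rewrite fa//; exact: cube_zoom.
  rewrite mul1r (height_push AB) /lift_family /=; case: ifPn => [ds|].
    by rewrite lam_inner// mulr1 height_level max_r//; apply: ha; exact: cube_zoom.
  by rewrite -ltNge => /ltW ds; rewrite (height_push AB) ax//; exact: zoom_outer.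
- move=> u s /andP[u0 u1] bs /=.
  by rewrite lam_boundary// !mulr0 push0 ax//; exact: zoom_boundary.
Qed.

End Spheroids.

Lemma compact_cube n : compact (@cube R n).
Proof.
rewrite (_ : @cube R n = [set s | `|s - const_mx 2^-1| <= 2^-1]); first exact: compact_box.
apply/seteqP; split=> s.
  move=> cs; apply: mx_norm_le => [|i j]; first by rewrite invr_ge0.
  by have /andP[s0 s1] := cs j; rewrite !mxE (ord1 i) ler_norml; apply/andP; split; lra.
move=> H i; have := le_trans (ler_mx_entry _ 0 i) H; rewrite !mxE ler_norml => /andP[h1 h2].
by apply/andP; split; lra.
Qed.

Lemma spheroid_extend (X : topologicalType) (z : X) n (a : 'rV[R]_n -> X) : spheroid z a ->
  [/\ continuous (a \o zoom 0), (forall s, cube s -> (a \o zoom 0) s = a s) &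
      forall s, cube_boundary s -> (a \o zoom 0) s = z].
Proof.
move=> [ca az]; split.
- exact: (continuous_comp_within ca (@zoom_continuousr R n 0) (cube_zoom 0)).
- by move=> s cs; rewrite /= zoom0.
- by move=> s bs; have [cs _] := bs; rewrite /= zoom0//; exact: az.
Qed.

(** The homotopy lifted at one level [N] joins the lifts of its two ends, and [homotopic_lift] links
    these to [a] and [b]. *)
Lemma homotopic_tel n x (a b : 'rV[R]_n -> Y) : spheroid x a -> spheroid x b ->
  homotopic (p x) (p \o a) (p \o b) -> homotopic x a b.
Proof.
move=> /spheroid_extend[ca aa ax] /spheroid_extend[cb bb bx] /homotopicP[H [cH He Hb]].
pose r (ts : R * 'rV[R]_n) := (clamp 0 1 ts.1, zoom 0 ts.2).
have cr : continuous r.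
  move=> ts; apply: (@pair_continuous _ _ _ (fun ts : R * 'rV[R]_n => clamp 0 1 ts.1) (fun ts => zoom 0 ts.2)).
    by apply: (@continuous_comp _ _ _ fst); [exact: cvg_fst|exact: clamp_continuous].
  by apply: (@continuous_comp _ _ _ snd); [exact: cvg_snd|exact: zoom_continuousr].
pose Q : set (R * 'rV[R]_n)%type := `[0, 1]%classic `*` @cube R n.
have cQ : compact Q.
  by apply: compact_setX; [exact: segment_compact|exact: compact_cube].
near \oo => N.
have hx : height x <= N%:R by near: N; exact: nbhs_infty_ger.
have ha : forall s, cube s -> height ((a \o zoom 0) s) <= N%:R.
  by near: N; exact: height_near_le (@compact_cube n) ca.
have hb : forall s, cube s -> height ((b \o zoom 0) s) <= N%:R.
  by near: N; exact: height_near_le (@compact_cube n) cb.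
have HN : forall ts, Q ts -> A N (set_val (H ts)).
  by near: N; exact: image_near_level.
have cHr : continuous (H \o r).
  by move=> ts; apply: continuous_comp; [exact: cr|exact: cH].
have HNr ts : A N (set_val ((H \o r) ts)).
  apply: HN; split; last exact: cube_zoom.
  by rewrite /= in_itv /= clamp_itv.
have cf := to_level_continuous (H := HNr) cHr.
have fx t s : cube_boundary s -> set_val (to_level HNr (t, s)) = set_val (p x).
  move=> bs; change (set_val (H (clamp 0 1 t, zoom 0 s)) = set_val (p x)).
  rewrite zoom0; last by case: bs.
  by congr set_val; apply: Hb => //; rewrite clamp_itv.
have Ha := homotopic_lift fx (t := 0) ca ax ha.
have Hb' := homotopic_lift fx (t := 1) cb bx hb.
apply: (homotopic_eq (a := a \o zoom 0) (b := b \o zoom 0)) => //.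
apply: homotopic_trans (Ha _) _.
  move=> s cs; change (set_val (H (clamp 0 1 0, zoom 0 s)) = set_val (p (a (zoom 0 s)))).
  rewrite zoom0// clamp_id ?lexx ?ler01//; by have [-> _] := He s cs.
apply: homotopic_trans (homotopic_sym (Hb' _)); last first.
  move=> s cs; change (set_val (H (clamp 0 1 1, zoom 0 s)) = set_val (p (b (zoom 0 s)))).
  rewrite zoom0// clamp_id ?lexx ?ler01//; by have [_ ->] := He s cs.
apply/homotopicP; exists (lift_family x (to_level HNr)); split=> //.
  exact: lift_family_continuous.
by move=> t s _; exact: lift_family_boundary.
Unshelve. all: by end_near. Qed.

(** The lift at level [N] projects to [b] rescaled by [zoom 1]; running the zoom back to [0] is the
    required homotopy. *)
Lemma spheroid_lift n x (b : 'rV[R]_n -> B) : spheroid (p x) b ->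
  exists2 a, spheroid x a & homotopic (p x) (p \o a) b.
Proof.
move=> /spheroid_extend[cb bb bx].
near \oo => N.
have hx : height x <= N%:R by near: N; exact: nbhs_infty_ger.
have HN : forall s, cube s -> A N (set_val ((b \o zoom 0) s)).
  by near: N; exact: image_near_level (@compact_cube n) cb.
have HNr (ts : R * 'rV[R]_n) : A N (set_val ((b \o zoom 0 \o snd) ts)).
  by rewrite /= -[zoom 0 _]zoom0; [apply: HN|]; exact: cube_zoom.
have cf : continuous (to_level HNr).
  apply: to_level_continuous => ts.
  by apply: (@continuous_comp _ _ _ snd (b \o zoom 0)); [exact: cvg_snd|exact: cb].
have fx t s : cube_boundary s -> set_val (to_level HNr (t, s)) = set_val (p x).
  by move=> bs; rewrite /= -(bx s bs).
exists (fun s => lift_family x (to_level HNr) (0, s)).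
  split; last by move=> s; exact: lift_family_boundary.
  apply: continuous_subspaceT => s.
  apply: (@continuous_comp _ _ _ (fun s : 'rV[R]_n => (0 : R, s)) (lift_family x (to_level HNr))).
    by apply: (@pair_continuous _ _ _ (fun=> 0 : R) id); [exact: cst_continuous|exact: cvg_id].
  exact: lift_family_continuous.
apply/homotopicP; exists (fun ts => (b \o zoom 0) (zoom (1 - ts.1) ts.2)); split.
- move=> ts; apply: (@continuous_comp _ _ _ (fun ts : R * 'rV[R]_n => zoom (1 - ts.1) ts.2) (b \o zoom 0)); last exact: cb.
  apply: (@continuous_comp _ _ _ (fun ts : R * 'rV[R]_n => (1 - ts.1, ts.2)) (fun ts : R * 'rV[R]_n => zoom ts.1 ts.2)); last exact: zoom_continuous.
  apply: (@pair_continuous _ _ _ (fun ts : R * 'rV[R]_n => 1 - ts.1) snd); last exact: cvg_snd.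
  by apply: cvgB; [exact: cvg_cst|exact: cvg_fst].
- move=> s cs; rewrite /= inclusion_lift_family// incl_to_level subr0 subrr; split=> //.
  by rewrite !zoom0.
- by move=> t s /andP[t0 t1] bs; apply: bx; apply: zoom_boundary => //; rewrite subr_ge0.
Unshelve. all: by end_near. Qed.

Theorem tel_inclusion_weak_equivalence : weak_homotopy_equivalence R p.
Proof.
split.
- exact: inclusion_continuous.
- exact: joined_tel.
- move=> y; near \oo => N.
  have HN : A N (set_val y).
    suff : [set set_val y] `<=` A N by apply.
    near: N; apply: exhaust; first exact: compact_set1.
    by move=> _ ->; exact: (set_mem (valP y)).
  pose f (_ : R) := y; have H (z : R) : A N (set_val (f z)) by exact: HN.
  exists (lev AS (to_level H 0) 0); rewrite inclusion_lev incl_to_level.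
  by apply/joinedP; exists f; [exact: cst_continuous|].
- by move=> n x a b _; exact: homotopic_tel.
- by move=> n x b _; exact: spheroid_lift.
Unshelve. all: by end_near. Qed.

End WeakEquivalence.

Lemma points_equation (R : realType) (X : model_space) : exists b : bool,
  forall x, points R X x <-> b%:R * (dot x x - 1) = 0.
Proof.
case: X; [exists false|exists true] => x; first by rewrite mul0r.
rewrite mul1r dotE; split=> /= [h|/eqP]; last first.
  by rewrite subr_eq0 => /eqP <-; apply: eq_bigr => i _; rewrite expr2.
by apply/eqP; rewrite subr_eq0 -[X in _ == X]h; apply/eqP; apply: eq_bigr => i _; rewrite expr2.
Qed.

Theorem corollary4p10 (R : realType) (X : model_space)
    (g : riemannian_metric (points R X))
    (K : set (Emb (points R X))) (hK : knot_type K)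
    (cstar : Emb (points R X)) (hcstar : K cstar)
    (Lstar : R) (hLstar : Lstar%:E = Rop g cstar)
    (L : nat -> R) (hL0 : Lstar <= L 0%N)
    (hLmono : forall i, L i < L i.+1) (hLinf : L i @[i --> \oo] --> +oo) :
  weak_homotopy_equivalence R
    (tel_inclusion R
       (fun i => Rop_sublevel_le g K (hLmono i))
       (fun i => Rop_sublevel_sub g K (L i))).
Proof.
have [b HM] := points_equation R X.
apply: tel_inclusion_weak_equivalence => C cC CK.
(* The ropelength bound on [C] holds for all sufficiently large constants, and [L] tends to
   infinity. *)
have nL : \forall N \near \oo, forall c, C c -> (Rop g c <= (L N)%:E)%E.
  by exact: (hLinf _ (compact_Rop_bounded HM g cC)).
by apply: filterS nL => N HN c Cc; split; [exact: CK|exact: HN].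
Qed.
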